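(* Let $a,b$ be positive integers, $d=a+b$, and let $\phi:\mathbb{Z}^d\to\mathbb{C}$ be finitely supported with $\max_{\xi}|\widehat\phi(\xi)|=1$, this maximum being attained at exactly one point $\xi_0\in\mathbb{T}^d$. Suppose that on the domain of $\Gamma_{\xi_0}$ (an open neighborhood of $0$), $$\Gamma_{\xi_0}(\xi):=\log\left(\frac{\widehat\phi(\xi+\xi_0)}{\widehat\phi(\xi_0)}\right)=i\alpha\cdot\xi-P(\xi)+R(\xi),$$ where $\alpha\in\mathbb{R}^d$, $P$ is a positive-definite polynomial, and $R$ is a smooth complex-valued function with $R(\xi)=o(P(\xi))$ as $\xi\to0$. Suppose additionally that $$P(\xi)=P_1(\eta+Q(\zeta))+P_2(\eta),\qquad \xi=(\eta,\zeta)\in\mathbb{R}^a\times\mathbb{R}^b=\mathbb{R}^d,$$ where: (1) $P_1$ and $P_2$ are positive homogeneous functions on $\mathbb{R}^a$ with homogeneous orders $\mu_{P_1}$ and $\mu_{P_2}$; (2) $Q:\mathbb{R}^b\to\mathbb{R}^a$ is $C^1$ and nondegenerate multivariate homogeneous; (3) there exist $E_1\in\operatorname{Exp}(P_1)$, $E_2\in\operatorname{Exp}(P_2)$ and $F_1,F_2\in\operatorname{End}(\mathbb{R}^b)$ such that, for $k=1,2$, $Q$ is homogeneous with respect to the pair $(E_k,F_k)$, and such that $[E_1,E_2]=E_1E_2-E_2E_1=0$ and $\{t^{E_1-E_2}\}$ is non-expanding. Set $\mu_\phi=\mu_{P_1}+\mu_{P_2\circ(-Q)}=\operatorname{tr}E_1+\operatorname{tr}F_2$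 and $H_P^t(x)=\frac{1}{(2\pi)^d}\int_{\mathbb{R}^d}e^{-tP(\xi)}e^{-ix\cdot\xi}\,d\xi$ for $t>0$, $x\in\mathbb{R}^d$. Then for each $\epsilon>0$ there exists $N\in\mathbb{N}_+$ for which $$\left|\phi^{(n)}(x)-\widehat\phi(\xi_0)^ne^{-ix\cdot\xi_0}H_P^n(x-n\alpha)\right|<\epsilon n^{-\mu_\phi}$$ for all $n\ge N$ and $x\in\mathbb{Z}^d$. In other words, $\phi^{(n)}(x)=\widehat\phi(\xi_0)^ne^{-ix\cdot\xi_0}H_P^n(x-n\alpha)+o(n^{-\mu_\phi})$ uniformly for $x\in\mathbb{Z}^d$ as $n\to\infty$.
   Context: For finitely supported $\phi:\mathbb{Z}^d\to\mathbb{C}$: $\phi^{(1)}=\phi$ and $\phi^{(n)}(x)=\sum_{y\in\mathbb{Z}^d}\phi^{(n-1)}(x-y)\phi(y)$ for $n\ge2$; $\widehat\phi(\xi)=\sum_{x\in\mathbb{Z}^d}\phi(x)e^{ix\cdot\xi}$ for $\xi\in\mathbb{R}^d$; $\mathbb{T}^d=(-\pi,\pi]^d$; $\mathbb{N}_+=\{1,2,\dots\}$. The logarithm is the principal branch, and $\Gamma_{\xi_0}$ is defined on an open neighborhood of $0$. ''$R(\xi)=o(P(\xi))$ as $\xi\to0$'' means that for each $\epsilon>0$ there is an open neighborhood $\mathcal{O}$ of $0$ with $|R(\xi)|\le\epsilon P(\xi)$ on $\mathcal{O}$. $\operatorname{End}(\mathbb{R}^n)$ is the set of linear maps $\mathbb{R}^n\to\mathbb{R}^n$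 with the operator norm $\|\cdot\|$. For $E\in\operatorname{End}(\mathbb{R}^n)$ and $t>0$, $t^E=\exp((\ln t)E)$; the one-parameter group $\{t^E\}_{t>0}$ is contracting if $\lim_{t\to0}\|t^E\|=0$ and non-expanding if $\sup_{0<t\le1}\|t^E\|<\infty$. For $P:\mathbb{R}^n\to\mathbb{R}$, $\operatorname{Exp}(P)$ is the set of $E\in\operatorname{End}(\mathbb{R}^n)$ with $tP(\xi)=P(t^E\xi)$ for all $t>0$, $\xi\in\mathbb{R}^n$. $P$ is positive-definite if $P\ge0$ and $P(\xi)=0$ only when $\xi=0$. $P$ is positive homogeneous if it is continuous, positive-definite, $\operatorname{Exp}(P)\ne\varnothing$, and $\{\xi:P(\xi)=1\}$ is compact (equivalently, $\{t^E\}$ is contracting for some, equivalently every, $E\in\operatorname{Exp}(P)$; equivalently $P(\xi)\to\infty$ as $|\xi|\to\infty$). For such $P$, $\operatorname{tr}E$ is the same positive number for all $E\in\operatorname{Exp}(P)$; this number $\mu_P$ is the homogeneous order of $P$. A function $Q:\mathbb{R}^b\to\mathbb{R}^a$ is nondegenerate if $Q(\zeta)\ne0$ whenever $\zeta\ne0$; it is homogeneous with respect to the pair $(E,E')\in\operatorname{End}(\mathbb{R}^a)\times\operatorname{End}(\mathbb{R}^b)$ if $t^EQ(\zeta)=Q(t^{E'}\zeta)$ for all $t>0$, $\zeta\in\mathbb{R}^b$. $Q$ is nondegenerate multivariate homogeneous if it is continuous, nondegenerate, homogeneous with respect to some pair $(E,E')$ with $\{t^E\}$ contracting, and $\lim_{|\zeta|\to\infty}|Q(\zeta)|=\infty$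 (equivalently, there is a pair $(E,E')$ with respect to which $Q$ is homogeneous and both $\{t^E\}$, $\{t^{E'}\}$ are contracting). Under the hypotheses of the claim, $P_2\circ(-Q)$ is positive homogeneous on $\mathbb{R}^b$ with homogeneous order $\operatorname{tr}F_2$. *)

(* Defs.v *)
From HB Require Import structures.
From mathcomp Require Import all_boot all_order all_algebra.
From mathcomp Require Import all_classical all_reals all_analysis.
From mathcomp.real_closed Require Import complex.
(* Not imported: its notations clash with those of the analysis library. *)
From mathcomp.multinomials Require mpoly.

Set Implicit Arguments.
Unset Strict Implicit.
Unset Printing Implicit Defensive.

Import Order.TTheory GRing.Theory Num.Theory.
Import numFieldNormedType.Exports.

Local Open Scope classical_set_scope.
Local Open Scope ring_scope.
Local Open Scope complex_scope.

(* Vectors are column vectors and End(R^n) is 'M[R]_n acting by E *m v.  The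
   topology and the differentiability notions on 'cV[R]_n are the ones of the
   library, given by the sup norm; enorm and opnorm below are the Euclidean
   norm and the operator norm that it induces. *)
Section Euclidean.
Context {R : realType}.

Definition dotv n (u v : 'cV[R]_n) : R := \sum_(i < n) u i 0 * v i 0.

Definition enorm n (v : 'cV[R]_n) : R := Num.sqrt (dotv v v).

Definition opnorm n (E : 'M[R]_n) : R :=
  sup [set enorm (E *m v) | v in [set v : 'cV[R]_n | enorm v <= 1]].

Definition expmx n (A : 'M[R]_n) : 'M[R]_n :=
  limn (series (fun k => (k`!%:R)^-1 *: A ^+ k)).

(* t^E *)
Definition powmx n (t : R) (E : 'M[R]_n) : 'M[R]_n := expmx (ln t *: E).

Definition contracting n (E : 'M[R]_n) : Prop :=
  opnorm (powmx t E) @[t --> 0^'+] --> (0 : R).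

Definition nonexpanding n (E : 'M[R]_n) : Prop :=
  has_ubound [set opnorm (powmx t E) | t in [set t : R | 0 < t <= 1]].

(* C^k on a set U, which is open in all uses *)
Fixpoint Ck (V W : normedModType R) (k : nat) (U : set V) (f : V -> W) : Prop :=
  if k is k'.+1 then
    (forall x, U x -> differentiable f x) /\
    (forall v : V, Ck k' U (fun x => 'D_v f x))
  else forall x, U x -> {for x, continuous f}.

Definition smooth (V W : normedModType R) (U : set V) (f : V -> W) : Prop :=
  forall k, Ck k U f.

Definition is_polynomial n (P : 'cV[R]_n -> R) : Prop :=
  exists p : mpoly.mpoly n R,
    forall xi, P xi = mpoly.meval (fun i => xi i 0) p.

End Euclidean.

Section Homogeneous.
Context {R : realType}.

Definition positive_definite n (P : 'cV[R]_n -> R) : Prop :=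
  (forall xi, 0 <= P xi) /\ (forall xi, P xi = 0 -> xi = 0).

Definition Exp n (P : 'cV[R]_n -> R) : set 'M[R]_n :=
  [set E | forall t, 0 < t -> forall xi, t * P xi = P (powmx t E *m xi)].

Definition positive_homogeneous n (P : 'cV[R]_n -> R) : Prop :=
  [/\ continuous P, positive_definite P, Exp P !=set0
    & compact [set xi | P xi = 1]].

(* mu_P: all the elements of Exp P have the same trace when P is positive
   homogeneous, so the choice made by get is then immaterial. *)
Definition homogeneous_order n (P : 'cV[R]_n -> R) : R :=
  get [set \tr E | E in Exp P].

Definition nondegenerate a b (Q : 'cV[R]_b -> 'cV[R]_a) : Prop :=
  forall zeta, zeta != 0 -> Q zeta != 0.

Definition homogeneous_wrt a b (Q : 'cV[R]_b -> 'cV[R]_a)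
    (E : 'M[R]_a) (E' : 'M[R]_b) : Prop :=
  forall t, 0 < t -> forall zeta,
    powmx t E *m Q zeta = Q (powmx t E' *m zeta).

Definition nondegenerate_multivariate_homogeneous a b
    (Q : 'cV[R]_b -> 'cV[R]_a) : Prop :=
  [/\ continuous Q, nondegenerate Q,
      exists E E', homogeneous_wrt Q E E' /\ contracting E
    & forall M : R, exists r : R, forall zeta, r < enorm zeta ->
        M < enorm (Q zeta)].

End Homogeneous.

Section Complex.
Context {R : realType}.

Definition expi (x : R) : R[i] := cos x +i* sin x.

(* the principal argument, with values in ]-pi, pi]; Arg 0 is a junk value *)
Definition Arg (z : R[i]) : R :=
  let theta := acos (complex.Re z / Normc.normc z) in
  if 0 <= complex.Im z then theta else - theta.

Definition Log (z : R[i]) : R[i] := ln (Normc.normc z) +i* Arg z.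

End Complex.

Section Convolution.
Context {R : realType} {d : nat}.
Implicit Type phi : 'cV[int]_d -> R[i].

Definition vecZ (x : 'cV[int]_d) : 'cV[R]_d := map_mx intr x.

Definition finitely_supported phi : Prop := finite_set [set x | phi x != 0].

(* The sums \sum_(x \in setT) range over the support of the summand. *)
Definition conv phi psi : 'cV[int]_d -> R[i] :=
  fun x => \sum_(y \in setT) phi (x - y) * psi y.

(* phi^(n) for 1 <= n; the value at n = 0 is junk *)
Definition convpow phi (n : nat) : 'cV[int]_d -> R[i] :=
  iter n.-1 (fun psi => conv psi phi) phi.

Definition fourier phi (xi : 'cV[R]_d) : R[i] :=
  \sum_(x \in setT) phi x * expi (dotv (vecZ x) xi).

Definition torus : set 'cV[R]_d := [set xi | forall i, - pi < xi i 0 <= pi].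

Definition Gamma phi (xi0 xi : 'cV[R]_d) : R[i] :=
  Log (fourier phi (xi + xi0) / fourier phi xi0).

End Convolution.

(* Lebesgue measure on R^n, as the n-fold product of lebesgue_measure carried
   over to n.-tuple R, whose sigma-algebra is generated by the coordinates *)
Section LebesgueTuple.
Context {R : realType}.

Definition tuple_cons n (x : measurableTypeR R * n.-tuple (measurableTypeR R)) :
    n.+1.-tuple (measurableTypeR R) := [tuple of x.1 :: x.2].

Definition tuple_uncons n (t : n.+1.-tuple (measurableTypeR R)) :
    measurableTypeR R * n.-tuple (measurableTypeR R) := (thead t, [tuple of behead t]).

Lemma tuple_consK n : cancel (@tuple_cons n) (@tuple_uncons n).
Proof.
by case=> x t; rewrite /tuple_uncons theadE; congr pair; apply: val_inj.
Qed.

Lemma tuple_unconsK n : cancel (@tuple_uncons n) (@tuple_cons n).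
Proof. by move=> t; rewrite [RHS]tuple_eta; apply: val_inj. Qed.

Lemma measurable_tuple_cons n : measurable_fun setT (@tuple_cons n).
Proof. exact: measurable_cons. Qed.

Lemma measurable_tuple_uncons n : measurable_fun setT (@tuple_uncons n).
Proof.
apply/measurable_fun_pairP; split; first exact: measurable_tnth.
exact: measurable_behead.
Qed.

Section Step.
Local Open Scope ereal_scope.
Variables (n : nat)
  (mu : {sigma_finite_measure set (n.-tuple (measurableTypeR R)) -> \bar R}).

Definition lebesgue_cons : set (n.+1.-tuple (measurableTypeR R)) -> \bar R :=
  pushforward (lebesgue_measure \x mu) (@tuple_cons n).

Let lebesgue_cons0 : lebesgue_cons set0 = 0.
Proof. by rewrite /lebesgue_cons /pushforward preimage_set0 measure0. Qed.

Let lebesgue_cons_ge0 A : 0 <= lebesgue_cons A.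
Proof. exact: (measure_ge0 (lebesgue_measure \x mu)). Qed.

Let lebesgue_cons_sigma_additive : semi_sigma_additive lebesgue_cons.
Proof.
move=> F mF tF mUF; rewrite /lebesgue_cons /pushforward preimage_bigcup.
have mcons B : measurable B -> measurable (@tuple_cons n @^-1` B).
  by move=> mB; rewrite -[X in measurable X]setTI; exact: measurable_tuple_cons.
apply: measure_semi_sigma_additive.
- by move=> k; exact: mcons.
- apply/trivIsetP => /= i j _ _ ij; rewrite -preimage_setI.
  by move/trivIsetP : tF => /(_ _ _ _ _ ij) ->//; rewrite preimage_set0.
- by rewrite -preimage_bigcup; exact: mcons.
Qed.

HB.instance Definition _ := isMeasure.Build _ _ _ lebesgue_cons
  lebesgue_cons0 lebesgue_cons_ge0 lebesgue_cons_sigma_additive.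

Let lebesgue_cons_sigma_finite : sigma_finite setT lebesgue_cons.
Proof.
have /sigma_finiteP[F [TF ndF Foo]] := sigma_finiteT (@lebesgue_measure R).
have /sigma_finiteP[G [TG ndG Goo]] := sigma_finiteT mu.
exists (fun k => @tuple_uncons n @^-1` (F k `*` G k)).
  rewrite -preimage_bigcup (_ : \bigcup_k _ = setT) ?preimage_setT//.
  rewrite -subTset => -[x y] _.
  have [i _ Fix] : (\bigcup_i F i) x by rewrite -TF.
  have [j _ Gjy] : (\bigcup_i G i) y by rewrite -TG.
  exists (maxn i j) => //; split.
    by move: x Fix; exact/subsetPset/ndF/leq_maxl.
  by move: y Gjy; exact/subsetPset/ndG/leq_maxr.
move=> k; have [mF muF] := Foo k; have [mG muG] := Goo k.
have mFG : measurable (F k `*` G k) by exact: measurableX.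
split.
  by rewrite -[X in measurable X]setTI; exact: measurable_tuple_uncons.
rewrite /lebesgue_cons /pushforward.
rewrite (_ : _ @^-1` _ = F k `*` G k); last first.
  by rewrite -comp_preimage (_ : _ \o _ = id)//; apply/funext/tuple_consK.
by rewrite product_measure1E// lte_mul_pinfty// ge0_fin_numE.
Qed.

HB.instance Definition _ := Measure_isSigmaFinite.Build _ _ _ lebesgue_cons
  lebesgue_cons_sigma_finite.

End Step.

Fixpoint lebesgue_tuple (n : nat) :
    {sigma_finite_measure set (n.-tuple (measurableTypeR R)) -> \bar R} :=
  if n is m.+1 then lebesgue_cons (lebesgue_tuple m) else \d_([tuple]).

Definition col_of_tuple n (t : n.-tuple (measurableTypeR R)) : 'cV[R]_n :=
  \col_i tnth t i.

Definition integral_Rn n (f : 'cV[R]_n -> R[i]) : R[i] :=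
  (\int[lebesgue_tuple n]_t complex.Re (f (col_of_tuple t)))%R +i*
  (\int[lebesgue_tuple n]_t complex.Im (f (col_of_tuple t)))%R.

End LebesgueTuple.

(* H_P^t(x) *)
Definition heat_kernel {R : realType} d (P : 'cV[R]_d -> R) (t : R)
    (x : 'cV[R]_d) : R[i] :=
  (((2 * pi) ^+ d)^-1)%:C *
  integral_Rn (fun xi => (expR (- (t * P xi)))%:C * expi (- dotv x xi)).

(* Main.v *)
(* By Fourier inversion on the cube of side [2 pi] centred at [xi0],
   [(2 pi)^d phi^(n)(x)] is the integral of
   [hat phi(xi + xi0)^n e^(-i x.(xi + xi0))].  Away from [xi0] the base is at most
   some [rho < 1] in modulus, so this part decays geometrically.  Near [xi0] the
   n-th power is [hat phi(xi0)^n e^(n i alpha.xi - n P + n Rem)], and as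
   [|Rem| <= e P] it differs from its model without [Rem] by at most
   [12 e e^(-n P / 4)].  All reduces to bounding the integral of [e^(-s P)] by
   [C s^(-mu)] for [s >= 1]: the measurable bijection
     (w, z) |-> (s^(-E1) w - Q(s^(-F2) z), s^(-F2) z)
   has Jacobian [s^(-tr E1 - tr F2)] and turns [s P] into
   [P1(w) + P2(s^(E2 - E1) w - Q(z))], where [s^(E2 - E1)] stays bounded.
   Hence this sum dominates a power of [|w| + |z|] outside a ball, uniformly in [s],
   and the exponential of its opposite lies below a fixed integrable function. *)
Require Import Defs.
From HB Require Import structures.
From mathcomp Require Import all_boot all_order all_algebra perm.
From mathcomp Require Import all_classical all_reals all_analysis measurable_realfun.
From mathcomp.real_closed Require Import complex.
From mathcomp Require Import ring lra.

Set Implicit Arguments.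
Unset Strict Implicit.
Unset Printing Implicit Defensive.

Import Order.TTheory GRing.Theory Num.Theory.
Import numFieldNormedType.Exports.

Local Open Scope classical_set_scope.
Local Open Scope ring_scope.
Local Open Scope complex_scope.

(** * Matrix exponentials *)

(** The bijection is not linear, but with z fixed it moves y only by a constant vector. With z as
    the outermost variable, Tonelli reduces its Jacobian to translation invariance and two linear
    changes of variables; these come from Gaussian elimination, and [det_expmx] turns the
    determinants of s^(-E1) and s^(-F2) into powers of s. The scaling is mixed for a reason. The
    argument y + Q(z) of P1 has to become s^(-E1) w, whereas inside P2 the term Q(z) has to follow
    s^(E2), which forces F2 on z. The price is the factor s^(E2 - E1) on w: commutation makes it a
    power of 1/s, and 1/s <= 1 is exactly where non-expansion applies. Positive homogeneity only
    provides compactness of {P = 1}. Boundedness of {P <= 1}, polynomial growth in both directions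
    and a quasi-triangle inequality all have to be derived from it. The order mu is the trace of an
    arbitrarily chosen exponent. It is well defined because, for two exponents E and E', the matrix
    t^E t^(-E') preserves P, so that its determinant is at most 1 in modulus. *)

Section MatrixNorm.
Context {R : realType}.

Lemma mx_norm_coord m n (A : 'M[R]_(m, n)) i j : `|A i j| <= `|A|.
Proof.
rewrite [leRHS]/Num.Def.normr/= mx_normrE.
exact: (le_bigmax _ (fun ij : 'I_m * 'I_n => `|A ij.1 ij.2|) (i, j)).
Qed.

Lemma mx_norm_le m n (A : 'M[R]_(m, n)) c :
  0 <= c -> (forall i j, `|A i j| <= c) -> `|A| <= c.
Proof.
move=> c0 Ac; rewrite [leLHS]/Num.Def.normr/= mx_normrE.
by apply/bigmax_leP; split=> // -[i j] _ /=.
Qed.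

(** The entrywise sup norm is submultiplicative only up to the inner dimension. This is why n |A|,
    rather than |A|, is the argument of every scalar exponential that majorizes a matrix one. *)
Lemma mulmx_norm m n p (A : 'M[R]_(m, n)) (B : 'M[R]_(n, p)) :
  `|A *m B| <= n%:R * `|A| * `|B|.
Proof.
apply: mx_norm_le => [|i j]; first by rewrite !mulr_ge0.
rewrite mxE (le_trans (ler_norm_sum _ _ _))//.
rewrite (@le_trans _ _ (\sum_(k < n) `|A| * `|B|))//.
  by apply: ler_sum => k _; rewrite normrM ler_pM// mx_norm_coord.
by rewrite sumr_const card_ord -mulrA mulr_natl.
Qed.

Lemma normM n (A B : 'M[R]_n) : `|A * B| <= n%:R * `|A| * `|B|.
Proof. exact: mulmx_norm. Qed.

Lemma norm1mx n : `|1 : 'M[R]_n| <= 1.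
Proof.
apply: mx_norm_le => // i j; rewrite [1]/(1%:M) mxE.
by case: (i == j); rewrite ?normr1 ?normr0.
Qed.

Lemma normX n (A : 'M[R]_n) k : `|A ^+ k| <= (n%:R * `|A|) ^+ k.
Proof.
elim: k => [|k ih]; first by rewrite !expr0 norm1mx.
by rewrite !exprS (le_trans (normM _ _))// ler_wpM2l.
Qed.

Lemma cvg_mx_coord m n (u : nat -> 'M[R]_(m, n)) (l : 'M[R]_(m, n)) i j :
  u @ \oo --> l -> (fun k => u k i j) @ \oo --> l i j.
Proof.
by move=> ul; apply: (@cvg_comp _ _ _ u (fun A : 'M[R]_(m, n) => A i j)) ul _;
  exact: coord_continuous.
Qed.

Lemma cvg_mxP m n (u : nat -> 'M[R]_(m, n)) (l : 'M[R]_(m, n)) :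
  (forall i j, (fun k => u k i j) @ \oo --> l i j) -> u @ \oo --> l.
Proof.
move=> ul; apply/cvgrPdist_le => /= e e0; near=> k.
apply: mx_norm_le => [|i j]; first exact: ltW.
rewrite !mxE; move: i j; near: k.
apply: filter_forall => i; apply: filter_forall => j.
by move/cvgrPdist_le : (ul i j) => /(_ _ e0).
Unshelve. all: by end_near. Qed.

End MatrixNorm.

Section MatrixExp.
Context {R : realType}.

Lemma sum_triangle (V : nmodType) (g : nat -> nat -> V) N :
  \sum_(0 <= m < N) \sum_(0 <= i < m.+1) g (m - i)%N i =
  \sum_(0 <= i < N) \sum_(0 <= k < N - i) g k i.
Proof.
elim: N => [|N ih]; first by rewrite !big_nil.
rewrite big_nat_recr//= ih.
rewrite [RHS](eq_big_nat _ _ (F2 := fun i =>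
  \sum_(0 <= k < N - i) g k i + g (N - i)%N i)); last first.
  by move=> i /andP[_ iN]; rewrite subSn// big_nat_recr.
by rewrite big_split/= [X in _ = X + _]big_nat_recr//= subnn [X in _ = _ + X + _]big_nil addr0.
Qed.

Definition expmx_term n (A : 'M[R]_n) k : 'M[R]_n := (k`!%:R)^-1 *: A ^+ k.

Lemma expmx_term_le n (A : 'M[R]_n) k :
  `|expmx_term A k| <= exp_coeff (n%:R * `|A|) k.
Proof.
rewrite /expmx_term /exp_coeff/= mulrC normrZ ger0_norm ?invr_ge0//.
by rewrite ler_wpM2l ?invr_ge0// normX.
Qed.

Lemma cvg_expmx n (A : 'M[R]_n) : series (expmx_term A) @ \oo --> expmx A.
Proof.
have cA i j : cvgn (series (fun k => expmx_term A k i j)).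
  apply: normed_cvg.
  apply: (series_le_cvg _ _ _ (is_cvg_series_exp_coeff (n%:R * `|A|))) => k //=.
  - by rewrite exp_coeff_ge0 ?mulr_ge0.
  - exact: le_trans (mx_norm_coord _ _ _) (expmx_term_le _ _).
suff : series (expmx_term A) @ \oo -->
    \matrix_(i, j) limn (series (fun k => expmx_term A k i j)) by move=> /cvgP.
apply: cvg_mxP => i j; rewrite mxE.
under eq_fun do rewrite /series/= summxE.
exact: cA.
Qed.

(** What remains is the corner i + k >= N of the square i, k < N. An arbitrary ring is allowed so
    that the identity serves both the matrix series and the scalar series that majorizes it. *)
Lemma cauchy_product_tail (V : pzRingType) (x y z : nat -> V) N :
  (forall m, z m = \sum_(0 <= i < m.+1) y i * x (m - i)%N) ->
  (\sum_(0 <= i < N) y i) * (\sum_(0 <= k < N) x k) - \sum_(0 <= m < N) z m =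
  \sum_(0 <= i < N) \sum_(N - i <= k < N) y i * x k.
Proof.
move=> zE; rewrite (eq_bigr _ (fun m _ => zE m)).
rewrite (sum_triangle (fun k i => y i * x k)).
rewrite mulr_suml -sumrB big_nat [RHS]big_nat; apply: eq_bigr => i iN.
rewrite mulr_sumr (@big_cat_nat _ _ _ (N - i)%N 0 N)//= ?leq_subr//.
by rewrite [X in X - _]addrC addrK.
Qed.

Lemma fact_bin_inv m i : (i <= m)%N ->
  m`!%:R^-1 * 'C(m, i)%:R = i`!%:R^-1 * (m - i)`!%:R^-1 :> R.
Proof.
move=> im; rewrite -(bin_fact im) natrM invfM mulrAC mulVf ?mul1r.
  by rewrite natrM invfM.
by rewrite pnatr_eq0 -lt0n bin_gt0.
Qed.

Lemma expmx_termD n (A B : 'M[R]_n) m : GRing.comm A B ->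
  expmx_term (A + B) m =
  \sum_(0 <= i < m.+1) expmx_term B i * expmx_term A (m - i)%N.
Proof.
move=> AB; rewrite /expmx_term (exprDn_comm _ AB) scaler_sumr big_mkord.
apply: eq_bigr => i _; rewrite -[X in _ *: X = _]scaler_nat scalerA.
rewrite -[RHS]/(_ *m _) -scalemxAl -scalemxAr scalerA.
have im : (i <= m)%N by rewrite -ltnS.
rewrite (fact_bin_inv im); congr (_ *: _).
by rewrite -[RHS]/(_ * _); apply/commr_sym/commrX/commr_sym/commrX.
Qed.

Lemma exp_coeffD (a b : R) m : exp_coeff (a + b) m =
  \sum_(0 <= i < m.+1) exp_coeff b i * exp_coeff a (m - i)%N.
Proof.
rewrite !exp_coeffE exprDn mulr_sumr big_mkord.
apply: eq_bigr => i _; have im : (i <= m)%N by rewrite -ltnS.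
by rewrite -[X in _ * X = _]mulr_natr mulrA mulrAC (fact_bin_inv im); ring.
Qed.

(** The corner left by the product of the matrix partial sums is bounded termwise by n times the
    scalar corner [u], and [u] tends to 0 because the scalar exponential is already known to be
    multiplicative. *)
Lemma expmxD n (A B : 'M[R]_n) : GRing.comm A B ->
  expmx (A + B) = expmx B *m expmx A.
Proof.
move=> AB; set a := n%:R * `|A|; set b := n%:R * `|B|.
pose sA := series (expmx_term A); pose sB := series (expmx_term B).
pose u N := series (exp_coeff b) N * series (exp_coeff a) N -
            series (exp_coeff (a + b)) N.
have cexp (x : R) : series (exp_coeff x) @ \oo --> expR x.
  exact: is_cvg_series_exp_coeff.
have u0 : u @ \oo --> (0 : R).
  have -> : 0 = expR b * expR a - expR (a + b) by rewrite expRD mulrC subrr.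
  by apply: cvgB => //; exact: cvgM.
have le_u N : `|sB N * sA N - series (expmx_term (A + B)) N| <= n%:R * u N.
  rewrite /u /sA /sB /series/=.
  rewrite (cauchy_product_tail _ (fun m => expmx_termD m AB)).
  rewrite (cauchy_product_tail _ (fun m => exp_coeffD a b m)).
  rewrite mulr_sumr (le_trans (ler_norm_sum _ _ _))//; apply: ler_sum => i _.
  rewrite mulr_sumr (le_trans (ler_norm_sum _ _ _))//; apply: ler_sum => k _.
  by rewrite (le_trans (normM _ _))// -mulrA ler_wpM2l// ler_pM ?expmx_term_le.
apply/matrixP => i j; apply/eqP; rewrite -subr_eq0 -normr_eq0 eq_le normr_ge0 andbT.
have cAB : (fun N => `|series (expmx_term (A + B)) N i j - (sB N *m sA N) i j|)
    @ \oo --> `|expmx (A + B) i j - (expmx B *m expmx A) i j|.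
  apply: cvg_norm; apply: cvgB; first exact/cvg_mx_coord/cvg_expmx.
  rewrite mxE; under eq_fun do rewrite mxE.
  apply: cvg_big => [|k _]; first exact: add_continuous.
  apply: cvgM; apply: cvg_mx_coord; exact: cvg_expmx.
have nu0 : (fun N => n%:R * u N) @ \oo --> (0 : R).
  by rewrite -[0](mulr0 n%:R); exact: cvgMr.
apply: ler_cvg_to cAB nu0 _; near=> N.
rewrite distrC (le_trans _ (le_u N))// -[_ * _ in leRHS]/(_ *m _).
by have := mx_norm_coord (sB N *m sA N - series (expmx_term (A + B)) N) i j;
  rewrite !mxE.
Unshelve. all: by end_near. Qed.

Lemma cvg_exp_coeff (x : R) : series (exp_coeff x) @ \oo --> expR x.
Proof. exact: is_cvg_series_exp_coeff. Qed.

Lemma expmx_norm n (A : 'M[R]_n) : `|expmx A| <= expR (n%:R * `|A|).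
Proof.
apply: (ler_cvg_to (cvg_norm (@cvg_expmx n A)) (@cvg_exp_coeff _)).
apply: nearW => N; rewrite (le_trans (ler_norm_sum _ _ _))//.
by apply: ler_sum => k _; exact: expmx_term_le.
Qed.

Lemma expmx0 n : expmx 0 = 1%:M :> 'M[R]_n.
Proof.
have c0 : series (@expmx_term n 0) @ \oo --> (1%:M : 'M[R]_n).
  apply: cvg_near_cst; exists 1%N => // -[//|N] _.
  rewrite /series/= big_nat_recl// big1 ?addr0.
    by rewrite /expmx_term expr0 invr1 scale1r.
  by move=> i _; rewrite /expmx_term exprS mul0r scaler0.
by apply: cvg_unique c0 => //; exact: cvg_expmx.
Qed.

Lemma expmx_approx n (A : 'M[R]_n) : n%:R * `|A| <= 2^-1 ->
  `|expmx A - (1%:M + A)| <= 2 * (n%:R * `|A|) ^+ 2.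
Proof.
set a := n%:R * `|A| => a2.
have a0 : 0 <= a by rewrite mulr_ge0.
(* Since e^a <= 1 / (1 - a), the left side is at most a^2 / (1 - a), and a <= 1/2. *)
have e1 : expR a - (1 + a) <= 2 * a ^+ 2.
  have := expR_ge1Dx (- a); rewrite expRN => h.
  have : expR a * (1 - a) <= 1.
    by rewrite -ler_pdivlMl ?expR_gt0// mulr1.
  have := expR_gt0 a; nra.
apply: le_trans e1.
have cl : (fun N => `|series (expmx_term A) N - (1%:M + A)|) @ \oo -->
    `|expmx A - (1%:M + A)|.
  by apply: cvg_norm; apply: cvgB; [exact: cvg_expmx|exact: cvg_cst].
have cr : (fun N => series (exp_coeff a) N - (1 + a)) @ \oo -->
    expR a - (1 + a).
  by apply: cvgB; [exact: cvg_exp_coeff|exact: cvg_cst].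
apply: ler_cvg_to cl cr _; exists 2%N => // -[//|[//|N]] _ /=.
have t0 : expmx_term A 0 = 1%:M by rewrite /expmx_term expr0 invr1 scale1r.
have t1 : expmx_term A 1 = A by rewrite /expmx_term expr1 invr1 scale1r.
have r0 : exp_coeff a 0 = 1 by rewrite /exp_coeff/= expr0 divr1.
have r1 : exp_coeff a 1 = a by rewrite /exp_coeff/= expr1 divr1.
rewrite /series/= !(big_nat_recl N.+1)// !(big_nat_recl N)// t0 t1 r0 r1.
rewrite !addrA [1%:M + A + _ - _]addrAC subrr add0r.
rewrite [1 + a + _ - _]addrAC subrr add0r (le_trans (ler_norm_sum _ _ _))//.
by apply: ler_sum => k _; exact: expmx_term_le.
Qed.

End MatrixExp.

(** * The determinant of a matrix exponential *)

Section DetExp.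
Context {R : realType}.

Lemma expR_approx (y : R) : y <= 2^-1 -> `|expR y - (1 + y)| <= 2 * y ^+ 2.
Proof.
move=> y2; rewrite ger0_norm ?subr_ge0 ?expR_ge1Dx//.
have := expR_ge1Dx (- y); rewrite expRN => h.
have : expR y * (1 - y) <= 1 by rewrite -ler_pdivlMl ?expR_gt0// mulr1.
have := expR_gt0 y; nra.
Qed.

Lemma prod1D_approx (I : Type) (s : seq I) (x : I -> R) e :
  0 <= e -> e <= 1 -> (forall i, `|x i| <= e) ->
  `|\prod_(i <- s) (1 + x i) - (1 + \sum_(i <- s) x i)| <= 4 ^+ size s * e ^+ 2.
Proof.
move=> e0 e1 xe; elim: s => [|i s ih] /=.
  by rewrite !big_nil addr0 subrr normr0 expr0 mul1r exprn_ge0.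
rewrite !big_cons; set p := \prod_(_ <- _) _ in ih *.
set t := \sum_(_ <- _) _ in ih *.
have te : `|t| <= 2 ^+ size s * e.
  rewrite /t; elim: s {p t ih} => [|j s ih]; first by rewrite big_nil normr0 mulr_ge0.
  rewrite big_cons (le_trans (ler_normD _ _))//= exprS.
  have : 1 <= 2 ^+ size s :> R by rewrite exprn_ege1// ler1n.
  by have := xe j; nra.
have -> : (1 + x i) * p - (1 + (x i + t)) =
    (p - (1 + t)) * (1 + x i) + t * x i by ring.
rewrite (le_trans (ler_normD _ _))// !normrM.
have h1 : `|1 + x i| <= 2.
  by rewrite (le_trans (ler_normD _ _))// normr1; have := xe i; lra.
have h2 : `|p - (1 + t)| * `|1 + x i| <= 4 ^+ size s * e ^+ 2 * 2.
  by rewrite ler_pM.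
have h3 : `|t| * `|x i| <= 2 ^+ size s * e * e by rewrite ler_pM.
have h4 : 2 ^+ size s <= 4 ^+ size s :> R.
  by rewrite lerXn2r// ?nnegrE ?ler_nat.
have h5 : 2 ^+ size s * e * e <= 4 ^+ size s * e ^+ 2.
  by rewrite -mulrA -expr2 ler_wpM2r// exprn_ge0.
rewrite exprS; have : 0 <= 4 ^+ size s * e ^+ 2 by rewrite mulr_ge0// exprn_ge0.
by lra.
Qed.

(** In the Leibniz formula the identity permutation contributes 1 + tr D up to second order. Any
    other permutation moves two distinct indices i and s(i), so its product contains two
    off-diagonal entries of D, the other factors being at most 2. *)
Lemma det1D_approx n : exists2 C : R, 0 <= C & forall D : 'M[R]_n,
  `|D| <= 1 -> `|\det (1%:M + D) - (1 + \tr D)| <= C * `|D| ^+ 2.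
Proof.
exists ((n`! * 2 ^ n)%:R + 4 ^+ n) => [|D D1].
  by rewrite addr_ge0// exprn_ge0.
have D0 : 0 <= `|D| by [].
rewrite /determinant (bigD1 (1%g : {perm 'I_n}))//= odd_perm1 expr0 mul1r.
rewrite (eq_bigr (fun i => 1 + D i i)); last first.
  by move=> i _; rewrite perm1 !mxE eqxx.
rewrite addrAC (le_trans (ler_normD _ _))// mulrDl [leRHS]addrC lerD//.
  have := @prod1D_approx _ (index_enum 'I_n) (fun i => D i i) _ D0 D1.
  rewrite -sum1_size sum1_card card_ord; apply => i; exact: mx_norm_coord.
rewrite (le_trans (ler_norm_sum _ _ _))//.
rewrite (@le_trans _ _ (\sum_(s : {perm 'I_n}) 2 ^+ n * `|D| ^+ 2))//; last first.
  by rewrite sumr_const -[leLHS]mulr_natl card_Sn natrM natrX mulrA.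
rewrite [leRHS](bigD1 (1%g : {perm 'I_n}))//= ler_wpDl ?mulr_ge0 ?exprn_ge0//.
apply: ler_sum => s s1.
have [i si] : exists i, s i != i.
  apply/existsP; move: s1; apply: contraR; rewrite negb_exists => /forallP h.
  by apply/eqP/permP => i; rewrite perm1; apply/eqP/negPn; exact: h.
rewrite normrM normrX normrN1 expr1n mul1r.
rewrite (bigD1 i)//= (bigD1 (s i))//= !normrM mulrA.
have hD j : s j != j -> `|(1%:M + D) j (s j)| <= `|D|.
  by move=> sj; rewrite !mxE eq_sym (negbTE sj) add0r mx_norm_coord.
rewrite mulrC ler_pM// ?mulr_ge0//; last first.
  by rewrite expr2 ler_pM// hD// (inj_eq perm_inj).
rewrite normr_prod (@le_trans _ _ (\prod_(j | (j != i) && (j != s i)) 2))//.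
  apply: ler_prod => j _; rewrite normr_ge0/= mxE (le_trans (ler_normD _ _))//.
  rewrite (_ : 2 = 1 + 1 :> R)// lerD ?(le_trans (mx_norm_coord _ _ _))//.
  exact: norm1mx.
rewrite prodr_const ler_weXn2l ?ler1n//.
by rewrite -[leqRHS](card_ord n) max_card.
Qed.

(* [x] is [y ^ N] with [y = 1 + O(N^-2)] for every large N. *)
Lemma eq1_of_roots (x C : R) (N0 : nat) : 0 <= C ->
  (forall N, (N0 < N)%N -> exists2 y, x = y ^+ N & `|y - 1| <= C / N%:R ^+ 2) ->
  x = 1.
Proof.
move=> C0 h; apply/eqP; rewrite -subr_eq0 -normr_eq0 eq_le normr_ge0 andbT.
have c0 : (fun N : nat => expR (C * N.+1%:R^-1) - 1) @ \oo --> (0 : R).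
  rewrite -[X in _ --> X](subrr 1); apply: cvgB; last exact: cvg_cst.
  rewrite -[X in _ --> X]expR0 -(mulr0 C).
  apply: (@cvg_comp _ _ _ (fun N : nat => C * N.+1%:R^-1) expR); last exact: continuous_expR.
  by apply: cvgMr; exact: cvg_harmonic.
apply: (ler_cvg_to (@cvg_cst _ `|x - 1| _ _ _) c0).
exists N0 => // N /= N0N; have [y -> yC] := h N.+1 N0N.
have N1 : 0 < N.+1%:R :> R by rewrite ltr0n.
set u := y - 1 in yC; have -> : y = 1 + u by rewrite /u addrC subrK.
have le1 (k : nat) : `|(1 + u) ^+ k - 1| <= (1 + `|u|) ^+ k - 1.
  elim: k => [|k ih]; first by rewrite !expr0 !subrr normr0.
  rewrite !exprS.
  have -> : (1 + u) * (1 + u) ^+ k - 1 = (1 + u) * ((1 + u) ^+ k - 1) + u by ring.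
  rewrite (le_trans (ler_normD _ _))// normrM.
  have : `|1 + u| <= 1 + `|u| by rewrite (le_trans (ler_normD _ _))// normr1.
  have : 0 <= `|(1 + u) ^+ k - 1| by [].
  have : 0 <= `|u| by [].
  by nra.
rewrite (le_trans (le1 _))// lerD2r.
(* (1 + |u|)^(N+1) is at most e^((N+1) |u|), and |u| <= C / (N+1)^2 leaves the exponent C /
   (N+1). *)
rewrite (@le_trans _ _ (expR `|u| ^+ N.+1))//.
  by rewrite lerXn2r ?nnegrE ?addr_ge0 ?expR_ge0// expR_ge1Dx.
rewrite -expRM_natl ler_expR mulrC -ler_pdivlMr//.
by rewrite (le_trans yC)// expr2 invfM mulrA.
Qed.

Lemma expmxMn n (A : 'M[R]_n) N : expmx (N%:R *: A) = expmx A ^+ N.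
Proof.
elim: N => [|N ih]; first by rewrite scale0r expmx0.
rewrite -addn1 natrD scalerDl scale1r exprD expr1 expmxD ?ih; last first.
  by rewrite scaler_nat; exact/commr_sym/commrMn.
by rewrite -[LHS]/(_ * _) -exprS exprSr.
Qed.

Lemma det_exp n (A : 'M[R]_n) N : \det (A ^+ N) = \det A ^+ N.
Proof.
elim: N => [|N ih]; first by rewrite !expr0 det1.
by rewrite !exprS -ih -det_mulmx.
Qed.

Lemma mxtrace_norm n (A : 'M[R]_n) : `|\tr A| <= n%:R * `|A|.
Proof.
rewrite (le_trans (ler_norm_sum _ _ _))// mulr_natl.
rewrite (@le_trans _ _ (\sum_(i < n) `|A|))//; last first.
  by rewrite sumr_const card_ord.
by apply: ler_sum => i _; exact: mx_norm_coord.
Qed.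

(** With B = A / N, the number det(exp B) e^(-tr B) is 1 + O(N^-2), by the first-order expansions of
    the exponential and of the determinant. Its N-th power is det(exp A) e^(-tr A), which does not
    depend on N and so equals 1. Neither eigenvalues nor a differential equation are involved. *)
Lemma det_expmx n (A : 'M[R]_n) : \det (expmx A) = expR (\tr A).
Proof.
have [C C0 hC] := det1D_approx n.
set t := \tr A; set a := n%:R * `|A|.
have a0 : 0 <= a by rewrite mulr_ge0.
suff h1 : \det (expmx A) * expR (- t) = 1.
  by rewrite -[RHS]mul1r -h1 -mulrA -expRD addNr expR0 mulr1.
pose c := `|A| + 2 * a ^+ 2.
have c0 : 0 <= c by rewrite addr_ge0// mulr_ge0// exprn_ge0.
(* For N >= M the quantities |t| / N and a / N are at most 1/2 and c / N is at most 1, where c / N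
   bounds |exp B - 1|. The three summands of [K] are the errors of the determinant, of the trace of
   exp B - 1 and of the scalar exponential. *)
pose M := 2 * (`|t| + c + a).
pose K := (C * c ^+ 2 + n%:R * (2 * a ^+ 2) + 2 * t ^+ 2) * expR `|t|.
apply: (@eq1_of_roots _ K (Num.bound M)).
  rewrite mulr_ge0 ?expR_ge0//; have s0 x : 0 <= x ^+ 2 :> R by exact: sqr_ge0.
  have h1 := mulr_ge0 C0 (s0 c); have h2 := s0 t.
  have h3 : 0 <= n%:R * (2 * a ^+ 2) by rewrite mulr_ge0// mulr_ge0.
  lra.
move=> N MN; have N0 : (0 < N)%N by case: N MN.
have M0 : 0 <= M by rewrite mulr_ge0// addr_ge0// addr_ge0.
have {MN} MN : M <= N%:R.
  by rewrite ltW// (lt_trans (archi_boundP M0))// ltr_nat.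
pose v : R := N%:R^-1; have v0 : 0 <= v by rewrite invr_ge0.
have N1 : 0 < N%:R :> R by rewrite ltr0n.
have v1 : v <= 1 by rewrite invf_le1// ler1n.
have Mv : M * v <= 1 by rewrite ler_pdivrMr// mul1r.
pose B := v *: A; pose x := \det (expmx B).
have AB : A = N%:R *: B by rewrite scalerA mulfV ?scale1r ?gt_eqF.
have aB : n%:R * `|B| = a * v by rewrite normrZ ger0_norm// mulrCA mulrC.
have tB : \tr B = t * v by rewrite mxtraceZ mulrC.
have t0 : 0 <= `|t| by [].
have av : 0 <= a * v by rewrite mulr_ge0.
have av2 : a * v <= 2^-1.
  have : (`|t| + c) * v >= 0 by rewrite mulr_ge0// addr_ge0.
  by move: Mv; rewrite /M; nra.
have cv1 : c * v <= 1.
  have : (`|t| + a) * v >= 0 by rewrite mulr_ge0// addr_ge0.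
  have : c * v >= 0 by rewrite mulr_ge0.
  by move: Mv; rewrite /M; nra.
have tv2 : `|t| * v <= 2^-1.
  have : (c + a) * v >= 0 by rewrite mulr_ge0// addr_ge0.
  by move: Mv; rewrite /M; nra.
pose D := expmx B - 1%:M.
have DB : `|D - B| <= 2 * (a * v) ^+ 2.
  by rewrite /D -addrA -opprD -aB expmx_approx// aB.
have Dc : `|D| <= c * v.
  rewrite -(subrK B D) (le_trans (ler_normD _ _))// addrC.
  rewrite /c mulrDl lerD//; first by rewrite normrZ ger0_norm// mulrC.
  rewrite (le_trans DB)// -mulrA ler_wpM2l// exprMn ler_wpM2l ?exprn_ge0//.
  by rewrite expr2 ler_piMl.
have xD : `|x - (1 + \tr D)| <= C * c ^+ 2 * v ^+ 2.
  have -> : x = \det (1%:M + D) by rewrite /D addrC subrK.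
  rewrite (le_trans (hC _ (le_trans Dc cv1)))// -mulrA -exprMn ler_wpM2l//.
  by rewrite lerXn2r// nnegrE// mulr_ge0.
have trD : `|\tr D - t * v| <= n%:R * (2 * a ^+ 2) * v ^+ 2.
  rewrite -tB -[_ - _](raddfB (@mxtrace R n)) (le_trans (mxtrace_norm _))// -mulrA ler_wpM2l//.
  by rewrite -mulrA -exprMn.
have et : `|expR (t * v) - (1 + t * v)| <= 2 * t ^+ 2 * v ^+ 2.
  by rewrite -mulrA -exprMn expR_approx// (le_trans _ tv2)// ler_wpM2r// ler_norm.
exists (x * expR (- (t * v))).
  rewrite {1}AB expmxMn det_exp exprMn -expRM_natl mulrN; congr (_ * expR (- _)).
  by rewrite mulrCA mulfV ?mulr1 ?gt_eqF.
have -> : x * expR (- (t * v)) - 1 = (x - expR (t * v)) * expR (- (t * v)).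
  by rewrite mulrBl -expRD subrr expR0.
rewrite normrM (ger0_norm (expR_ge0 _)) -exprVn -/v /K mulrAC ler_pM ?expR_ge0//.
  have -> : x - expR (t * v) = (x - (1 + \tr D)) + (\tr D - t * v)
     - (expR (t * v) - (1 + t * v)) by ring.
  rewrite (le_trans (ler_normB _ _))// [leRHS]mulrDl [X in _ <= X + _]mulrDl.
  rewrite lerD//.
  by rewrite (le_trans (ler_normD _ _))// lerD.
by rewrite ler_expR -mulNr (le_trans (ler_norm _))// normrM normrN ger0_norm// ler_piMr.
Qed.

End DetExp.

(** * Compactness and comparison of norms on column vectors *)

Section ColumnVectors.
Context {R : realType}.

(** Heine-Borel is carried over from row vectors by transposition, an isometry for the sup norm. *)
Lemma compact_cV_ball n (K : R) : compact [set v : 'cV[R]_n | `|v| <= K].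
Proof.
pose A := [set v : 'rV[R]_n | `|v| <= K].
have trn m p (v : 'M[R]_(m, p)) : `|v^T| = `|v|.
  apply/eqP; rewrite eq_le; apply/andP; split; apply: mx_norm_le => // i j.
    by rewrite mxE mx_norm_coord.
  by have := mx_norm_coord v^T j i; rewrite mxE.
have cA : compact A.
  apply: bounded_closed_compact.
    by exists K; split; [exact: num_real|move=> M KM v /= /le_trans; apply; exact: ltW].
  apply: (@closed_comp _ _ (fun v : 'rV[R]_n => `|v|) [set x : R | x <= K]).
    by move=> v _; exact: norm_continuous.
  exact: closed_le.
have -> : [set v : 'cV[R]_n | `|v| <= K] = trmx @` A.
  apply/seteqP; split=> [v /= vK|_ [v /= vK <-]]; last by rewrite trn.
  by exists v^T; rewrite ?trmxK// /A/= trn.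
apply: continuous_compact => //; apply: continuous_subspaceT => v.
apply/(@cvgrPdist_le _ _ _ (nbhs v) (nbhs_filter v) trmx) => /= e e0.
apply: filterS (nbhsx_ballx (v : 'rV[R]_n) e e0) => w.
rewrite mx_norm_ball /ball_/= => vw; by rewrite -linearB/= trn ltW.
Qed.

Lemma closed_bounded_compact_cV n (A : set 'cV[R]_n) (K : R) :
  closed A -> (forall v, A v -> `|v| <= K) -> compact A.
Proof. by move=> cA AK; exact: subclosed_compact cA (@compact_cV_ball n K) AK. Qed.

Lemma continuous_cV_bounded n (f : 'cV[R]_n -> R) (K : R) : continuous f ->
  exists2 M, 1 <= M & forall v, `|v| <= K -> f v <= M.
Proof.
move=> cf.
have : compact (f @` [set v | `|v| <= K]).
  by apply: continuous_compact; [exact: continuous_subspaceT|exact: compact_cV_ball].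
move=> /compact_bounded[M [_ hM]].
exists (Num.max 1 (M + 1)); first by rewrite le_max lexx.
move=> v vK; rewrite le_max; apply/orP; right.
apply: le_trans (ler_norm _) _; apply: hM; first by rewrite ltrDl.
by exists v.
Qed.

Lemma norm_le_enorm n (v : 'cV[R]_n) : `|v| <= enorm v.
Proof.
apply: mx_norm_le => [|i j]; first exact: sqrtr_ge0.
rewrite ord1 /enorm /dotv -sqrtr_sqr ler_wsqrtr//.
rewrite (bigD1 i)//= expr2 lerDl sumr_ge0// => k _; exact: sqr_ge0.
Qed.

Lemma enorm_le_norm n (v : 'cV[R]_n) : enorm v <= n%:R * `|v|.
Proof.
rewrite -[leRHS]ger0_norm ?mulr_ge0// -sqrtr_sqr ler_wsqrtr// /dotv.
rewrite (@le_trans _ _ (\sum_(i < n) `|v| ^+ 2))//.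
  apply: ler_sum => i _; rewrite -expr2 -real_normK ?num_real//.
  by rewrite lerXn2r ?nnegrE ?mx_norm_coord.
rewrite sumr_const card_ord -[leLHS]mulr_natl exprMn ler_wpM2r ?exprn_ge0//.
by rewrite -natrX ler_nat; case: n {v} => // n; rewrite expnS leq_pmulr ?expn_gt0.
Qed.

Lemma norm_le_opnorm n (A : 'M[R]_n) (v : 'cV[R]_n) :
  `|A *m v| <= n%:R * opnorm A * `|v|.
Proof.
case: n A v => [|n] A v.
  rewrite (_ : A *m v = 0) ?normr0 ?mul0r//.
  by apply/matrixP => -[].
have n0 : (0 : R) < n.+1%:R by rewrite ltr0n.
have [->|v0] := eqVneq v 0; first by rewrite mulmx0 normr0 mulr0.
have nv : 0 < n.+1%:R * `|v| by rewrite mulr_gt0// normr_gt0.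
(* The Euclidean norm of v is at most (n+1) |v|, so this multiple lies in the Euclidean unit ball
   over which [opnorm] takes its supremum. *)
pose w := (n.+1%:R * `|v|)^-1 *: v.
have w1 : enorm w <= 1.
  rewrite (le_trans (enorm_le_norm _))// normrZ ger0_norm ?invr_ge0 ?(ltW nv)//.
  by rewrite mulrCA mulrC mulfV ?gt_eqF.
have vE : v = (n.+1%:R * `|v|) *: w by rewrite scalerA mulfV ?scale1r ?gt_eqF.
rewrite {1}vE -scalemxAr normrZ ger0_norm ?(ltW nv)// [leRHS]mulrAC ler_wpM2l ?(ltW nv)//.
apply: le_trans (norm_le_enorm _) _; apply: ub_le_sup; last by exists w.
(* The set has to be shown bounded, as [sup] takes a default value on unbounded sets. *)
exists (n.+1%:R * (n.+1%:R * `|A|)) => _ [u /= u1 <-].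
rewrite (le_trans (enorm_le_norm _))// ler_wpM2l//.
rewrite (le_trans (mulmx_norm _ _))// ler_piMr ?mulr_ge0//.
exact: le_trans (norm_le_enorm _) u1.
Qed.

End ColumnVectors.

Section MatrixPower.
Context {R : realType} {n : nat}.
Implicit Types (s t : R) (E : 'M[R]_n).

Lemma powmx1 E : powmx 1 E = 1%:M.
Proof. by rewrite /powmx ln1 scale0r expmx0. Qed.

Lemma comm_scale (a b : R) (A B : 'M[R]_n) : A *m B = B *m A ->
  GRing.comm (a *: A) (b *: B).
Proof.
move=> AB; rewrite /GRing.comm -![_ * _]/(_ *m _).
by rewrite -!scalemxAl -!scalemxAr AB !scalerA mulrC.
Qed.

Lemma powmxM s t E : 0 < s -> 0 < t -> powmx (s * t) E = powmx s E *m powmx t E.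
Proof.
move=> s0 t0; rewrite /powmx lnM ?posrE// addrC scalerDl expmxD//.
exact: comm_scale.
Qed.

Lemma powmxVr t E : 0 < t -> powmx t E *m powmx t^-1 E = 1%:M.
Proof. by move=> t0; rewrite -powmxM ?invr_gt0// divff ?powmx1 ?gt_eqF. Qed.

Lemma det_powmx t E : 0 < t -> \det (powmx t E) = t `^ (\tr E).
Proof. by move=> t0; rewrite det_expmx mxtraceZ /powR gt_eqF// mulrC. Qed.

Lemma powmx_norm t E : `|powmx t E| <= expR (n%:R * `|E| * `|ln t|).
Proof.
by rewrite (le_trans (expmx_norm _))// ler_expR normrZ mulrCA mulrC.
Qed.

Lemma powmx_norm_ge1 t E : 1 <= t ->
  `|powmx t E| <= t ^+ Num.bound (n%:R * `|E|).
Proof.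
move=> t1; have t0 : 0 < t by rewrite (lt_le_trans _ t1).
rewrite (le_trans (powmx_norm _ _))// ger0_norm ?ln_ge0//.
rewrite -[in leRHS](lnK t0) -expRM_natl ler_expR ler_wpM2r ?ln_ge0//.
by rewrite ltW// archi_boundP// mulr_ge0.
Qed.

End MatrixPower.

(** * Positive homogeneous functions *)

Section PositiveHomogeneous.
Context {R : realType} {n : nat}.
Variables (P : 'cV[R]_n -> R) (E : 'M[R]_n).
Hypotheses (hP : positive_homogeneous P) (hE : Exp P E).

Let cP : continuous P. Proof. by case: hP. Qed.
Let P_ge0 v : 0 <= P v. Proof. by case: hP => _ [+ _] _ _; exact. Qed.
Let P_eq0 v : P v = 0 -> v = 0. Proof. by case: hP => _ [_ +] _ _; exact. Qed.

Lemma homogeneous_powmx t v : 0 < t -> P (powmx t E *m v) = t * P v.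
Proof. by move=> t0; rewrite hE. Qed.

Lemma positive_homogeneous0 : P 0 = 0.
Proof. by have := @hE 2 (ltr0Sn _ 1) 0; rewrite mulmx0; lra. Qed.

Lemma positive_homogeneous_gt0 v : v != 0 -> 0 < P v.
Proof. by move=> v0; rewrite lt_def P_ge0 andbT; apply: contra v0 => /eqP/P_eq0/eqP. Qed.

Lemma level_set_bounded : exists2 K, 1 <= K & forall v, P v = 1 -> `|v| <= K.
Proof.
case: hP => _ _ _ /compact_bounded[M [_ hM]].
exists (Num.max 1 (M + 1)); first by rewrite le_max lexx.
move=> v v1; have := hM (M + 1); rewrite ltrDl => /(_ ltr01 v v1) /= vM.
by rewrite le_max vM orbT.
Qed.

Lemma level_set_scaling v : v != 0 -> exists2 u,
  P u = 1 & v = powmx (P v) E *m u.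
Proof.
move=> /positive_homogeneous_gt0 Pv; exists (powmx (P v)^-1 E *m v).
  by rewrite homogeneous_powmx ?invr_gt0// mulVf ?gt_eqF.
by rewrite mulmxA powmxVr// mul1mx.
Qed.

(* Writing [v = t^E u] with [P u = 1], the scalar [r] commutes with [t^E]. *)
Lemma homogeneous_scale_le : exists2 M, 1 <= M &
  forall r v, 0 <= r <= 2 -> P (r *: v) <= M * P v.
Proof.
have [K K1 hK] := level_set_bounded.
have [M M1 hM] := continuous_cV_bounded (2 * K) cP.
exists M => // r v /andP[r0 r2].
have [->|v0] := eqVneq v 0; first by rewrite scaler0 positive_homogeneous0 mulr0.
have [u u1 vE] := level_set_scaling v0.
have Pv := positive_homogeneous_gt0 v0.
rewrite [in leLHS]vE scalemxAr homogeneous_powmx// mulrC ler_wpM2r//.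
by rewrite hM// normrZ ger0_norm// ler_pM// hK.
Qed.

(* Along the ray through a large [v] with [P v < 1] the value 1 is never taken
   (IVT), so [P] stays in [[P v / M, 1]], a set bounded by homogeneity. *)
Lemma sublevel_bounded : exists2 K, 1 <= K & forall v, P v <= 1 -> `|v| <= K.
Proof.
have [K K1 hK] := level_set_bounded; exists K => // v Pv1.
rewrite leNgt; apply/negP => Kv.
have v0 : v != 0 by rewrite -normr_gt0 (le_lt_trans _ Kv)// (le_trans _ K1).
have [M M1 hM] := homogeneous_scale_le.
have Pv := positive_homogeneous_gt0 v0.
have K0 : 0 <= K by rewrite (le_trans _ K1).
(* Applying [homogeneous_scale_le] with the factor 1/r to r v shows that P stays above [s] on the
   ray r >= 1. Then [L] bounds every vector whose value lies between [s] and 1. *)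
pose s := P v / M; have M0 : 0 < M by rewrite (lt_le_trans _ M1).
have s0 : 0 < s by rewrite divr_gt0.
pose L := n%:R * expR (n%:R * `|E| * `|ln s|) * K.
have L0 : 0 <= L by rewrite !mulr_ge0// expR_ge0.
have Pr r : 1 <= r -> P (r *: v) < 1.
  move=> r1; rewrite ltNge; apply/negP => Pr1.
  have cray : continuous (fun r : R => P (r *: v)).
    move=> x; apply: (@continuous_comp _ _ _ (fun r : R => r *: v) P); last exact: cP.
    exact: scalel_continuous.
  have [||c] := @IVT _ (fun r : R => P (r *: v)) 1 r 1 r1.
  - exact: continuous_subspaceT.
  - by rewrite scale1r ge_min Pv1 le_max Pr1 orbT.
  rewrite in_itv/= => /andP[c1 _] /hK; rewrite normrZ ger0_norm ?(le_trans _ c1)//.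
  by rewrite leNgt (lt_le_trans Kv)// ler_peMl.
have bdd w : w != 0 -> s <= P w -> P w <= 1 -> `|w| <= L.
  move=> w0 sw w1; have [u u1 wE] := level_set_scaling w0.
  rewrite wE (le_trans (mulmx_norm _ _))// /L ler_pM ?hK// ?mulr_ge0//.
  rewrite ler_wpM2l// (le_trans (powmx_norm _ _))// ler_expR ler_wpM2l ?mulr_ge0//.
  have Pw := positive_homogeneous_gt0 w0.
  by rewrite !ler0_norm ?ln_le0// ?lerN2 ?ler_ln// (le_trans sw).
pose r := L + 1; have r1 : 1 <= r by rewrite lerDr.
have r0 : 0 < r by rewrite (lt_le_trans _ r1).
have rv0 : r *: v != 0 by rewrite scaler_eq0 negb_or gt_eqF.
have sr : s <= P (r *: v).
  have vE : v = r^-1 *: (r *: v) by rewrite scalerA mulVf ?scale1r ?gt_eqF.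
  rewrite /s ler_pdivrMr// mulrC {1}vE hM// invr_ge0 (ltW r0)/=.
  by rewrite (@le_trans _ _ 1)// ?invf_le1// ler1n.
have := bdd _ rv0 sr (ltW (Pr _ r1)).
rewrite leNgt normrZ ger0_norm ?(ltW r0)// => /negP; apply.
have v1 : 1 <= `|v| by rewrite (le_trans K1)// ltW.
by rewrite (@lt_le_trans _ _ r)// ?ltrDl// ler_peMr// ltW.
Qed.

(** Beyond {P <= 1}, write v = t^E u with t = P v and P u = 1; for t >= 1 the norm of t^E grows at
    most like a power of t. *)
Lemma norm_le_homogeneous : exists K, exists2 m, 1 <= K &
  forall v, `|v| <= K * (1 + P v) ^+ m.
Proof.
have [K K1 hK] := sublevel_bounded.
have K0 : 0 <= K by rewrite (le_trans _ K1).
pose m := Num.bound (n%:R * `|E|).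
exists (n.+1%:R * K), m; first by rewrite -[leLHS]mulr1 ler_pM// ler1n.
move=> v; have P1 : 1 <= 1 + P v by rewrite lerDl.
have [Pv|Pv] := leP (P v) 1.
  rewrite (le_trans (hK _ Pv))// -[leLHS]mulr1 ler_pM ?exprn_ege1//.
  by rewrite ler_peMl// ler1n.
have v0 : v != 0.
  by apply: contraTneq Pv => ->; rewrite positive_homogeneous0 ltr10.
have [u u1 vE] := level_set_scaling v0.
rewrite {1}vE (le_trans (mulmx_norm _ _))// mulrAC ler_pM ?mulr_ge0//.
  by rewrite ler_pM ?ler_nat ?leqnSn// hK// u1.
rewrite (le_trans (powmx_norm_ge1 _ (ltW Pv)))// lerXn2r ?nnegrE ?addr_ge0//.
by rewrite lerDr.
Qed.

(** A doubling argument: P(2 v) <= M P(v) with M <= 2^j, so each dyadic scale costs a factor 2^j,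
    which amounts to growth of order |v|^j. *)
Lemma homogeneous_le_norm : exists K, exists2 m, 1 <= K &
  forall v, P v <= K * (1 + `|v|) ^+ m.
Proof.
have [M M1 hM] := homogeneous_scale_le.
have [B B1 hB] := continuous_cV_bounded 1 cP.
have M0 : 0 <= M by rewrite (le_trans _ M1).
have B0 : 0 <= B by rewrite (le_trans _ B1).
pose j := Num.bound M.
have Mj : M <= 2 ^+ j by rewrite ltW// upper_nthrootP.
have main N v : 2^-1 <= `|v| -> `|v| <= 2 ^+ N -> P v <= B * (2 * `|v|) ^+ j.
  elim: N v => [|N ih] v v2 vN.
    rewrite (le_trans (hB _ vN))// ler_peMr// exprn_ege1// -ler_pdivrMl// mulr1.
    exact: v2.
  have [v1|v1] := leP `|v| 1.
    rewrite (le_trans (hB _ v1))// ler_peMr// exprn_ege1// -ler_pdivrMl// mulr1.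
    exact: v2.
  have vE : v = 2 *: (2^-1 *: v) by rewrite scalerA mulfV ?scale1r.
  have nw : `|2^-1 *: v| = 2^-1 * `|v| by rewrite normrZ ger0_norm.
  rewrite {1}vE (le_trans (hM _ _ _))// ?lexx ?ler0n//.
  rewrite (@le_trans _ _ (2 ^+ j * (B * (2 * `|2^-1 *: v|) ^+ j)))//.
    rewrite ler_pM// ih// nw; first by lra.
    by rewrite ler_pdivrMl// -exprS.
  by rewrite mulrCA -exprMn nw [2 * (2^-1 * _)]mulrA mulfV// mul1r.
exists (B * 2 ^+ j), j; first by rewrite -[leLHS]mulr1 ler_pM// exprn_ege1// ler1n.
move=> v; rewrite -mulrA -exprMn.
have [v2|v2] := leP 2^-1 `|v|.
  rewrite (le_trans (main (Num.bound `|v|) v v2 _))//.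
    by rewrite ltW// upper_nthrootP.
  rewrite ler_wpM2l// lerXn2r ?nnegrE ?mulr_ge0// ?addr_ge0//.
  by rewrite ler_wpM2l// lerDr.
rewrite (le_trans (hB _ _))//; first by lra.
rewrite ler_peMr// exprn_ege1//; have : 0 <= `|v| by []. lra.
Qed.

(** With t = P x + P y, both t^(-E) x and t^(-E) y lie in the bounded set {P <= 1}, so P is bounded
    at their sum, and homogeneity restores the factor t. *)
Lemma homogeneous_quasi_triangle : exists2 M, 1 <= M &
  forall x y, P (x + y) <= M * (P x + P y).
Proof.
have [K K1 hK] := sublevel_bounded.
have [B B1 hB] := continuous_cV_bounded (2 * K) cP.
exists B => // x y; have [t0|t0] := leP (P x + P y) 0.
  have x0 : x = 0 by apply: P_eq0; have := P_ge0 x; have := P_ge0 y; lra.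
  have y0 : y = 0 by apply: P_eq0; have := P_ge0 x; have := P_ge0 y; lra.
  by rewrite x0 y0 addr0 positive_homogeneous0 addr0 mulr0.
set t := P x + P y in t0 *; pose T := powmx t^-1 E.
have sub z : P z <= t -> `|T *m z| <= K.
  by move=> zt; rewrite hK// homogeneous_powmx ?invr_gt0// ler_pdivrMl// mulr1.
have -> : x + y = powmx t E *m (T *m x + T *m y).
  by rewrite -mulmxDr mulmxA powmxVr// mul1mx.
rewrite homogeneous_powmx// mulrC ler_wpM2r ?(ltW t0)// hB//.
by rewrite (le_trans (ler_normD _ _))// mulr_natl mulr2n lerD// sub// /t ?lerDl ?lerDr.
Qed.

Lemma homogeneous_ball : exists2 r, 0 < r & forall v, `|v| <= r -> P v <= 1.
Proof.
have /cvgrPdist_le/(_ 1 ltr01) := @cP (0 : 'cV[R]_n).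
rewrite positive_homogeneous0 => /nbhs_ballP[r /= r0 hr].
exists (r / 2) => [|v vr]; first by rewrite divr_gt0.
have := hr v; rewrite mx_norm_ball /ball_/= !sub0r !normrN ger0_norm//; apply.
by rewrite (le_lt_trans vr)// ltr_pdivrMr// ltr_pMr// ltr1n.
Qed.

(* All powers of [M] preserve the bounded neighbourhood [{P <= 1}] of 0, hence
   are bounded. *)
Lemma det_homogeneous_le1 (M : 'M[R]_n) : (forall v, P (M *m v) = P v) ->
  `|\det M| <= 1.
Proof.
move=> hM; have [K K1 hK] := sublevel_bounded.
have [r r0 hr] := homogeneous_ball.
have Mk k v : P (M ^+ k *m v) = P v.
  elim: k v => [|k ih] v; first by rewrite expr0 mul1mx.
  by rewrite exprSr -[_ * _]/(_ *m _) -mulmxA ih hM.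
have K0 : 0 <= K by rewrite (le_trans _ K1).
pose C := r^-1 * K.
have C0 : 0 <= C by rewrite mulr_ge0// invr_ge0 ltW.
have Mkb k : `|M ^+ k| <= C.
  apply: mx_norm_le => // i j.
  (* The vector r e_j lies in {P <= 1}, hence so does its image, which is r times column j of
     M^k. *)
  have : `|M ^+ k *m (r *: delta_mx j 0 : 'cV[R]_n)| <= K.
    rewrite hK// Mk hr// normrZ ger0_norm ?(ltW r0)// ler_piMr ?(ltW r0)//.
    by apply: mx_norm_le => // ? ?; rewrite mxE; case: (_ && _); rewrite ?normr1 ?normr0.
  move=> /(le_trans (mx_norm_coord _ i 0)).
  rewrite -scalemxAr -colE !mxE normrM ger0_norm ?(ltW r0)//.
  by rewrite /C ler_pdivlMl.
have [D D0 hD] : exists2 D, 0 <= D & forall k, `|\det M| ^+ k <= D.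
  exists (n`!%:R * C ^+ n) => [|k]; first by rewrite mulr_ge0// exprn_ge0.
  rewrite -normrX -det_exp /determinant (le_trans (ler_norm_sum _ _ _))//.
  rewrite (@le_trans _ _ (\sum_(s : {perm 'I_n}) C ^+ n))//; last first.
    by rewrite sumr_const card_Sn -[leLHS]mulr_natl.
  apply: ler_sum => s _; rewrite normrM normrX normrN1 expr1n mul1r normr_prod.
  rewrite (@le_trans _ _ (\prod_(i < n) C))//; last first.
    by rewrite prodr_const card_ord.
  apply: ler_prod => i _; by rewrite normr_ge0/= (le_trans (mx_norm_coord _ _ _)).
rewrite leNgt; apply/negP => d1.
pose e := `|\det M| - 1; have e0 : 0 < e by rewrite subr_gt0.
(* Bernoulli's inequality: if |det M| exceeded 1, its powers would eventually pass [D]. *)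
have bern k : 1 + e *+ k <= `|\det M| ^+ k.
  elim: k => [|k ih]; first by rewrite mulr0n addr0 expr0.
  rewrite exprS (@le_trans _ _ (`|\det M| * (1 + e *+ k)))//; last first.
    by rewrite ler_wpM2l.
  rewrite (_ : `|\det M| = 1 + e); last by rewrite /e addrC subrK.
  have : 0 <= e *+ k by rewrite mulrn_wge0// ltW.
  by rewrite mulrS; nra.
have := le_trans (bern (Num.bound (D / e))) (hD _).
rewrite -mulr_natr; have := archi_boundP (divr_ge0 D0 (ltW e0)).
by rewrite ltr_pdivrMr// mulrC; lra.
Qed.

End PositiveHomogeneous.

(** At t = e the matrix t^F t^(-G) preserves P and has determinant e^(tr F - tr G), so tr F <= tr G;
    exchanging F and G gives equality. *)
Lemma homogeneous_order_mxtrace (R : realType) n (P : 'cV[R]_n -> R) E :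
  positive_homogeneous P -> Exp P E -> homogeneous_order P = \tr E.
Proof.
move=> hP hE.
have le_tr (F G : 'M[R]_n) : Exp P F -> Exp P G -> \tr F <= \tr G.
  move=> hF hG; pose t : R := expR 1; have t0 : 0 < t by exact: expR_gt0.
  have tV0 : 0 < t^-1 by rewrite invr_gt0.
  have /(_ (powmx t F *m powmx t^-1 G)) := @det_homogeneous_le1 _ _ P F hP hF.
  rewrite det_mulmx !det_expmx !mxtraceZ lnV ?posrE// expRK mul1r mulN1r -expRD.
  rewrite ger0_norm ?expR_ge0// -[X in (_ -> is_true (_ <= X)) -> _]expR0 ler_expR subr_le0; apply.
  move=> v; rewrite -mulmxA (homogeneous_powmx hF)// (homogeneous_powmx hG)//.
  by rewrite mulrA mulfV ?mul1r// gt_eqF.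
have : [set \tr F | F in Exp P] (homogeneous_order P) by apply: getI; exists E.
by case=> F hF <-; apply/eqP; rewrite eq_le !le_tr.
Qed.

(** Identifies tr F as the homogeneous order of the composite. Its level set is compact because Q is
    bounded there, by compactness of the level set of P, while |Q| tends to infinity. *)
Lemma positive_homogeneous_comp_opp (R : realType) a b (P : 'cV[R]_a -> R)
    (Q : 'cV[R]_b -> 'cV[R]_a) E F :
  positive_homogeneous P -> nondegenerate_multivariate_homogeneous Q ->
  Exp P E -> homogeneous_wrt Q E F ->
  positive_homogeneous (fun zeta => P (- Q zeta)) /\
  Exp (fun zeta => P (- Q zeta)) F.
Proof.
move=> hP [cQ Q0 _ Qoo] hE hQ; have [cP [P0 Peq0] _ _] := hP.
have hF : Exp (fun zeta => P (- Q zeta)) F.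
  by move=> t t0 xi; rewrite -hQ// -mulmxN hE.
have cPQ : continuous (fun zeta => P (- Q zeta)).
  move=> z; apply: (@continuous_comp _ _ _ (fun z => - Q z) P); last exact: cP.
  exact/continuousN/cQ.
split => //; split => //.
- split=> // xi /Peq0/eqP; rewrite oppr_eq0 => Qxi; apply/eqP.
  by apply: contraLR Qxi => /Q0.
- by exists F.
- have [K K1 hK] := level_set_bounded hP.
  have [r hr] := Qoo (a%:R * K).
  apply: (@closed_bounded_compact_cV _ _ _ r) => [|v /= v1].
    exact: (@closed_comp _ _ (fun zeta => P (- Q zeta)) [set 1 : R]).
  rewrite (le_trans (norm_le_enorm _))// leNgt; apply/negP => /hr.
  rewrite ltNge => /negP; apply.
  by rewrite (le_trans (enorm_le_norm _))// ler_wpM2l// -normrN hK.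
Qed.

(** * Domination up to a polynomial *)

Section PolynomialDomination.
Context {R : realType} {X : Type} (D : X -> Prop).
Implicit Types f g h : X -> R.

(** Forgetting constants and exponents makes the bounds composable. The domain [D] is there to carry
    the constraint |w'| <= C |w| of the phase. *)
Definition poly_dominated f g := exists K, exists2 m,
  1 <= K & forall x, D x -> f x <= K * (1 + g x) ^+ m.

Lemma poly_dominated_le f f' g : (forall x, D x -> f x <= f' x) ->
  poly_dominated f' g -> poly_dominated f g.
Proof.
move=> ff' [K [m K1 h]]; exists K, m => // x Dx.
exact: le_trans (ff' _ Dx) (h _ Dx).
Qed.

Lemma poly_dominatedD f f' g : (forall x, 0 <= g x) ->
  poly_dominated f g -> poly_dominated f' g ->
  poly_dominated (fun x => f x + f' x) g.
Proof.
move=> g0 [K [m K1 h]] [K' [m' K1' h']]; exists (K + K'), (m + m')%N.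
  by rewrite (le_trans K1)// lerDl (le_trans _ K1').
move=> x Dx; rewrite mulrDl lerD//.
  rewrite (le_trans (h _ Dx))// ler_wpM2l ?(le_trans _ K1)//.
  by rewrite ler_weXn2l ?leq_addr// lerDl.
rewrite (le_trans (h' _ Dx))// ler_wpM2l ?(le_trans _ K1')//.
by rewrite ler_weXn2l ?leq_addl// lerDl.
Qed.

Lemma poly_dominatedZ C f g : (forall x, 0 <= g x) -> 0 <= C ->
  poly_dominated f g -> poly_dominated (fun x => C * f x) g.
Proof.
move=> g0 C0 [K [m K1 h]]; exists ((1 + C) * K), m.
  by rewrite -[leLHS]mulr1 ler_pM// lerDl.
move=> x Dx; rewrite (@le_trans _ _ (C * (K * (1 + g x) ^+ m)))//.
  by rewrite ler_wpM2l// h.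
rewrite -mulrA ler_wpM2r ?lerDr// mulr_ge0 ?(le_trans _ K1)//.
by rewrite exprn_ge0// addr_ge0.
Qed.

Lemma poly_dominated_trans f h g : (forall x, 0 <= h x) -> (forall x, 0 <= g x) ->
  poly_dominated f h -> poly_dominated h g -> poly_dominated f g.
Proof.
move=> h0 g0 [K [m K1 fh]] [K' [m' K1' hg]].
exists (K * (2 * K') ^+ m), (m' * m)%N.
  by rewrite -[leLHS]mulr1 ler_pM// exprn_ege1//; lra.
move=> x Dx; rewrite (le_trans (fh _ Dx))// -mulrA ler_wpM2l ?(le_trans _ K1)//.
rewrite exprM -exprMn lerXn2r ?nnegrE ?addr_ge0// ?mulr_ge0 ?exprn_ge0 ?addr_ge0//.
  by lra.
have g1 : 1 <= (1 + g x) ^+ m' by rewrite exprn_ege1// lerDl.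
have := hg _ Dx; nra.
Qed.

End PolynomialDomination.

Section PhaseBounds.
Context {R : realType} {a b : nat}.
Variables (P1 P2 : 'cV[R]_a -> R) (Q : 'cV[R]_b -> 'cV[R]_a).
Variables (E1 E2 : 'M[R]_a) (F2 : 'M[R]_b).
Hypotheses (hP1 : positive_homogeneous P1) (hP2 : positive_homogeneous P2).
Hypothesis hQ : nondegenerate_multivariate_homogeneous Q.
Hypotheses (hE1 : Exp P1 E1) (hE2 : Exp P2 E2) (hQ2 : homogeneous_wrt Q E2 F2).

(** The variable w' stands for s^(E2 - E1) w; keeping it free, subject only to |w'| <= C |w|, makes
    K and m independent of s. The value T controls |w| through P1, hence |w'| and P2(-w'). As -Q(z)
    = (w' - Q(z)) - w', the quasi-triangle inequality then controls P2(-Q(z)), which is itself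
    positive homogeneous in z and so controls |z|. *)
Lemma norm_le_phase (C : R) : 0 <= C -> exists K, exists2 m, 1 <= K &
  forall w w' zeta, `|w'| <= C * `|w| ->
    let T := P1 w + P2 (w' - Q zeta) in
    `|w| <= K * (1 + T) ^+ m /\ `|zeta| <= K * (1 + T) ^+ m.
Proof.
move=> C0; pose X := ('cV[R]_a * 'cV[R]_a * 'cV[R]_b)%type.
pose D (x : X) := `|x.1.2| <= C * `|x.1.1|.
pose T (x : X) := P1 x.1.1 + P2 (x.1.2 - Q x.2).
have P1_ge0 v : 0 <= P1 v by case: hP1 => _ [+ _] _ _; exact.
have P2_ge0 v : 0 <= P2 v by case: hP2 => _ [+ _] _ _; exact.
have T0 x : 0 <= T x by exact: addr_ge0.
have [hPQ hF2] := positive_homogeneous_comp_opp hP2 hQ hE2 hQ2.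
have TT : poly_dominated D T T.
  by exists 1, 1%N => // x _; rewrite mul1r expr1 lerDr.
have dw : poly_dominated D (fun x => `|x.1.1|) T.
  have [K [m K1 h]] := norm_le_homogeneous hP1 hE1.
  apply: (@poly_dominated_trans _ _ _ _ (fun x => P1 x.1.1)) => //.
    by exists K, m => // x _; exact: h.
  by apply: poly_dominated_le TT => x _; rewrite lerDl.
have dw' : poly_dominated D (fun x => P2 (- x.1.2)) T.
  have [K [m K1 h]] := homogeneous_le_norm hP2 hE2.
  apply: (@poly_dominated_trans _ _ _ _ (fun x => C * `|x.1.1|)) => //.
  - by move=> x; rewrite mulr_ge0.
  - exists K, m => // x Dx; rewrite (le_trans (h _))// ler_wpM2l ?(le_trans _ K1)//.
    by rewrite lerXn2r ?nnegrE ?addr_ge0 ?mulr_ge0// normrN lerD2l.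
  - exact: poly_dominatedZ.
have dz : poly_dominated D (fun x => `|x.2|) T.
  have [K [m K1 h]] := norm_le_homogeneous hPQ hF2.
  apply: (@poly_dominated_trans _ _ _ _ (fun x => P2 (- Q x.2))) => //.
    by exists K, m => // x _; exact: h.
  have [M M1 hM] := homogeneous_quasi_triangle hP2 hE2.
  apply: (@poly_dominated_le _ _ _ _
      (fun x => M * (P2 (x.1.2 - Q x.2) + P2 (- x.1.2)))) => [x _|].
    by rewrite (le_trans _ (hM _ _))// [_ - _ - _]addrAC subrr add0r.
  apply: poly_dominatedZ => //; first by rewrite (le_trans _ M1).
  apply: poly_dominatedD => //; apply: poly_dominated_le TT => x _.
  by rewrite lerDr.
have [K [m K1 h]] := poly_dominatedD T0 dw dz.
exists K, m => // w w' z Dw /=.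
have := h (w, w', z) Dw; rewrite /T/= => {}h.
by split; apply: le_trans h; rewrite ?lerDl ?lerDr.
Qed.

Lemma exprn_le_expR (x : R) N : 0 <= x -> x ^+ N <= N`!%:R * expR x.
Proof.
move=> x0; case: N => [|N].
  by rewrite expr0 fact0 mul1r (le_trans _ (expR_ge1Dx _))// lerDl.
rewrite -ler_pdivrMl ?ltr0n ?fact_gt0// mulrC.
by rewrite (le_trans _ (expR_ge1Dxn N x0))// lerDr.
Qed.

(* Dominates [(1 + |v|)^(-2 n)], is integrable, and factors over the coordinates. *)
Definition cauchy_prod n (v : 'cV[R]_n) : R := \prod_i (1 + v i 0 ^+ 2)^-1.

Lemma cauchy_prod_ge n (v : 'cV[R]_n) : (1 + `|v|) ^- (2 * n) <= cauchy_prod v.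
Proof.
rewrite exprM -exprVn.
have -> : ((1 + `|v|) ^+ 2)^-1 ^+ n = \prod_(i < n) ((1 + `|v|) ^+ 2)^-1.
  by rewrite prodr_const card_ord.
apply: ler_prod => i _; rewrite invr_ge0 exprn_ge0 ?addr_ge0//=.
rewrite lef_pV2 ?posrE ?exprn_gt0// ?ltr_pwDl ?sqr_ge0//.
have := mx_norm_coord v i 0; have : 0 <= `|v| by [].
rewrite -real_normK ?num_real//; have : 0 <= `|v i 0| by []; nra.
Qed.

(** Both norms being polynomially bounded by T, the product of the two [cauchy_prod] is bounded
    below by an inverse power of 1 + T, and e^(-T) decays faster than any such power. *)
Lemma expRN_phase_le (C : R) : 0 <= C -> exists2 K, 0 <= K &
  forall w w' zeta, `|w'| <= C * `|w| ->
    expR (- (P1 w + P2 (w' - Q zeta))) <= K * (cauchy_prod w * cauchy_prod zeta).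
Proof.
move=> C0; have [K [m K1 h]] := norm_le_phase C0.
have K0 : 0 <= K by rewrite (le_trans _ K1).
(* The total exponent in the two uses of [cauchy_prod_ge]. In the constant, 2 K comes from 1 + |v|
   <= 2 K (1 + T)^m, and [expR 1] from e^(-T) = e e^(-(1 + T)). *)
pose N := (2 * a + 2 * b)%N.
exists ((2 * K) ^+ N * ((m * N)`!%:R * expR 1)).
  by rewrite !mulr_ge0// ?exprn_ge0 ?mulr_ge0 ?expR_ge0.
move=> w w' z ww'; have /= [] := h _ _ z ww'; set T := P1 w + _ => hw hz.
have T0 : 0 <= T.
  by case: hP1 hP2 => _ [+ _] _ _ [_ [+ _] _ _] => ? ?; rewrite addr_ge0.
have G1 : 1 <= (1 + T) ^+ m by rewrite exprn_ege1// lerDl.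
pose G := 2 * K * (1 + T) ^+ m.
have G0 : 0 < G by rewrite !mulr_gt0 ?(lt_le_trans _ K1)// (lt_le_trans _ G1).
have cauchy_G n (v : 'cV[R]_n) : `|v| <= K * (1 + T) ^+ m ->
    G ^- (2 * n) <= cauchy_prod v.
  move=> vG; rewrite (le_trans _ (cauchy_prod_ge v))//.
  rewrite lef_pV2 ?posrE ?exprn_gt0// ?ltr_pwDl//.
  rewrite lerXn2r ?nnegrE ?addr_ge0 ?(ltW G0)//.
  by move: vG; rewrite /G -mulrA; nra.
rewrite (@le_trans _ _ ((2 * K) ^+ N * ((m * N)`!%:R * expR 1) * G ^- N))//.
  rewrite ler_pdivlMr ?exprn_gt0// [G ^+ N]exprMn -exprM mulrCA ler_wpM2l//.
    by rewrite exprn_ge0// mulr_ge0.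
  have -> : expR (- T) = expR 1 * expR (- (1 + T)).
    by rewrite -expRD; congr expR; ring.
  rewrite -mulrA [leRHS]mulrC ler_wpM2l ?expR_ge0// expRN ler_pdivrMl ?expR_gt0// mulrC.
  by rewrite exprn_le_expR// addr_ge0.
rewrite ler_wpM2l//.
  by rewrite !mulr_ge0// ?exprn_ge0 ?mulr_ge0 ?expR_ge0.
rewrite /N exprD invfM ler_pM ?invr_ge0 ?exprn_ge0 ?(ltW G0)//; exact: cauchy_G.
Qed.

End PhaseBounds.

(** * Change of variables for Lebesgue measure *)

Section LebesgueLine.
Context {R : realType}.
Local Notation mu := (@lebesgue_measure R).

(** The image of Lebesgue measure under x |-> d x + c, multiplied by |d|, agrees with it on
    half-open intervals, which determine it. For d < 0 the preimage of such an interval is open at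
    the other end but has the same length. *)
Lemma ge0_integral_affine (d c : R) (f : measurableTypeR R -> \bar R) : d != 0 ->
  measurable_fun setT f -> (forall x, 0 <= f x)%E ->
  (\int[mu]_x f (d * x + c)%R = `|d|^-1%:E * \int[mu]_x f x)%E.
Proof.
move=> d0 mf f0.
pose phi (x : measurableTypeR R) : measurableTypeR R := d * x + c.
have mphi : measurable_fun setT phi.
  by apply: measurable_funD => //; exact: measurable_funM.
have nd : 0 < `|d| by rewrite normr_gt0.
pose k : {nonneg R} := NngNum (normr_ge0 d).
pose nu : {measure set (measurableTypeR R) -> \bar R} :=
  measure_function_pushforward__canonical__measure_function_Measure mu mphi.
have -> : (\int[mu]_x f x = \int[mscale k nu]_x f x)%E.
  apply: eq_measure_integral => A mA _; apply: lebesgue_measure_unique => // X.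
  case=> -[a b] _ <-.
  rewrite -[RHS]/(`|d|%:E * mu (phi @^-1` `]a, b]))%E lebesgue_measure_itv/=.
  have [dgt0|dlt0] := ltP 0 d.
    have -> : phi @^-1` `]a, b] = `](a - c) / d, (b - c) / d]%classic.
      apply/seteqP; split => x /=; rewrite !in_itv/= /phi;
        by rewrite ltr_pdivrMr// ler_pdivlMr// ltrBlDr lerBrDr mulrC.
    rewrite lebesgue_measure_itv/= !lte_fin ltr_pM2r ?invr_gt0// ltrD2r.
    case: ifPn => _; last by rewrite mule0.
    rewrite ger0_norm ?(ltW dgt0)// -!EFinB -EFinM -mulrBl mulrC divfK//.
    by congr EFin; ring.
  have {}dlt0 : d < 0 by rewrite lt_neqAle d0.
  have -> : phi @^-1` `]a, b] = `[(b - c) / d, (a - c) / d[%classic.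
    apply/seteqP; split => x /=; rewrite !in_itv/= /phi;
      by rewrite ltr_ndivlMr// ler_ndivrMr// ltrBlDr lerBrDr mulrC andbC.
  rewrite lebesgue_measure_itv/= !lte_fin ltr_nM2r ?invr_lt0// ltrD2r.
  case: ifPn => _; last by rewrite mule0.
  rewrite ltr0_norm// -!EFinB -EFinM -mulrBl mulNr [_ / d]mulrC mulVKf//.
  by congr EFin; ring.
rewrite ge0_integral_mscale// muleA -EFinM mulVf ?gt_eqF// mul1e.
rewrite ge0_integral_pushforward//.
Qed.
End LebesgueLine.

Section LebesgueColumn.
Context {R : realType}.
Local Notation mu := (@lebesgue_measure R).
Local Notation RT := (measurableTypeR R).

Definition tuple_of_col n (v : 'cV[R]_n) : n.-tuple RT := [tuple v i 0 | i < n].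

Lemma tuple_of_colK n : cancel (@tuple_of_col n) (@col_of_tuple R n).
Proof.
by move=> v; apply/matrixP => i j; rewrite mxE tnth_mktuple (ord1 j).
Qed.

Lemma col_of_tuple_cons n (x : RT) (t : n.-tuple RT) :
  col_of_tuple (tuple_cons (x, t)) = col_mx (x%:M : 'cV_1) (col_of_tuple t).
Proof.
apply/matrixP => i j; rewrite mxE (ord1 j).
case: (split_ordP (m := 1) i) => k ->; rewrite ?(@col_mxEu _ 1 n 1) ?(@col_mxEd _ 1 n 1).
  by rewrite (tnth_nth 0) (ord1 k) mxE eqxx mulr1n.
by rewrite mxE !(tnth_nth 0).
Qed.

Section Integral.
Local Open Scope ereal_scope.

(* Column vectors carry no sigma-algebra here, so measurability and integrals of
   functions on them go through [col_of_tuple]. *)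
Definition mcol n (F : 'cV[R]_n -> \bar R) :=
  measurable_fun [set: n.-tuple RT] (F \o @col_of_tuple R n).

Definition Icol n (F : 'cV[R]_n -> \bar R) :=
  \int[@lebesgue_tuple R n]_t F (col_of_tuple t).

Lemma measurable_affine m n (A : 'M[R]_(m, n)) (c : 'cV[R]_m) :
  measurable_fun [set: n.-tuple RT]
    (fun t => tuple_of_col (A *m col_of_tuple t + c)%R).
Proof.
apply/measurable_fun_tnthP => i.
rewrite (_ : _ \o _ = fun t : n.-tuple RT =>
   (\sum_(j < n) A i j * tnth t j + c i 0)%R); last first.
  apply/funext => t /=; rewrite tnth_mktuple !mxE; congr (_ + _)%R.
  by apply: eq_bigr => j _; rewrite mxE.
apply: measurable_funD => //; apply: measurable_sum => j.
by apply: measurable_funM => //; exact: measurable_tnth.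
Qed.

Lemma mcol_affine m n (F : 'cV[R]_m -> \bar R) (A : 'M[R]_(m, n)) c :
  mcol F -> mcol (fun v => F (A *m v + c)%R).
Proof.
move=> mF; rewrite /mcol (_ : _ \o _ = (F \o @col_of_tuple R m) \o
    (fun t : n.-tuple RT => tuple_of_col (A *m col_of_tuple t + c)%R)).
  by apply: measurableT_comp => //; exact: measurable_affine.
by apply/funext => t /=; rewrite tuple_of_colK.
Qed.

Lemma mcol_cons n (F : 'cV[R]_(1 + n) -> \bar R) : mcol F ->
  measurable_fun [set: RT * n.-tuple RT]
    (fun p => F (col_mx p.1%:M (col_of_tuple p.2))).
Proof.
move=> mF; rewrite (_ : (fun p : RT * n.-tuple RT => _) =
    (F \o @col_of_tuple R (1 + n)) \o @tuple_cons R n).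
  by apply: measurableT_comp => //; exact: measurable_tuple_cons.
by apply/funext => -[x t] /=; rewrite -col_of_tuple_cons.
Qed.

Lemma Icol_prod n (F : 'cV[R]_(1 + n) -> \bar R) : mcol F -> (forall v, 0 <= F v) ->
  Icol F = \int[mu \x @lebesgue_tuple R n]_p F (col_mx p.1%:M (col_of_tuple p.2)).
Proof.
move=> mF F0.
pose nu : {measure set (n.+1.-tuple RT) -> \bar R} :=
  measure_function_pushforward__canonical__measure_function_Measure
    (mu \x @lebesgue_tuple R n)%E (@measurable_tuple_cons R n).
rewrite /Icol (@eq_measure_integral _ _ _ _ nu)//.
rewrite ge0_integral_pushforward//; last exact: measurable_tuple_cons.
by rewrite preimage_setT; apply: eq_integral => -[x t] _ /=; rewrite -col_of_tuple_cons.
Qed.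

Lemma Icol_cons n (F : 'cV[R]_(1 + n) -> \bar R) : mcol F -> (forall v, 0 <= F v) ->
  Icol F = \int[mu]_x Icol (fun v => F (col_mx x%:M v)).
Proof.
move=> mF F0; rewrite Icol_prod// fubini_tonelli1//.
exact: (mcol_cons mF).
Qed.

Lemma Icol_consC n (F : 'cV[R]_(1 + n) -> \bar R) : mcol F -> (forall v, 0 <= F v) ->
  Icol F = Icol (fun v => \int[mu]_x F (col_mx x%:M v)).
Proof.
move=> mF F0; rewrite Icol_prod// fubini_tonelli2//.
exact: (mcol_cons mF).
Qed.

Lemma measurable_Icol_cons n (F : 'cV[R]_(1 + n) -> \bar R) :
  mcol F -> (forall v, 0 <= F v) ->
  measurable_fun [set: RT] (fun x => Icol (fun v => F (col_mx x%:M v))).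
Proof.
move=> mF F0; apply: (@measurable_fun_fubini_tonelli_F _ _ _ _ _ (lebesgue_tuple n)
  (fun p : RT * n.-tuple RT => F (col_mx p.1%:M (col_of_tuple p.2)))) => //.
exact: mcol_cons.
Qed.

Lemma mcol_integral_cons n (F : 'cV[R]_(1 + n) -> \bar R) :
  mcol F -> (forall v, 0 <= F v) ->
  mcol (fun v => \int[mu]_x F (col_mx x%:M v)).
Proof.
move=> mF F0; apply: (@measurable_fun_fubini_tonelli_G _ _ _ _ _ mu
  (fun p : RT * n.-tuple RT => F (col_mx p.1%:M (col_of_tuple p.2)))) => //.
exact: mcol_cons.
Qed.

Lemma mcol_pair1 n (F : 'cV[R]_(1 + n) -> \bar R) x :
  mcol F -> mcol (fun v => F (col_mx x%:M v)).
Proof. by move=> /mcol_cons/(measurable_fun_pair2 x). Qed.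

Lemma mcol_pair2 n (F : 'cV[R]_(1 + n) -> \bar R) v :
  mcol F -> measurable_fun [set: RT] (fun x => F (col_mx x%:M v)).
Proof.
by move=> /mcol_cons/(measurable_fun_pair1 (tuple_of_col v)) /=; rewrite tuple_of_colK.
Qed.

Lemma Icol_translate n (F : 'cV[R]_n -> \bar R) c : mcol F -> (forall v, 0 <= F v) ->
  Icol (fun v => F (v + c)%R) = Icol F.
Proof.
elim: n F c => [|n ih] F c mF F0.
  by apply: eq_integral => t _; congr F; apply/matrixP => -[].
move: F c mF F0; rewrite -[n.+1]/(1 + n)%N => F c mF F0.
have mFc : mcol (fun v => F (v + c)%R).
  have := @mcol_affine _ _ F 1%:M c mF.
  by rewrite (_ : (fun v => _) = (fun v => F (v + c)%R))//; apply/funext => v; rewrite mul1mx.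
pose c0 : R := usubmx c ord0 ord0; pose c' := dsubmx c.
have cE : c = col_mx (c0%:M : 'cV_1) c'.
  by rewrite -mx11_scalar vsubmxK.
rewrite (Icol_cons mFc (fun v => F0 _)) (Icol_cons mF F0).
under eq_integral => x _.
  rewrite (_ : Icol _ = Icol (fun v => F (col_mx (1 * x + c0)%R%:M v))); last first.
    rewrite -(ih (fun v => F (col_mx (1 * x + c0)%R%:M v)) c')//.
    - rewrite mul1r; congr Icol; apply/funext => v; congr F.
      by rewrite cE add_col_mx raddfD.
    - exact: mcol_pair1.
  over.
rewrite (@ge0_integral_affine _ 1 c0 (fun x => Icol (fun v => F (col_mx x%:M v))))//.
- by rewrite normr1 invr1 mul1e.
- exact: measurable_Icol_cons.
- by move=> x; exact: integral_ge0.
Qed.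

End Integral.
End LebesgueColumn.

(** * Linear changes of variables *)

Section LinearChange.
Context {R : realType}.
Local Notation mu := (@lebesgue_measure R).
Local Open Scope ereal_scope.

Lemma Icol_ge0 n (F : 'cV[R]_n -> \bar R) : (forall v, 0 <= F v) -> 0 <= Icol F.
Proof. by move=> F0; exact: integral_ge0. Qed.

Lemma IcolZl n (F : 'cV[R]_n -> \bar R) (k : R) : mcol F -> (forall v, 0 <= F v) ->
  (0 <= k)%R -> Icol (fun v => k%:E * F v) = k%:E * Icol F.
Proof. by move=> mF F0 k0; rewrite /Icol ge0_integralZl. Qed.

Lemma mcol_mulmx m n (F : 'cV[R]_m -> \bar R) (A : 'M[R]_(m, n)) :
  mcol F -> mcol (fun v => F (A *m v)).
Proof.
move=> /(mcol_affine A 0); rewrite (_ : (fun v => _) = (fun v => F (A *m v)))//.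
by apply/funext => v; rewrite addr0.
Qed.

Definition change_of_var n (M : 'M[R]_n) := forall F : 'cV[R]_n -> \bar R,
  mcol F -> (forall v, 0 <= F v) ->
  Icol (fun v => F (M *m v)) = (`|\det M|^-1)%:E * Icol F.

Lemma change_of_varM n (A B : 'M[R]_n) :
  change_of_var A -> change_of_var B -> change_of_var (A *m B).
Proof.
move=> hA hB F mF F0; under [Icol _]eq_integral do rewrite -mulmxA.
rewrite -/(Icol (fun v => F (A *m (B *m v)))) (hB (fun v => F (A *m v)))//.
  by rewrite hA// muleA -EFinM det_mulmx normrM invfM mulrC.
exact: mcol_mulmx.
Qed.

Lemma change_of_var1 n : change_of_var (1%:M : 'M[R]_n).
Proof.
move=> F mF F0; rewrite det1 normr1 invr1 mul1e.
by apply: eq_integral => t _; rewrite mul1mx.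
Qed.

(** The first coordinate is integrated innermost: with the others fixed in v, it undergoes the
    affine map x |-> d x + r v, and only B remains to act on v. *)
Lemma change_of_var_ublock n (d : R) (r : 'rV[R]_n) (B : 'M[R]_n) : (d != 0)%R ->
  change_of_var B -> change_of_var (block_mx d%:M r 0 B : 'M[R]_(1 + n)).
Proof.
move=> d0 hB F mF F0.
pose G w := \int[mu]_x F (col_mx x%:M w).
have mG : mcol G by exact: mcol_integral_cons.
have G0 w : 0 <= G w by exact: integral_ge0.
rewrite (Icol_consC (mcol_mulmx _ mF) (fun v => F0 _)).
rewrite (_ : Icol _ = Icol (fun v => `|d|^-1%:E * G (B *m v))).
  rewrite IcolZl ?invr_ge0//; last exact: mcol_mulmx.
  rewrite hB// muleA -EFinM det_ublock det_scalar1 normrM invfM.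
  by rewrite -Icol_consC.
congr Icol; apply/funext => v.
rewrite -(@ge0_integral_affine _ d ((r *m v) 0 0)%R (fun x => F (col_mx x%:M (B *m v))))//.
  apply: eq_integral => x _; congr F.
  rewrite mul_block_col mul0mx add0r; congr col_mx.
  by rewrite [X in (_ + X)%R]mx11_scalar -scalar_mxM raddfD.
exact: mcol_pair2.
Qed.

(** The first coordinate is integrated outermost: with x fixed, the others are merely translated by
    c x. *)
Lemma change_of_var_shear n (c : 'cV[R]_n) :
  change_of_var (block_mx 1%:M 0 c 1%:M : 'M[R]_(1 + n)).
Proof.
move=> F mF F0; rewrite det_lblock !det1 mulr1 normr1 invr1 mul1e.
rewrite (Icol_cons (mcol_mulmx _ mF) (fun v => F0 _)).
rewrite (Icol_cons mF F0); apply: eq_integral => x _.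
rewrite -(@Icol_translate _ _ (fun v => F (col_mx x%:M v)) (c *m x%:M))//.
  congr Icol; apply/funext => v; congr F.
  by rewrite mul_block_col !mul1mx mul0mx addr0 addrC.
exact: mcol_pair1.
Qed.

(** Gaussian elimination on the first column, by induction on the dimension. A vanishing pivot is
    repaired by adding another row to the first one, which avoids permutation matrices. *)
Lemma change_of_var_unitmx n (M : 'M[R]_n) : M \in unitmx -> change_of_var M.
Proof.
elim: n M => [|n ih] M uM.
  move=> F mF F0; rewrite det_mx00 normr1 invr1 mul1e.
  by apply: eq_integral => t _; congr F; apply/matrixP => -[].
move: M uM; rewrite -[n.+1]/(1 + n)%N => M uM.
have pivot (N : 'M[R]_(1 + n)) : N \in unitmx -> (ulsubmx N 0 0 != 0)%R ->
    change_of_var N.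
  move=> uN a0; set a := (ulsubmx N 0 0)%R in a0.
  (* The Schur complement of the pivot, invertible since det N = a det B'. *)
  pose B' := (drsubmx N - (a^-1 *: dlsubmx N) *m ursubmx N)%R.
  have NE : N = (block_mx 1%:M 0 (a^-1 *: dlsubmx N) 1%:M : 'M[R]_(1 + n)) *m
                (block_mx a%:M (ursubmx N) 0 B' : 'M[R]_(1 + n)).
    rewrite mulmx_block !mul1mx !mul0mx !addr0 -[LHS]submxK.
    rewrite [ulsubmx N]mx11_scalar -/a; congr block_mx.
      by rewrite mul_mx_scalar scalerA mulfV// scale1r.
    by rewrite /B' addrC subrK.
  have uB : B' \in unitmx.
    move: uN; rewrite !unitmxE NE det_mulmx det_lblock det_ublock !det1 !mul1r.
    by rewrite det_scalar1 unitrM => /andP[].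
  rewrite NE; apply: change_of_varM; first exact: change_of_var_shear.
  by apply: change_of_var_ublock => //; exact: ih.
have [a0|] := eqVneq (ulsubmx M 0 0)%R 0%R; last exact: pivot.
(* Otherwise the first column would vanish and M would kill the first basis vector. *)
have [i ci] : exists i, (dlsubmx M i 0 != 0)%R.
  apply/existsP; move: uM; apply: contraTT; rewrite negb_exists => /forallP c0.
  apply/negP => uM; have : M *m (col_mx 1%:M 0 : 'cV[R]_(1 + n)) = 0%R.
    rewrite -[M]submxK mul_block_col !mulmx0 !addr0 !mulmx1.
    rewrite -[RHS](@col_mx0 _ 1 n 1); congr col_mx; apply/matrixP => j k.
      by rewrite (ord1 j) (ord1 k) a0 mxE.
    by rewrite (ord1 k) [RHS]mxE; apply/eqP/negPn; exact: c0.
  move=> /(congr1 (mulmx (invmx M))); rewrite mulKmx// mulmx0.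
  move=> /(congr1 (@usubmx _ 1 n 1)); rewrite col_mxKu linear0.
  by move=> /matrixP/(_ 0 0)%R/eqP; rewrite !mxE eqxx oner_eq0.
(* Left multiplication by [S e] adds e times row i of the lower block to the first row, so [S 1]
   makes the pivot nonzero. *)
pose S (e : R) : 'M[R]_(1 + n) := block_mx 1%:M (e *: delta_mx ord0 i) 0 1%:M.
have SK : S (-1)%R *m S 1%R = 1%:M.
  rewrite /S mulmx_block !mul1mx !mulmx1 !mul0mx !mulmx0 !addr0 !add0r.
  by rewrite scale1r scaleN1r subrr -scalar_mx_block.
have -> : M = S (-1)%R *m (S 1%R *m M) by rewrite mulmxA SK mul1mx.
have uS : S 1%R \in unitmx by rewrite unitmxE det_ublock !det1 mulr1 unitr1.
apply: change_of_varM.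
  by apply: change_of_var_ublock; [exact: oner_neq0|exact: change_of_var1].
apply: pivot; first by rewrite unitmx_mul uS.
rewrite -[M]submxK /S mulmx_block block_mxKul mul1mx mxE a0 add0r scale1r.
by rewrite -rowE mxE.
Qed.

End LinearChange.

(** * Splitting the coordinates into two blocks *)

Section Concatenation.
Context {R : realType}.
Local Notation mu := (@lebesgue_measure R).
Local Notation RT := (measurableTypeR R).

Lemma measurable_col_mx d (T : measurableType d) a b (g : T -> a.-tuple RT)
    (h : T -> b.-tuple RT) : measurable_fun setT g -> measurable_fun setT h ->
  measurable_fun setT
    (fun x => tuple_of_col (col_mx (col_of_tuple (g x)) (col_of_tuple (h x)))).
Proof.
move=> /measurable_fun_tnthP mg /measurable_fun_tnthP mh.
apply/measurable_fun_tnthP => i; case: (split_ordP i) => k ->.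
  rewrite (_ : _ \o _ = (@tnth _ _)^~ k \o g); first exact: mg.
  by apply/funext => x /=; rewrite tnth_mktuple col_mxEu mxE.
rewrite (_ : _ \o _ = (@tnth _ _)^~ k \o h); first exact: mh.
by apply/funext => x /=; rewrite tnth_mktuple col_mxEd mxE.
Qed.

Local Open Scope ereal_scope.

Lemma mcol_comp d (T : measurableType d) n (F : 'cV[R]_n -> \bar R) (g : T -> n.-tuple RT) :
  mcol F -> measurable_fun setT g -> measurable_fun setT (fun x => F (col_of_tuple (g x))).
Proof. by move=> mF mg; exact: (measurableT_comp mF mg). Qed.

Lemma mcol_cat d (T : measurableType d) a b (F : 'cV[R]_(a + b) -> \bar R)
    (g : T -> a.-tuple RT) (h : T -> b.-tuple RT) :
  mcol F -> measurable_fun setT g -> measurable_fun setT h ->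
  measurable_fun setT (fun x => F (col_mx (col_of_tuple (g x)) (col_of_tuple (h x)))).
Proof.
move=> mF mg mh; have := mcol_comp mF (measurable_col_mx mg mh).
by under eq_fun do rewrite tuple_of_colK.
Qed.

Lemma mcol_Icol_cat a b (F : 'cV[R]_(a + b) -> \bar R) :
  mcol F -> (forall v, 0 <= F v) ->
  mcol (fun z => Icol (fun y => F (col_mx y z))).
Proof.
move=> mF F0.
apply: (@measurable_fun_fubini_tonelli_F _ _ _ _ _ (lebesgue_tuple a)
  (fun p : b.-tuple RT * a.-tuple RT =>
     F (col_mx (col_of_tuple p.2) (col_of_tuple p.1)))) => //.
exact: mcol_cat.
Qed.

Lemma col_mx_assoc1 a b (x : 'cV[R]_1) (y : 'cV[R]_a) (z : 'cV[R]_b) :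
  col_mx x (col_mx y z) = col_mx (col_mx x y) z :> 'cV[R]_(1 + (a + b)).
Proof. by rewrite col_mxA castmx_id. Qed.

Lemma Icol0 (F : 'cV[R]_0 -> \bar R) : Icol F = F 0%R.
Proof.
rewrite /Icol (_ : (fun t => _) = cst (F 0%R)).
  by rewrite integral_dirac// diracT mul1e.
by apply/funext => t /=; congr F; apply/matrixP => -[].
Qed.

(** The lower block z is outermost so that, in the phase integral, Q(z) is constant during the
    integration over y. *)
Lemma Icol_cat a b (F : 'cV[R]_(a + b) -> \bar R) :
  mcol F -> (forall v, 0 <= F v) ->
  Icol F = Icol (fun z => Icol (fun y => F (col_mx y z))).
Proof.
elim: a F => [|a ih] F mF F0.
  apply: eq_integral => t _.
  rewrite Icol0; congr F.
  apply/matrixP => i j; have -> : i = rshift 0 i by exact: val_inj.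
  by rewrite (@col_mxEd _ 0 b 1); congr (col_of_tuple t _ j); exact: val_inj.
move: F mF F0; rewrite -[(a.+1 + b)%N]/(1 + (a + b))%N => F mF F0.
rewrite (Icol_cons mF F0).
under eq_integral => x _ do rewrite (ih _ (mcol_pair1 _ mF) (fun v => F0 _)).
(* The coordinate x has to move inside the integral over z; the integral over y is therefore taken
   as a function of the pair (x, z), whose joint measurability Tonelli requires. *)
pose f (p : RT * b.-tuple RT) := Icol (fun y : 'cV[R]_a =>
  F (col_mx p.1%:M (col_mx y (col_of_tuple p.2)))).
have mf : measurable_fun setT f.
  apply: (@measurable_fun_fubini_tonelli_F _ _ _ _ _ (lebesgue_tuple a)
    (fun q : (RT * b.-tuple RT) * a.-tuple RT =>
     F (col_mx q.1.1%:M (col_mx (col_of_tuple q.2) (col_of_tuple q.1.2))))) => //.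
  pose h (q : (RT * b.-tuple RT) * a.-tuple RT) :=
    tuple_cons (q.1.1, tuple_of_col (col_mx (col_of_tuple q.2) (col_of_tuple q.1.2))).
  have mh : measurable_fun setT h.
    apply: (measurableT_comp (@measurable_tuple_cons R (a + b))).
    apply: measurable_fun_pair; first by apply: measurableT_comp.
    by apply: measurable_col_mx => //; exact: measurableT_comp.
  have := mcol_comp (mF : @mcol R (a + b).+1 F) mh.
  by under eq_fun do rewrite /h col_of_tuple_cons tuple_of_colK.
rewrite -[LHS]/(\int[mu]_x \int[lebesgue_tuple b]_z f (x, z)).
rewrite (fubini_tonelli f mf); last by move=> p; exact: Icol_ge0.
apply: eq_integral => z _.
pose G (y : 'cV[R]_(1 + a)) := F (col_mx y (col_of_tuple z)).
have mG : mcol G.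
  exact: (@mcol_cat _ _ (1 + a) b F id (fun=> z)).
transitivity (Icol G) => //.
rewrite (Icol_cons mG (fun v => F0 _)); apply: eq_integral => x _.
by congr Icol; apply/funext => y; rewrite /f/= col_mx_assoc1.
Qed.

Lemma cauchy_prod_cons n (x : R) (v : 'cV[R]_n) :
  cauchy_prod (col_mx x%:M v : 'cV[R]_(1 + n)) = ((oneDsqr x)^-1 * cauchy_prod v)%R.
Proof.
rewrite /cauchy_prod big_ord_recl /=; congr (_ * _)%R.
  have -> : ord0 = lshift n (0%R : 'I_1) by exact: val_inj.
  by rewrite (@col_mxEu _ 1 n 1) mxE eqxx mulr1n.
apply: eq_bigr => i _; have -> : lift ord0 i = rshift 1 i by exact: val_inj.
by rewrite (@col_mxEd _ 1 n 1).
Qed.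

Lemma cauchy_prod_ge0 n (v : 'cV[R]_n) : (0 <= cauchy_prod v)%R.
Proof. by apply: prodr_ge0 => i _; rewrite invr_ge0 addr_ge0// sqr_ge0. Qed.

Lemma measurable_oneDsqrV : measurable_fun [set: RT] (fun x => (oneDsqr x)^-1%R).
Proof.
by have := continuous_measurable_fun (@continuous_oneDsqrV R); exact.
Qed.

Lemma measurable_cauchy_prod n :
  measurable_fun [set: n.-tuple RT] (fun t => cauchy_prod (col_of_tuple t)).
Proof.
apply: measurable_prod => i _.
rewrite (_ : (fun t : n.-tuple RT => _) = (fun x => (oneDsqr x)^-1%R) \o (@tnth n RT)^~ i).
  by apply: measurableT_comp; [exact: measurable_oneDsqrV|exact: measurable_tnth].
by apply/funext => t /=; rewrite mxE.
Qed.

Lemma mcol_cauchy_prod n : mcol (fun v : 'cV[R]_n => (cauchy_prod v)%:E).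
Proof. by have /measurable_EFinP := @measurable_cauchy_prod n; exact. Qed.

Lemma Icol_cauchy_prod n :
  Icol (fun v : 'cV[R]_n => (cauchy_prod v)%:E) = (pi ^+ n)%:E.
Proof.
elim: n => [|n ih]; first by rewrite Icol0 /cauchy_prod big_ord0 expr0.
have ipi : \int[mu]_x ((oneDsqr x)^-1)%:E = pi%:E.
  rewrite ge0_symfun_integralT.
  - rewrite -set_itvE integral0y_oneDsqr -EFinM; congr EFin.
    by rewrite mulrC divfK.
  - by move=> x; rewrite invr_ge0 addr_ge0// sqr_ge0.
  - exact: continuous_oneDsqrV.
  - by move=> x /=; rewrite /oneDsqr sqrrN.
rewrite (@Icol_cons _ n _ (@mcol_cauchy_prod n.+1)); last first.
  by move=> v; rewrite lee_fin cauchy_prod_ge0.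
under eq_integral => x _.
  rewrite (_ : Icol _ = (pi ^+ n)%:E * ((oneDsqr x)^-1)%:E).
    over.
  rewrite -ih muleC -IcolZl.
  - by congr Icol; apply/funext => v; rewrite cauchy_prod_cons EFinM.
  - exact: mcol_cauchy_prod.
  - by move=> v; rewrite lee_fin cauchy_prod_ge0.
  - by rewrite invr_ge0 addr_ge0// sqr_ge0.
rewrite ge0_integralZl//.
- by rewrite ipi -EFinM exprSr.
- by have /measurable_EFinP := measurable_oneDsqrV; exact.
- by rewrite lee_fin exprn_ge0// pi_ge0.
Qed.

End Concatenation.

(** * Scaling of the phase integral *)

Section PhaseIntegral.
Context {R : realType} {a b : nat}.
Variables (P : 'cV[R]_(a + b) -> R) (P1 P2 : 'cV[R]_a -> R) (Q : 'cV[R]_b -> 'cV[R]_a).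
Variables (E1 E2 : 'M[R]_a) (F2 : 'M[R]_b).
Hypothesis hP : forall y z, P (col_mx y z) = P1 (y + Q z) + P2 y.
Hypotheses (hP1 : positive_homogeneous P1) (hP2 : positive_homogeneous P2).
Hypothesis hQ : nondegenerate_multivariate_homogeneous Q.
Hypotheses (hE1 : Exp P1 E1) (hE2 : Exp P2 E2) (hQ2 : homogeneous_wrt Q E2 F2).
Hypotheses (hcomm : E1 *m E2 - E2 *m E1 = 0) (hE12 : nonexpanding (E1 - E2)).
Hypothesis mP : forall s : R, mcol (fun xi => (expR (- (s * P xi)))%:E).

(** Commutation merges the two powers into a single one with base 1/s, to which non-expansion
    applies when s >= 1. *)
Lemma powmxV_mul s : 0 < s ->
  powmx s E2 *m powmx s^-1 E1 = powmx s^-1 (E1 - E2).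
Proof.
move=> s0; rewrite /powmx lnV ?posrE// -expmxD; last first.
  by apply: comm_scale; move/eqP: hcomm; rewrite subr_eq0 => /eqP.
by rewrite scalerBr !scaleNr opprK.
Qed.

Lemma nonexpanding_norm : exists2 C, 0 <= C & forall s (w : 'cV[R]_a), 1 <= s ->
  `|powmx s E2 *m powmx s^-1 E1 *m w| <= C * `|w|.
Proof.
have [C0 hC] := hE12.
exists (a%:R * Num.max 0 C0); first by rewrite mulr_ge0// le_max lexx.
move=> s w s1; have s0 : 0 < s by rewrite (lt_le_trans _ s1).
rewrite powmxV_mul// (le_trans (norm_le_opnorm _ _))// ler_wpM2r// ler_wpM2l//.
rewrite le_max; apply/orP; right; apply: hC; exists s^-1 => //=.
by rewrite invr_gt0 s0/= invf_le1.
Qed.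

(** The factor s is absorbed by E1 in P1 and by E2 in P2. Since z is scaled by F2, the matrix s^(E2)
    sends Q(s^(-F2) z) back to Q(z). *)
Lemma phase_scaling s w z : 0 < s ->
  s * P (col_mx (powmx s^-1 E1 *m w - Q (powmx s^-1 F2 *m z)) (powmx s^-1 F2 *m z)) =
  P1 w + P2 (powmx s E2 *m powmx s^-1 E1 *m w - Q z).
Proof.
move=> s0; have sV0 : 0 < s^-1 by rewrite invr_gt0.
rewrite hP subrK mulrDr (homogeneous_powmx hE1)// mulrA mulfV ?gt_eqF// mul1r.
congr (_ + _); rewrite -(homogeneous_powmx hE2)//; congr P2.
by rewrite mulmxBr mulmxA -hQ2// [X in _ - X]mulmxA powmxVr// mul1mx.
Qed.

Local Open Scope ereal_scope.

Lemma Icol_le n (F G : 'cV[R]_n -> \bar R) : mcol F -> mcol G ->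
  (forall v, 0 <= F v) -> (forall v, F v <= G v) -> Icol F <= Icol G.
Proof. by move=> mF mG F0 FG; apply: ge0_le_integral. Qed.

Lemma Icol_linear n (F : 'cV[R]_n -> \bar R) (M : 'M[R]_n) (d : R) : mcol F ->
  (forall v, 0 <= F v) -> (\det M = d)%R -> (0 < d)%R ->
  Icol F = d%:E * Icol (fun v => F (M *m v)).
Proof.
move=> mF F0 dM d0; rewrite (change_of_var_unitmx _ mF F0).
  by rewrite dM ger0_norm ?(ltW d0)// muleA -EFinM mulfV ?gt_eqF// mul1e.
by rewrite unitmxE dM unitfE gt_eqF.
Qed.

Lemma Icol_expRN_le : exists2 K, (0 <= K)%R & forall s, (1 <= s)%R ->
  Icol (fun xi => (expR (- (s * P xi)))%:E) <= (K * s `^ (- (\tr E1 + \tr F2)))%:E.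
Proof.
have [C C0 hC] := nonexpanding_norm.
have [K K0 hK] := expRN_phase_le hP1 hP2 hQ hE1 hE2 hQ2 C0.
exists (K * (pi ^+ a * pi ^+ b))%R; first by rewrite !mulr_ge0// exprn_ge0// pi_ge0.
move=> s s1; have s0 : (0 < s)%R by rewrite (lt_le_trans _ s1).
have sV0 : (0 < s^-1)%R by rewrite invr_gt0.
set F := fun xi => (expR (- (s * P xi)))%:E.
have F0 xi : 0 <= F xi by rewrite lee_fin expR_ge0.
have mF : mcol F by exact: mP.
rewrite Icol_cat//; set H := fun z => Icol _.
have mH : mcol H by exact: mcol_Icol_cat.
have H0 z : 0 <= H z by exact: Icol_ge0.
pose M1 := powmx s^-1 E1; pose M2 := powmx s^-1 F2.
pose d1 := (s^-1 `^ (\tr E1))%R; pose d2 := (s^-1 `^ (\tr F2))%R.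
have d10 : (0 < d1)%R by rewrite powR_gt0.
have d20 : (0 < d2)%R by rewrite powR_gt0.
(* The inner integral at fixed z: y is translated by the constant vector -Q(s^(-F2) z), then s^(-E1)
   w is substituted. *)
have HE z : H (M2 *m z) <= (d1 * (K * pi ^+ a) * cauchy_prod z)%:E.
  pose G (y : 'cV[R]_a) := F (col_mx y (M2 *m z)).
  have mG : mcol G.
    by have := @mcol_cat _ _ _ a b F id (fun=> tuple_of_col (M2 *m z)) mF;
       rewrite /= tuple_of_colK; apply.
  pose G' (y : 'cV[R]_a) := G (y - Q (M2 *m z))%R.
  have mG' : mcol G'.
    have := @mcol_affine _ _ _ G 1%:M (- Q (M2 *m z))%R mG.
    by under eq_fun do rewrite mul1mx.
  rewrite /H -/G -(Icol_translate (- Q (M2 *m z))%R mG (fun _ => F0 _)) -/G'.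
  rewrite (@Icol_linear _ G' M1 d1 mG' (fun _ => F0 _))//; last by rewrite det_powmx.
  rewrite -mulrA EFinM lee_wpmul2l ?lee_fin ?(ltW d10)//.
  apply: (@le_trans _ _ (Icol (fun w : 'cV[R]_a => (K * cauchy_prod z)%:E * (cauchy_prod w)%:E))).
    apply: Icol_le => //.
    - exact: mcol_mulmx.
    - by apply: measurable_funeM; exact: mcol_cauchy_prod.
    - by move=> w; exact: F0.
    - move=> w; rewrite /G' /G /F -EFinM lee_fin phase_scaling// -mulrA.
      by rewrite [(cauchy_prod z * _)%R]mulrC hK// hC.
  rewrite IcolZl.
  - by rewrite Icol_cauchy_prod -EFinM lee_fin mulrAC.
  - exact: mcol_cauchy_prod.
  - by move=> w; rewrite lee_fin cauchy_prod_ge0.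
  - by rewrite mulr_ge0// cauchy_prod_ge0.
rewrite (@Icol_linear _ H M2 d2)//; last by rewrite det_powmx.
apply: (@le_trans _ _ (d2%:E *
    Icol (fun z : 'cV[R]_b => (d1 * (K * pi ^+ a))%:E * (cauchy_prod z)%:E))).
  rewrite lee_wpmul2l ?lee_fin ?(ltW d20)//; apply: Icol_le.
  - exact: mcol_mulmx.
  - by apply: measurable_funeM; exact: mcol_cauchy_prod.
  - by move=> z; exact: H0.
  - by move=> z; rewrite -EFinM; exact: HE.
rewrite IcolZl.
- rewrite Icol_cauchy_prod -!EFinM lee_fin opprD powRD; last first.
    by rewrite (gt_eqF s0) implybT.
  have -> : (s `^ (- \tr E1) = d1)%R by rewrite /d1 -powR_inv1 ?(ltW s0)// -powRrM mulN1r.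
  have -> : (s `^ (- \tr F2) = d2)%R by rewrite /d2 -powR_inv1 ?(ltW s0)// -powRrM mulN1r.
  by rewrite le_eqVlt; apply/orP; left; apply/eqP; ring.
- exact: mcol_cauchy_prod.
- by move=> w; rewrite lee_fin cauchy_prod_ge0.
- by rewrite !mulr_ge0 ?(ltW d10)// exprn_ge0// pi_ge0.
Qed.

Local Close Scope ereal_scope.

(** The case s = 1, with w = w' = y + Q(z), for z; for y it is enough that P2(y) <= P. It makes P
    coercive, hence bounded below away from 0. *)
Lemma norm_le_phase_polynomial : exists K, exists2 m, 1 <= K &
  forall xi, `|xi| <= K * (1 + P xi) ^+ m.
Proof.
have [K [m K1 h]] := norm_le_phase hP1 hP2 hQ hE1 hE2 hQ2 ler01.
have [K' [m' K1' h']] := norm_le_homogeneous hP2 hE2.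
exists (K + K'), (m + m')%N => [|xi]; first by rewrite (le_trans K1)// lerDl (le_trans _ K1').
rewrite -[xi]vsubmxK; set y := usubmx xi; set z := dsubmx xi.
have P1_ge0 v : 0 <= P1 v by case: hP1 => _ [+ _] _ _; exact.
have P2_ge0 v : 0 <= P2 v by case: hP2 => _ [+ _] _ _; exact.
have := h (y + Q z) (y + Q z) z; rewrite mul1r addrK lexx => /(_ isT) /= [_].
set T := P1 _ + P2 _; have TE : T = P (col_mx y z) by rewrite hP.
rewrite -TE => hz; have hy := h' y.
have T0 : 0 <= T by rewrite addr_ge0.
have P2T : P2 y <= T by rewrite lerDr.
have T1 : 1 <= 1 + T by rewrite lerDl.
have K0 : 0 <= K by rewrite (le_trans _ K1).
have K0' : 0 <= K' by rewrite (le_trans _ K1').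
have zT : `|z| <= (K + K') * (1 + T) ^+ (m + m').
  rewrite (le_trans hz)// ler_pM ?exprn_ge0 ?addr_ge0 ?lerDl//.
  by rewrite ler_weXn2l// leq_addr.
have yT : `|y| <= (K + K') * (1 + T) ^+ (m + m').
  rewrite (le_trans hy)// ler_pM ?exprn_ge0 ?addr_ge0 ?lerDr//.
  rewrite (@le_trans _ _ ((1 + T) ^+ m'))//; last by rewrite ler_weXn2l// leq_addl.
  by rewrite lerXn2r ?nnegrE ?addr_ge0// lerD2l.
apply: mx_norm_le => [|i j]; first by rewrite mulr_ge0 ?exprn_ge0 ?addr_ge0.
by case: (split_ordP i) => k ->; rewrite ?col_mxEu ?col_mxEd;
  rewrite (le_trans (mx_norm_coord _ _ _)).
Qed.

End PhaseIntegral.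

(** * Fourier inversion *)

Section CubeFourier.
Context {R : realType}.
Local Notation mu := (@lebesgue_measure R).
Local Notation RT := (measurableTypeR R).

Lemma sin_intr_pi (m : int) : sin (m%:~R * pi) = 0 :> R.
Proof.
have natpi (k : nat) : sin (k%:R * pi) = 0 :> R.
  elim: k => [|k ih]; first by rewrite mul0r sin0.
  by rewrite -natr1 mulrDl mul1r sinDpi ih oppr0.
by case: m => k; rewrite ?NegzE ?mulrNz ?mulNr ?sinN natpi ?oppr0.
Qed.

Lemma sinD_subN (x y : R) : sin (x + y) - sin (- x + y) = 2 * (sin x * cos y).
Proof. by rewrite !sinD sinN cosN; ring. Qed.

Definition box (x : R) : R := ((`|x| <= pi)%R : bool)%:R.

Lemma is_derive_linear (c x : R) : is_derive x 1 (fun x : R => c * x) c.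
Proof.
have := @is_deriveZ _ _ _ id c x 1 1 (is_derive_id _ _).
by rewrite [c *: 1]mulr1.
Qed.

Lemma is_derive_affine (c e x : R) : is_derive x 1 (fun x : R => c * x + e) c.
Proof.
have := @is_deriveD _ _ _ _ (cst e) x 1 c 0 (is_derive_linear c x) (is_derive_cst _ _ _).
by rewrite addr0.
Qed.

Lemma integral_box_cos (A B theta : R) (m : int) :
  (\int[mu]_x (box x * (A + B * cos (m%:~R * x + theta)))%:E =
   (2 * pi * (A + B * (m == 0)%:R * cos theta))%:E)%E.
Proof.
pose f (x : R) : R := A + B * cos (m%:~R * x + theta).
have pi0 : 0 < pi :> R by exact: pi_gt0.
have cf : continuous f.
  move=> x; apply: cvgD; first exact: cvg_cst.
  apply: cvgMr; apply: (@cvg_comp _ _ _ (fun x : R => m%:~R * x + theta) cos); last first.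
    exact: continuous_cos.
  by apply: cvgD; [apply: cvgMr; exact: cvg_id|exact: cvg_cst].
transitivity (\int[mu]_(x in `[(- pi)%R, pi%R]%classic) (f x)%:E)%E.
  rewrite [RHS]integral_mkcond; apply: eq_integral => x _.
  rewrite patchE /box mem_setE in_itv/= -ler_norml -/(f x).
  by case: (_ <= _); rewrite ?mul1r ?mul0r.
(* An antiderivative in both cases; for m <> 0 its oscillating part takes equal values at -pi and
   pi, because sin(m pi) = 0. *)
pose F (x : R) : R :=
  if m == 0 then (A + B * cos theta) * x
  else A * x + B / m%:~R * sin (m%:~R * x + theta).
have dF (x : R) : is_derive x 1 F (f x).
  rewrite /F /f; have [->|m0] := eqVneq m 0.
    by rewrite mul0r add0r; exact: is_derive_linear.
  have ds := @is_derive1_comp _ sin (fun x => m%:~R * x + theta) x _ _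
    (is_derive_sin _) (is_derive_affine _ _ _).
  have := is_deriveD (is_derive_linear A x) (is_deriveZ (B / m%:~R) ds).
  rewrite (_ : _ *: _ = B * cos (m%:~R * x + theta))//.
  rewrite -[LHS]/(B / m%:~R * (cos (m%:~R * x + theta) * m%:~R)).
  by rewrite [cos _ * _]mulrC mulrA divfK// intr_eq0.
have cF : continuous F.
  by move=> x; apply: differentiable_continuous; apply/derivable1_diffP; apply: ex_derive.
rewrite (@continuous_FTC2 _ f F (- pi) pi).
- rewrite -EFinB /F; congr EFin; have [m0|m0] := eqVneq m 0.
    by rewrite mulr1; ring.
  rewrite mulr0 mul0r addr0.
  have := sinD_subN (m%:~R * pi) theta; rewrite sin_intr_pi mul0r mulr0 => /eqP.
  by rewrite subr_eq0 [m%:~R * - pi]mulrN => /eqP ->; ring.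
- by rewrite gtrN.
- exact: continuous_subspaceT.
- split.
  + by move=> x _; apply: ex_derive.
  + exact/cvg_at_right_filter/cF.
  + exact/cvg_at_left_filter/cF.
- by move=> x _; rewrite derive1E; apply: derive_val.
Qed.

Definition cube n (v : 'cV[R]_n) : R := \prod_i box (v i 0).

Lemma cubeE n (v : 'cV[R]_n) : cube v = ((`|v| <= pi)%R : bool)%:R.
Proof.
have [vpi|] := boolP (`|v| <= pi).
  by rewrite /cube big1// => i _; rewrite /box (le_trans (mx_norm_coord _ _ _)).
move=> vpi; have [i hi] : exists i, ~~ (`|v i 0| <= pi).
  apply/existsP; move: vpi; apply: contraR; rewrite negb_exists => /forallP h.
  apply: mx_norm_le => [|i j]; first exact: pi_ge0.
  by rewrite (ord1 j); apply/negPn; exact: h.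
by rewrite /cube (bigD1 i)//= /box (negbTE hi) mul0r.
Qed.

Lemma cube_ge0 n (v : 'cV[R]_n) : 0 <= cube v.
Proof. by rewrite cubeE. Qed.

Lemma cube_cons n (x : R) (v : 'cV[R]_n) :
  cube (col_mx x%:M v : 'cV[R]_(1 + n)) = box x * cube v.
Proof.
rewrite /cube big_ord_recl /=; congr (_ * _).
  have -> : ord0 = lshift n (0%R : 'I_1) by exact: val_inj.
  by rewrite (@col_mxEu _ 1 n 1) mxE eqxx mulr1n.
apply: eq_bigr => i _; have -> : lift ord0 i = rshift 1 i by exact: val_inj.
by rewrite (@col_mxEd _ 1 n 1).
Qed.

Lemma dotv_cons n (u : 'cV[R]_(1 + n)) (x : R) (v : 'cV[R]_n) :
  dotv u (col_mx x%:M v) = u (lshift n 0) 0 * x + dotv (dsubmx u) v.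
Proof.
rewrite /dotv big_ord_recl /=; congr (_ + _).
  have -> : ord0 = lshift n (0%R : 'I_1) by exact: val_inj.
  by rewrite (@col_mxEu _ 1 n 1) mxE eqxx mulr1n.
apply: eq_bigr => i _; have -> : lift ord0 i = rshift 1 i by exact: val_inj.
by rewrite (@col_mxEd _ 1 n 1) mxE.
Qed.

Definition mreal n (f : 'cV[R]_n -> R) :=
  measurable_fun [set: n.-tuple RT] (f \o @col_of_tuple R n).

Lemma mreal_mcol n (f : 'cV[R]_n -> R) : mreal f -> mcol (fun v => (f v)%:E).
Proof. by move=> /measurable_EFinP; exact. Qed.

Lemma mreal_cst n (c : R) : mreal (fun _ : 'cV[R]_n => c).
Proof. exact: measurable_cst. Qed.

Lemma mrealD n (f g : 'cV[R]_n -> R) : mreal f -> mreal g -> mreal (fun v => f v + g v).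
Proof. by move=> mf mg; exact: (measurable_funD mf mg). Qed.

Lemma mrealB n (f g : 'cV[R]_n -> R) : mreal f -> mreal g -> mreal (fun v => f v - g v).
Proof. by move=> mf mg; exact: (measurable_funB mf mg). Qed.

Lemma mrealM n (f g : 'cV[R]_n -> R) : mreal f -> mreal g -> mreal (fun v => f v * g v).
Proof. by move=> mf mg; exact: (measurable_funM mf mg). Qed.

Lemma mreal_sum n I (s : seq I) (f : I -> 'cV[R]_n -> R) :
  (forall i, mreal (f i)) -> mreal (fun v => \sum_(i <- s) f i v).
Proof. by move=> mf; apply: (measurable_sum s (h := fun i => f i \o @col_of_tuple R n)). Qed.

Lemma mreal_continuous n (g : R -> R) (f : 'cV[R]_n -> R) : continuous g -> mreal f ->
  mreal (fun v => g (f v)).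
Proof.
move=> /continuous_measurable_fun mg mf.
exact: (measurableT_comp mg mf).
Qed.

Lemma mreal_coord n i : mreal (fun v : 'cV[R]_n => v i 0).
Proof.
have := @measurable_tnth _ RT n i.
rewrite /mreal (_ : _ \o _ = (@tnth n RT)^~ i)//.
by apply/funext => t /=; rewrite mxE.
Qed.

Lemma mreal_dotv n (u : 'cV[R]_n) : mreal (dotv u).
Proof. by apply: mreal_sum => i; apply: mrealM; [exact: mreal_cst|exact: mreal_coord]. Qed.

Lemma measurable_box : measurable_fun [set: RT] box.
Proof.
rewrite (_ : box = \1_(`[(- pi)%R, pi%R]%classic : set RT)).
  exact: measurable_indic.
by apply/funext => x; rewrite indicE mem_setE in_itv/= -ler_norml.
Qed.

Lemma mreal_cube n : mreal (@cube n).
Proof.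
apply: measurable_prod => i _.
exact: (measurableT_comp measurable_box (@mreal_coord n i)).
Qed.

(* The constant [A] keeps the integrand nonnegative, so that Tonelli applies. *)
Lemma Icol_cube_cos n (A B theta : R) (k : 'cV[int]_n) : `|B| <= A ->
  Icol (fun v => (cube v * (A + B * cos (dotv (vecZ k) v + theta)))%:E) =
  ((2 * pi) ^+ n * (A + B * (k == 0)%:R * cos theta))%:E.
Proof.
have mF m (A' B' : R) (u : 'cV[R]_m) (t : R) :
    mreal (fun v => cube v * (A' + B' * cos (dotv u v + t))).
  apply: mrealM; first exact: mreal_cube.
  apply: mrealD; first exact: mreal_cst.
  apply: mrealM; first exact: mreal_cst.
  apply: (mreal_continuous (@continuous_cos R)).
  by apply: mrealD; [exact: mreal_dotv|exact: mreal_cst].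
have F0 m (A' B' : R) (u : 'cV[R]_m) (t : R) v : `|B'| <= A' ->
    0 <= cube v * (A' + B' * cos (dotv u v + t)).
  move=> BA; rewrite mulr_ge0 ?cube_ge0//.
  have : `|B' * cos (dotv u v + t)| <= A'.
    by rewrite normrM (le_trans _ BA)// ler_piMr// cos_max.
  by rewrite ler_norml => /andP[]; lra.
elim: n B k => [|n ih] B k BA.
  rewrite Icol0 /cube big_ord0 mul1r expr0 mul1r; congr (A + _)%:E.
  have -> : k = 0 by apply/matrixP => -[].
  by rewrite eqxx mulr1 /dotv big_ord0 add0r.
move: k; rewrite -[n.+1]/(1 + n)%N => k.
rewrite Icol_consC; last 2 first.
- by apply: mreal_mcol; exact: mF.
- by move=> v; rewrite lee_fin F0.
pose k0 := k (lshift n 0) 0.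
have kE : (k == 0) = (k0 == 0) && (dsubmx k == 0).
  rewrite -{1}[k]vsubmxK -(@col_mx0 _ 1 n 1); apply/eqP/andP.
    by move=> /eq_col_mx[] /matrixP/(_ 0 0); rewrite !mxE => h ->; rewrite /k0 h.
  move=> [/eqP k00 /eqP ->]; congr col_mx; apply/matrixP => i j.
  by rewrite (ord1 i) (ord1 j) !mxE -[RHS]k00.
rewrite (_ : Icol _ = Icol (fun v => (2 * pi)%:E * (cube v * (A + B * (k0 == 0)%:R *
    cos (dotv (vecZ (dsubmx k)) v + theta)))%:E)%E); last first.
  congr Icol; apply/funext => v; rewrite -EFinM.
  have -> : cube v * (A + B * (k0 == 0)%:R *
      cos (dotv (vecZ (dsubmx k)) v + theta)) =
      cube v * A + cube v * B * (k0 == 0)%:R *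
      cos (dotv (vecZ (dsubmx k)) v + theta) by rewrite mulrDr !mulrA.
  rewrite -integral_box_cos.
  apply: eq_integral => x _; congr EFin.
  rewrite cube_cons dotv_cons mxE -/k0 -addrA.
  have -> : dsubmx (vecZ k) = vecZ (dsubmx k) :> 'cV[R]_n by rewrite /vecZ map_dsubmx.
  by ring.
have BA' : `|B * (k0 == 0)%:R| <= A.
  by rewrite normrM (le_trans _ BA)// ler_piMr//; case: (_ == _); rewrite ?normr1 ?normr0.
rewrite IcolZl.
- rewrite ih// -EFinM mulrA -exprS; congr (_ * (A + _ * _))%:E.
  by rewrite kE; case: (k0 == 0); rewrite ?mulr1 ?mulr0 ?mul0r.
- by apply: mreal_mcol; exact: mF.
- by move=> v; rewrite lee_fin F0.
- by rewrite mulr_ge0// pi_ge0.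
Qed.

End CubeFourier.

(** * Integrals of complex-valued functions *)

Section ComplexIntegral.
Context {R : realType}.
Local Notation RT := (measurableTypeR R).
Local Notation Re := complex.Re.
Local Notation Im := complex.Im.
Local Notation normc := Normc.normc.

Lemma ReD (x y : R[i]) : Re (x + y) = Re x + Re y.
Proof. by case: x y => [? ?] [? ?]. Qed.

Lemma ImD (x y : R[i]) : Im (x + y) = Im x + Im y.
Proof. by case: x y => [? ?] [? ?]. Qed.

Lemma ReM (x y : R[i]) : Re (x * y) = Re x * Re y - Im x * Im y.
Proof. by case: x y => [? ?] [? ?]. Qed.

Lemma ImM (x y : R[i]) : Im (x * y) = Re x * Im y + Im x * Re y.
Proof. by case: x y => [? ?] [? ?]. Qed.

Lemma complex_eq (x y : R[i]) : Re x = Re y -> Im x = Im y -> x = y.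
Proof. by case: x y => [? ?] [? ?] /= -> ->. Qed.

Lemma normc_ge0 (z : R[i]) : 0 <= normc z.
Proof. by case: z => ? ?; exact: sqrtr_ge0. Qed.

Lemma normr_Re_le (z : R[i]) : `|Re z| <= normc z.
Proof.
by case: z => x y /=; rewrite -sqrtr_sqr ler_wsqrtr// lerDl sqr_ge0.
Qed.

Lemma normr_Im_le (z : R[i]) : `|Im z| <= normc z.
Proof.
by case: z => x y /=; rewrite -sqrtr_sqr ler_wsqrtr// lerDr sqr_ge0.
Qed.

Lemma normc_le_ReIm (z : R[i]) : normc z <= `|Re z| + `|Im z|.
Proof.
case: z => x y /=; rewrite -[leRHS]ger0_norm ?addr_ge0// -sqrtr_sqr ler_wsqrtr//.
rewrite -(real_normK (num_real x)) -(real_normK (num_real y)).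
by rewrite sqrrD lerD2r lerDl mulrn_wge0// mulr_ge0.
Qed.

Lemma normcD (x y : R[i]) : normc (x + y) <= normc x + normc y.
Proof. exact: le_normcD. Qed.

Lemma normc_real (x : R) : normc x%:C = `|x|.
Proof. by rewrite /= expr0n addr0 sqrtr_sqr. Qed.

Lemma normc_expi (x : R) : normc (expi x) = 1.
Proof. by rewrite /= cos2Dsin2 sqrtr1. Qed.

Lemma expiD (x y : R) : expi (x + y) = expi x * expi y.
Proof. by rewrite /expi cosD sinD; apply: complex_eq; rewrite ?ReM ?ImM/=; ring. Qed.

Lemma expi0 : expi 0 = 1 :> R[i].
Proof. by rewrite /expi cos0 sin0. Qed.

Definition cmeas n (f : 'cV[R]_n -> R[i]) :=
  mreal (fun v => Re (f v)) /\ mreal (fun v => Im (f v)).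

Lemma cmeas_cst n (c : R[i]) : cmeas (fun _ : 'cV[R]_n => c).
Proof. by split; exact: mreal_cst. Qed.

Lemma cmeas_real n (f : 'cV[R]_n -> R) : mreal f -> cmeas (fun v => (f v)%:C).
Proof. by move=> mf; split => //; exact: mreal_cst. Qed.

Lemma cmeas_expi n (f : 'cV[R]_n -> R) : mreal f -> cmeas (fun v => expi (f v)).
Proof.
move=> mf; split; first exact: (mreal_continuous (@continuous_cos R)).
exact: (mreal_continuous (@continuous_sin R)).
Qed.

Lemma cmeasD n (f g : 'cV[R]_n -> R[i]) : cmeas f -> cmeas g ->
  cmeas (fun v => f v + g v).
Proof.
move=> [mf1 mf2] [mg1 mg2]; split; under eq_fun do rewrite ?ReD ?ImD; exact: mrealD.
Qed.

Lemma cmeasM n (f g : 'cV[R]_n -> R[i]) : cmeas f -> cmeas g ->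
  cmeas (fun v => f v * g v).
Proof.
move=> [mf1 mf2] [mg1 mg2]; split.
  by under eq_fun do rewrite ReM; apply: mrealB; exact: mrealM.
by under eq_fun do rewrite ImM; apply: mrealD; exact: mrealM.
Qed.

Lemma cmeas_sum n I (s : seq I) (f : I -> 'cV[R]_n -> R[i]) :
  (forall i, cmeas (f i)) -> cmeas (fun v => \sum_(i <- s) f i v).
Proof.
move=> mf; elim: s => [|i s ih].
  by under eq_fun do rewrite big_nil; exact: cmeas_cst.
by under eq_fun do rewrite big_cons; exact: cmeasD.
Qed.

Lemma cmeasX n (f : 'cV[R]_n -> R[i]) k : cmeas f -> cmeas (fun v => f v ^+ k).
Proof.
move=> mf; elim: k => [|k ih].
  by under eq_fun do rewrite expr0; exact: cmeas_cst.
by under eq_fun do rewrite exprS; exact: cmeasM.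
Qed.

(** Integrability through a real majorant with a bounded integral: one witness covers the real and
    imaginary parts at once. *)
Definition cint n (f : 'cV[R]_n -> R[i]) := cmeas f /\
  exists g, [/\ mreal g, forall v, normc (f v) <= g v &
                exists B : R, (Icol (fun v => (g v)%:E) <= B%:E)%E].

Lemma mreal_integrable n (f g : 'cV[R]_n -> R) : mreal f -> mreal g ->
  (forall v, `|f v| <= g v) ->
  (exists B : R, (Icol (fun v => (g v)%:E) <= B%:E)%E) ->
  (@lebesgue_tuple R n).-integrable setT (EFin \o (f \o @col_of_tuple R n)).
Proof.
move=> mf mg fg [B gB]; apply/integrableP; split; first exact/measurable_EFinP.
apply: le_lt_trans (ltry B); apply: le_trans gB.
apply: ge0_le_integral => //.
- by apply/measurable_EFinP; exact: (measurableT_comp (@normr_measurable R setT) mf).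
- exact/measurable_EFinP.
- by move=> t _; rewrite /= lee_fin fg.
Qed.

Lemma cint_integrable_Re n (f : 'cV[R]_n -> R[i]) : cint f ->
  (@lebesgue_tuple R n).-integrable setT (EFin \o (fun t => Re (f (col_of_tuple t)))).
Proof.
move=> [[mf _] [g [mg fg gB]]]; apply: (mreal_integrable mf mg _ gB) => v.
exact: le_trans (normr_Re_le _) (fg v).
Qed.

Lemma cint_integrable_Im n (f : 'cV[R]_n -> R[i]) : cint f ->
  (@lebesgue_tuple R n).-integrable setT (EFin \o (fun t => Im (f (col_of_tuple t)))).
Proof.
move=> [[_ mf] [g [mg fg gB]]]; apply: (mreal_integrable mf mg _ gB) => v.
exact: le_trans (normr_Im_le _) (fg v).
Qed.

Lemma cintD n (f g : 'cV[R]_n -> R[i]) : cint f -> cint g -> cint (fun v => f v + g v).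
Proof.
move=> [mf [f' [mf' ff' [Bf hf]]]] [mg [g' [mg' gg' [Bg hg]]]].
split; first exact: cmeasD.
exists (fun v => f' v + g' v); split; first exact: mrealD.
  by move=> v; rewrite (le_trans (normcD _ _))// lerD.
have f0 v : 0 <= f' v by rewrite (le_trans (normc_ge0 _) (ff' v)).
have g0 v : 0 <= g' v by rewrite (le_trans (normc_ge0 _) (gg' v)).
exists (Bf + Bg); rewrite EFinD; apply: le_trans (leeD hf hg).
rewrite /Icol -ge0_integralD//.
- by move=> t _; rewrite lee_fin.
- exact: mreal_mcol.
- by move=> t _; rewrite lee_fin.
- exact: mreal_mcol.
Qed.

Lemma cintZ n (c : R[i]) (f : 'cV[R]_n -> R[i]) : cint f -> cint (fun v => c * f v).
Proof.
move=> [mf [f' [mf' ff' [B hf]]]]; split; first by apply: cmeasM => //; exact: cmeas_cst.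
have f0 v : 0 <= f' v by rewrite (le_trans (normc_ge0 _) (ff' v)).
exists (fun v => normc c * f' v); split.
- by apply: mrealM => //; exact: mreal_cst.
- by move=> v; rewrite Normc.normcM ler_wpM2l// normc_ge0.
- exists (normc c * B); rewrite EFinM.
  under [Icol _]eq_integral do rewrite EFinM.
  rewrite -/(Icol (fun v => (normc c)%:E * (f' v)%:E)%E) IcolZl.
  + by rewrite lee_wpmul2l// lee_fin normc_ge0.
  + exact: mreal_mcol.
  + by move=> v; rewrite lee_fin.
  + exact: normc_ge0.
Qed.

Lemma integral_RnD n (f g : 'cV[R]_n -> R[i]) : cint f -> cint g ->
  integral_Rn (fun v => f v + g v) = integral_Rn f + integral_Rn g.
Proof.
move=> hf hg; apply: complex_eq; rewrite ?ReD ?ImD /integral_Rn/=.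
  rewrite -RintegralD//; first by apply: eq_Rintegral => t _; rewrite ReD.
    exact: cint_integrable_Re.
  exact: cint_integrable_Re.
rewrite -RintegralD//; first by apply: eq_Rintegral => t _; rewrite ImD.
  exact: cint_integrable_Im.
exact: cint_integrable_Im.
Qed.

Lemma integral_RnZ n (c : R[i]) (f : 'cV[R]_n -> R[i]) : cint f ->
  integral_Rn (fun v => c * f v) = c * integral_Rn f.
Proof.
move=> hf; have iR := cint_integrable_Re hf; have iI := cint_integrable_Im hf.
have iZ (k : R) (h : n.-tuple RT -> R) :
    (@lebesgue_tuple R n).-integrable setT (EFin \o h) ->
    (@lebesgue_tuple R n).-integrable setT (EFin \o (fun t => k * h t)).
  by move=> ih; exact: (integrableZl measurableT k ih).
apply: complex_eq; rewrite ?ReM ?ImM /integral_Rn/=.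
  rewrite -!RintegralZl// -RintegralB//; last 2 first.
  - exact: iZ.
  - exact: iZ.
  by apply: eq_Rintegral => t _; rewrite ReM.
rewrite -!RintegralZl// -RintegralD//; last 2 first.
- exact: iZ.
- exact: iZ.
by apply: eq_Rintegral => t _; rewrite ImM.
Qed.

Lemma integral_Rn_sum n I (s : seq I) (c : I -> R[i]) (f : I -> 'cV[R]_n -> R[i]) :
  (forall i, cint (f i)) ->
  integral_Rn (fun v => \sum_(i <- s) c i * f i v) =
  \sum_(i <- s) c i * integral_Rn (f i).
Proof.
move=> hf; pose g (s : seq I) v := \sum_(i <- s) c i * f i v.
have c0 : cint (fun _ : 'cV[R]_n => 0 : R[i]).
  split; first exact: cmeas_cst.
  exists (fun=> 0); split; first exact: mreal_cst.
  - by move=> v; rewrite Normc.normc0.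
  - by exists 0; rewrite /Icol integral0.
have hg s' : cint (g s').
  elim: s' => [|i s' ih].
    by rewrite (_ : g [::] = fun=> 0)//; apply/funext => v; rewrite /g big_nil.
  rewrite (_ : g (i :: s') = fun v => c i * f i v + g s' v).
    by apply: cintD => //; exact: cintZ.
  by apply/funext => v; rewrite /g big_cons.
rewrite -/(g s); elim: s => [|i s ih].
  rewrite big_nil (_ : g [::] = fun v => 0 * 0); last first.
    by apply/funext => v; rewrite /g big_nil mul0r.
  by rewrite (integral_RnZ 0 c0) mul0r.
rewrite big_cons -ih -integral_RnZ// -integral_RnD//; last exact: cintZ.
by congr integral_Rn; apply/funext => v; rewrite /g big_cons.
Qed.

(** The real and imaginary parts are estimated separately, whence the factor 2. *)
Lemma normc_integral_le n (f : 'cV[R]_n -> R[i]) (g : 'cV[R]_n -> R) (B : R) :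
  cmeas f -> mreal g -> (forall v, normc (f v) <= g v) ->
  (Icol (fun v => (g v)%:E) <= B%:E)%E -> normc (integral_Rn f) <= 2 * B.
Proof.
move=> [mf1 mf2] mg fg gB.
have fineB (x : \bar R) : (`|x| <= B%:E)%E -> `|fine x| <= B by case: x.
have main (h : 'cV[R]_n -> R) : mreal h -> (forall v, `|h v| <= g v) ->
    `|\int[@lebesgue_tuple R n]_t h (col_of_tuple t)| <= B.
  move=> mh hg; apply: fineB; apply: le_trans gB.
  apply: (le_trans (le_abse_integral _ _ _)) => //; first exact/measurable_EFinP.
  apply: ge0_le_integral => //.
  - by apply/measurable_EFinP; exact: (measurableT_comp (@normr_measurable R setT) mh).
  - exact/measurable_EFinP.
  - by move=> t _; rewrite /= lee_fin hg.
rewrite (le_trans (normc_le_ReIm _))// mulr_natl mulr2n lerD//.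
  by apply: (main _ mf1) => v; exact: le_trans (normr_Re_le _) (fg v).
by apply: (main _ mf2) => v; exact: le_trans (normr_Im_le _) (fg v).
Qed.

End ComplexIntegral.

Section FourierInversion.
Context {R : realType}.
Local Notation normc := Normc.normc.

Lemma Icol_cube n (C : R) : 0 <= C ->
  Icol (fun v : 'cV[R]_n => (cube v * C)%:E) = ((2 * pi) ^+ n * C)%:E.
Proof.
move=> C0; have := @Icol_cube_cos R n C 0 0 0; rewrite normr0 => /(_ C0).
rewrite !mul0r addr0 => <-; congr Icol; apply/funext => v.
by rewrite mul0r addr0.
Qed.

Lemma cint_cube n (f : 'cV[R]_n -> R[i]) (C : R) : cmeas f ->
  (forall v, normc (f v) <= C) -> cint (fun v => (cube v)%:C * f v).
Proof.
move=> mf fC; have C0 : 0 <= C by rewrite (le_trans (normc_ge0 _) (fC 0)).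
split; first by apply: cmeasM => //; apply: cmeas_real; exact: mreal_cube.
exists (fun v => cube v * C); split.
- by apply: mrealM; [exact: mreal_cube|exact: mreal_cst].
- move=> v; rewrite Normc.normcM normc_real ger0_norm ?cube_ge0//.
  by rewrite ler_wpM2l ?cube_ge0.
- by exists ((2 * pi) ^+ n * C); rewrite Icol_cube.
Qed.

(** The signed integrand is the difference of the nonnegative ones [f 1] and [f 0], to which the
    Tonelli computation applies. *)
Lemma Rintegral_cube_cos n (k : 'cV[int]_n) (theta : R) :
  \int[@lebesgue_tuple R n]_t (cube (col_of_tuple t) *
     cos (dotv (vecZ k) (col_of_tuple t) + theta)) =
  (2 * pi) ^+ n * (k == 0)%:R * cos theta.
Proof.
pose f (B : R) (v : 'cV[R]_n) := cube v * (1 + B * cos (dotv (vecZ k) v + theta)).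
have mf B : mreal (f B).
  apply: mrealM; first exact: mreal_cube.
  apply: mrealD; first exact: mreal_cst.
  apply: mrealM; first exact: mreal_cst.
  apply: (mreal_continuous (@continuous_cos R)).
  by apply: mrealD; [exact: mreal_dotv|exact: mreal_cst].
have fi B : `|B| <= 1 -> (@lebesgue_tuple R n).-integrable setT
    (EFin \o (f B \o @col_of_tuple R n)).
  move=> B1; apply: (@mreal_integrable _ _ (f B) (fun v => cube v * 2)) => //.
  - by apply: mrealM; [exact: mreal_cube|exact: mreal_cst].
  - move=> v; rewrite normrM ger0_norm ?cube_ge0// ler_wpM2l ?cube_ge0//.
    rewrite (le_trans (ler_normD _ _))// normr1 (_ : 2 = 1 + 1)// lerD2l.
    by rewrite normrM -[leRHS]mulr1 ler_pM// cos_max.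
  - by exists ((2 * pi) ^+ n * 2); rewrite Icol_cube.
have fI B : `|B| <= 1 -> \int[@lebesgue_tuple R n]_t f B (col_of_tuple t) =
    (2 * pi) ^+ n * (1 + B * (k == 0)%:R * cos theta).
  by move=> B1; rewrite /Rintegral -/(Icol (fun v => (f B v)%:E)) /f Icol_cube_cos.
transitivity (\int[@lebesgue_tuple R n]_t
    (f 1 (col_of_tuple t) - f 0 (col_of_tuple t))).
  by apply: eq_Rintegral => t _; rewrite /f; ring.
rewrite RintegralB//; last 2 first.
- by apply: fi; rewrite normr1.
- by apply: fi; rewrite normr0.
by rewrite !fI ?normr1 ?normr0//; ring.
Qed.

(** The free phase [theta] lets the cosine formula also give the imaginary part, through sin x =
    cos(x - pi / 2). *)
Lemma integral_cube_expi n (k : 'cV[int]_n) (theta : R) :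
  integral_Rn (fun v => (cube v)%:C * expi (dotv (vecZ k) v + theta)) =
  ((2 * pi) ^+ n * (k == 0)%:R)%:C * expi theta.
Proof.
have sinE (x : R) : sin x = cos (x - pi / 2).
  by rewrite cosB cos_pihalf sin_pihalf mulr0 add0r mulr1.
apply: complex_eq; rewrite ?ReM ?ImM /integral_Rn /= mul0r ?subr0 ?addr0.
  rewrite -Rintegral_cube_cos; apply: eq_Rintegral => t _.
  by rewrite mul0r subr0.
rewrite sinE -Rintegral_cube_cos; apply: eq_Rintegral => t _.
by rewrite mul0r addr0 sinE addrA.
Qed.

Lemma dotvC n (u v : 'cV[R]_n) : dotv u v = dotv v u.
Proof. by apply: eq_bigr => i _; rewrite mulrC. Qed.

Lemma dotvDr n (u v w : 'cV[R]_n) : dotv u (v + w) = dotv u v + dotv u w.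
Proof. by rewrite /dotv -big_split; apply: eq_bigr => i _; rewrite mxE mulrDr. Qed.

Lemma dotvDl n (u v w : 'cV[R]_n) : dotv (v + w) u = dotv v u + dotv w u.
Proof. by rewrite dotvC dotvDr !(dotvC u). Qed.

Lemma dotvNl n (u v : 'cV[R]_n) : dotv (- v) u = - dotv v u.
Proof. by rewrite /dotv -sumrN; apply: eq_bigr => i _; rewrite mxE mulNr. Qed.

Lemma dotvZl n c (u v : 'cV[R]_n) : dotv (c *: v) u = c * dotv v u.
Proof. by rewrite /dotv mulr_sumr; apply: eq_bigr => i _; rewrite mxE mulrA. Qed.

Lemma vecZB n (x y : 'cV[int]_n) : vecZ (x - y) = vecZ x - vecZ y :> 'cV[R]_n.
Proof. by rewrite /vecZ map_mxB. Qed.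

Section Inversion.
Context {d : nat}.
Variables (phi : 'cV[int]_d -> R[i]) (xi0 : 'cV[R]_d).
Hypothesis hphi : finitely_supported phi.

Let supp : seq 'cV[int]_d := finmap.enum_fset (fset_set [set x | phi x != 0]).

Lemma fsbig_supp (g : 'cV[int]_d -> R[i]) :
  \sum_(x \in setT) g x * phi x = \sum_(x <- supp) g x * phi x.
Proof.
rewrite -(@fsbig_widen _ _ _ _ [set x | phi x != 0])//; first by rewrite fsbig_finite.
by move=> x /= [_ /negP/negPn/eqP ->]; rewrite mulr0.
Qed.

Lemma fourierE (xi : 'cV[R]_d) :
  fourier phi xi = \sum_(y <- supp) expi (dotv (vecZ y) xi) * phi y.
Proof.
rewrite -fsbig_supp /fourier; apply: eq_fsbigr => y _; exact: mulrC.
Qed.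

Lemma convE (psi : 'cV[int]_d -> R[i]) x :
  Defs.conv psi phi x = \sum_(y <- supp) psi (x - y) * phi y.
Proof. exact: (fsbig_supp (fun y => psi (x - y))). Qed.

Lemma sum_supp_pred1 x : \sum_(y <- supp) (y == x)%:R * phi y = phi x.
Proof.
have [xs|xs] := boolP (x \in supp).
  rewrite (bigD1_seq x)//= ?eqxx ?mul1r; last exact: finmap.fset_uniq.
  by rewrite big1 ?addr0// => y /negbTE ->; rewrite mul0r.
rewrite big1_seq.
  apply/esym/eqP; move: xs; apply: contraNT => phix.
  by rewrite in_fset_set// inE.
by move=> y /= ys; case: eqP => [yx|]; rewrite ?mul0r//; move: ys; rewrite yx (negbTE xs).
Qed.

Lemma cmeas_fourier (c : 'cV[R]_d) : cmeas (fun v => fourier phi (v + c)).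
Proof.
under eq_fun do rewrite fourierE; apply: cmeas_sum => y.
apply: cmeasM; last exact: cmeas_cst.
apply: cmeas_expi; under eq_fun do rewrite dotvDr.
by apply: mrealD; [exact: mreal_dotv|exact: mreal_cst].
Qed.

Lemma cmeas_expi_shift (x c : 'cV[R]_d) : cmeas (fun v => expi (- dotv x (v + c))).
Proof.
apply: cmeas_expi; under eq_fun do rewrite -dotvNl dotvDr.
by apply: mrealD; [exact: mreal_dotv|exact: mreal_cst].
Qed.

Lemma normc_fourier_le : exists2 C : R, 0 <= C & forall xi, normc (fourier phi xi) <= C.
Proof.
exists (\sum_(y <- supp) normc (phi y)).
  by apply: sumr_ge0 => y _; exact: normc_ge0.
move=> xi; rewrite fourierE; elim: supp => [|y s ih].
  by rewrite !big_nil Normc.normc0.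
rewrite !big_cons (le_trans (normcD _ _))// lerD//.
by rewrite Normc.normcM normc_expi mul1r.
Qed.

Lemma normcX (z : R[i]) k : normc (z ^+ k) = normc z ^+ k.
Proof.
elim: k => [|k ih]; first by rewrite !expr0 Normc.normc1.
by rewrite !exprS Normc.normcM ih.
Qed.

(** Centring the cube at [xi0] keeps a whole neighbourhood of the maximum inside it, even when [xi0]
    lies on the boundary of the torus. *)
Definition inversion_integrand k (x : 'cV[int]_d) (v : 'cV[R]_d) : R[i] :=
  (cube v)%:C * (fourier phi (v + xi0) ^+ k * expi (- dotv (vecZ x) (v + xi0))).

Lemma cint_inversion k x : cint (inversion_integrand k x).
Proof.
have [C C0 hC] := normc_fourier_le.
apply: (@cint_cube _ _ (C ^+ k)).
  by apply: cmeasM; [exact/cmeasX/cmeas_fourier|exact: cmeas_expi_shift].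
move=> v; rewrite Normc.normcM normc_expi mulr1 normcX.
by rewrite lerXn2r ?nnegrE// normc_ge0.
Qed.

Lemma inversion_integrandS k x v : inversion_integrand k.+1 x v =
  \sum_(y <- supp) phi y * inversion_integrand k (x - y) v.
Proof.
rewrite /inversion_integrand exprSr {2}fourierE mulr_sumr mulr_suml mulr_sumr.
apply: eq_bigr => y _.
have -> : expi (- dotv (vecZ (x - y)) (v + xi0)) =
    expi (dotv (vecZ y) (v + xi0)) * expi (- dotv (vecZ x) (v + xi0)).
  by rewrite -expiD vecZB dotvDl dotvNl opprD opprK addrC.
ring.
Qed.

(** Orthogonality of characters. The exponent 0 is allowed as the start of the recursion, although
    [convpow] is meaningful only from 1 on. *)
Lemma integral_inversion0 x :
  integral_Rn (inversion_integrand 0 x) = ((2 * pi) ^+ d * (x == 0)%:R)%:C.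
Proof.
transitivity (((2 * pi) ^+ d * (x == 0)%:R)%:C * expi (- dotv (vecZ x) xi0)).
  have := integral_cube_expi (- x) (- dotv (vecZ x) xi0); rewrite oppr_eq0 => <-.
  congr integral_Rn; apply/funext => v; rewrite /inversion_integrand expr0 mul1r.
  by rewrite dotvDr -[- x]sub0r vecZB /vecZ map_mx0 sub0r dotvNl opprD.
have [->|_] := eqVneq x 0; last by rewrite mulr0 mul0r.
rewrite /vecZ map_mx0 (_ : dotv _ _ = 0) ?oppr0 ?expi0 ?mulr1//.
by rewrite /dotv big1// => i _; rewrite mxE mul0r.
Qed.

(* Expanding one factor [fourier phi] at a time turns the recursion defining
   [convpow] into one for the integrals. *)
Lemma fourier_inversion k x :
  integral_Rn (inversion_integrand k.+1 x) = ((2 * pi) ^+ d)%:C * convpow phi k.+1 x.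
Proof.
have stepE j z : integral_Rn (inversion_integrand j.+1 z) =
    \sum_(y <- supp) phi y * integral_Rn (inversion_integrand j (z - y)).
  rewrite -integral_Rn_sum; last by move=> y; exact: cint_inversion.
  by congr integral_Rn; apply/funext => v; exact: inversion_integrandS.
elim: k x => [|k ih] x.
  rewrite stepE /convpow/= -(sum_supp_pred1 x) mulr_sumr; apply: eq_bigr => y _.
  rewrite integral_inversion0 subr_eq0 [x == y]eq_sym.
  by case: (y == x); rewrite ?mulr1 ?mul1r ?mulr0 ?mul0r ?mulr0// mulrC.
rewrite stepE -[convpow phi k.+2 x]/(Defs.conv (convpow phi k.+1) phi x) convE mulr_sumr.
by apply: eq_bigr => y _; rewrite ih; ring.
Qed.

End Inversion.
End FourierInversion.

(** * Local and global estimates *)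

Section Estimates.
Context {R : realType}.
Local Notation Re := complex.Re.
Local Notation Im := complex.Im.
Local Notation normc := Normc.normc.

(** With u = Re z / |z|, sin(acos u) is |Im z| / |z|; the case split on the sign of Im z in [Arg]
    restores the sign. *)
Lemma LogK (z : R[i]) : z != 0 ->
  z = (expR (Re (Log z)))%:C * expi (Im (Log z)).
Proof.
move=> z0; have nz : 0 < normc z.
  rewrite lt_def normc_ge0 andbT; apply: contra z0 => /eqP h.
  by apply/eqP/Normc.eq0_normc.
set N := normc z in nz; pose u := Re z / N.
have u1 : -1 <= u <= 1.
  by rewrite -ler_norml normrM normfV (gtr0_norm nz) ler_pdivrMr// mul1r normr_Re_le.
have N2 : N ^+ 2 = Re z ^+ 2 + Im z ^+ 2.
  by rewrite /N; case: (z) => x y /=; rewrite sqr_sqrtr// addr_ge0// sqr_ge0.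
have cosA : cos (acos u) = u by rewrite acosK// in_itv/= u1.
have sinA : sin (acos u) = `|Im z| / N.
  rewrite sin_acos//.
  have -> : 1 - u ^+ 2 = (`|Im z| / N) ^+ 2.
    rewrite /u !expr_div_n real_normK ?num_real//.
    rewrite -[X in X - _](@divff _ (N ^+ 2)) ?sqrf_eq0 ?gt_eqF//.
    by rewrite -mulrBl N2 addrAC subrr add0r.
  by rewrite sqrtr_sqr ger0_norm// divr_ge0// ltW.
have reE : Re (Log z) = ln N by [].
have imE : Im (Log z) = if 0 <= Im z then acos u else - acos u by [].
rewrite reE imE lnK ?posrE//; apply: complex_eq; rewrite ?ReM ?ImM/= mul0r ?subr0 ?addr0.
  by case: ifP => _; rewrite ?cosN cosA mulrCA mulfV ?mulr1// gt_eqF.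
case: ifPn => [I0|I0]; rewrite ?sinN sinA.
  by rewrite ger0_norm// mulrCA mulfV ?mulr1// gt_eqF.
rewrite ltr0_norm; last by rewrite ltNge.
by rewrite mulNr opprK mulrCA mulfV ?mulr1// gt_eqF.
Qed.

Lemma sin_le_norm (y : R) : `|sin y| <= `|y|.
Proof.
wlog y0 : y / 0 <= y.
  move=> h; have [/h//|/ltW y0] := leP 0 y.
  by rewrite -normrN -sinN -(normrN y); apply: h; rewrite oppr_ge0.
have [c _] := MVT_segment y0 (fun x _ => is_derive_sin x)
  (continuous_subspaceT (@continuous_sin R)).
by rewrite sin0 !subr0 => ->; rewrite normrM ler_piMl// cos_max.
Qed.

Lemma cos_sub1_le_norm (y : R) : `|cos y - 1| <= `|y|.
Proof.
wlog y0 : y / 0 <= y.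
  move=> h; have [/h//|/ltW y0] := leP 0 y.
  by rewrite -cosN -(normrN y); apply: h; rewrite oppr_ge0.
have [c _] := MVT_segment y0 (fun x _ => is_derive_cos x)
  (continuous_subspaceT (@continuous_cos R)).
by rewrite cos0 subr0 => ->; rewrite normrM normrN ler_piMl// sin_max.
Qed.

Lemma expR_sub1_le_norm (x : R) : `|expR x - 1| <= `|x| * expR `|x|.
Proof.
have [x0|x0] := leP 0 x.
  rewrite !ger0_norm//; last by rewrite subr_ge0 -expR0 ler_expR.
  have := expR_ge1Dx (- x); rewrite expRN => h.
  have : expR x * (1 - x) <= 1 by rewrite -ler_pdivlMl ?expR_gt0// mulr1.
  by lra.
rewrite (ltr0_norm x0) ltr0_norm; last by rewrite subr_lt0 -expR0 ltr_expR.
rewrite opprB (@le_trans _ _ (- x))//; first by have := expR_ge1Dx x; lra.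
by rewrite ler_peMr ?oppr_ge0 ?(ltW x0)// -expR0 ler_expR oppr_ge0 ltW.
Qed.

(** One q e^q bounds e^x - 1; two more bound cos y - 1 and sin y, both multiplied by e^x. *)
Lemma normc_exp_sub1 (x y q : R) : `|x| <= q -> `|y| <= q ->
  normc ((expR x)%:C * expi y - 1) <= 3 * (q * expR q).
Proof.
move=> xq yq; have q0 : 0 <= q by rewrite (le_trans _ xq).
have -> : (expR x)%:C * expi y - 1 =
    (expR x - 1)%:C + (expR x)%:C * ((cos y - 1) +i* sin y).
  by apply: complex_eq; rewrite ?ReD ?ImD ?ReM ?ImM/=; ring.
have eq1 : expR x <= expR q by rewrite ler_expR (le_trans (ler_norm _)).
have h1 : `|expR x - 1| <= q * expR q.
  by rewrite (le_trans (expR_sub1_le_norm _))// ler_pM ?expR_ge0// ler_expR.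
have h2 : normc ((cos y - 1) +i* sin y) <= q + q.
  rewrite (le_trans (normc_le_ReIm _))//= lerD//.
    exact: le_trans (cos_sub1_le_norm _) yq.
  exact: le_trans (sin_le_norm _) yq.
rewrite (le_trans (normcD _ _))// Normc.normcM !normc_real (ger0_norm (expR_ge0 _)).
rewrite (@le_trans _ _ (q * expR q + expR q * (q + q)))//; last by lra.
by rewrite lerD// ler_pM ?expR_ge0// normc_ge0.
Qed.

(** With rho <= e^(-c) and m >= mu, the bound (c n)^(m+1) <= (m+1)! e^(c n) has one power of n to
    spare, which makes any n > C / eps large enough. *)
Lemma geometric_decay (rho mu eps : R) : 0 <= rho < 1 -> 0 < eps ->
  exists N : nat, forall n, (N < n)%N -> rho ^+ n <= eps * n%:R `^ (- mu).
Proof.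
move=> /andP[rho0 rho1] eps0.
have [c c0 rc] : exists2 c, 0 < c & rho <= expR (- c).
  have [->|r0] := eqVneq rho 0; first by exists 1; rewrite ?expR_ge0.
  have {}r0 : 0 < rho by rewrite lt_def r0.
  exists (- ln rho); first by rewrite oppr_gt0 ln_lt0// r0.
  by rewrite opprK lnK.
pose m := Num.bound `|mu|.
pose C := m.+1`!%:R / c ^+ m.+1.
have C0 : 0 <= C by rewrite divr_ge0// exprn_ge0// ltW.
exists (Num.bound (C / eps)) => n Nn.
have n0 : (0 < n)%N by case: n Nn.
have n0R : 0 < n%:R :> R by rewrite ltr0n.
have n1R : 1 <= n%:R :> R by rewrite ler1n.
have Ce : C <= eps * n%:R.
  rewrite -ler_pdivrMl// mulrC ltW// (lt_trans (archi_boundP _)) ?ltr_nat//.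
  by rewrite divr_ge0// ltW.
have nmu : n%:R `^ mu <= n%:R ^+ m.
  rewrite -powR_mulrn ?(ltW n0R)// ler_powR// (le_trans (ler_norm _))// ltW//.
  by rewrite archi_boundP.
rewrite powRN ler_pdivlMr ?powR_gt0//.
rewrite (@le_trans _ _ (expR (- (c * n%:R)) * n%:R ^+ m))//.
  rewrite ler_pM ?exprn_ge0 ?powR_ge0//.
  by rewrite (le_trans (_ : _ <= expR (- c) ^+ n))// ?lerXn2r ?nnegrE ?expR_ge0//
    -expRM_natl mulrN mulrC.
rewrite expRN mulrC ler_pdivrMr ?expR_gt0//.
have cn0 : 0 <= c * n%:R by rewrite mulr_ge0// ltW.
have := exprn_le_expR m.+1 cn0; rewrite exprMn => h.
have : n%:R ^+ m.+1 <= C * expR (c * n%:R).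
  by rewrite /C mulrAC ler_pdivlMr ?exprn_gt0// mulrC.
rewrite exprSr => {}h; rewrite -(ler_pM2r n0R) (le_trans h)//.
by rewrite [leRHS]mulrAC ler_wpM2r ?expR_ge0.
Qed.

Lemma compact_cV_annulus n (r L : R) :
  compact [set v : 'cV[R]_n | r <= `|v| <= L].
Proof.
apply: (@closed_bounded_compact_cV _ _ _ L) => [|v /andP[]//].
have -> : [set v : 'cV[R]_n | r <= `|v| <= L] =
    (fun v : 'cV[R]_n => `|v|) @^-1` [set x : R | r <= x] `&`
    (fun v : 'cV[R]_n => `|v|) @^-1` [set x : R | x <= L].
  by apply/seteqP; split => v /= => [/andP[]|[-> ->]].
by apply: closedI; apply: closed_comp => [v _|];
  [exact: norm_continuous|exact: closed_ge|exact: norm_continuous|exact: closed_le].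
Qed.

Section Polynomial.
Context {n : nat}.
Variables (P : 'cV[R]_n -> R).
Hypothesis polyP : is_polynomial P.

Lemma polynomial_continuous : continuous P.
Proof.
have [p hp] := polyP.
have -> : P = fun v => \sum_(m <- mpoly.msupp p) mpoly.mcoeff m p *
    \prod_(i < n) v i 0 ^+ mpoly.fun_of_multinom m i.
  by apply/funext => v; rewrite hp mpoly.mevalE.
apply: continuous_big => [|m _]; first exact: add_continuous.
have cprod : continuous (fun v : 'cV[R]_n =>
    \prod_(i < n) v i 0 ^+ mpoly.fun_of_multinom m i).
  apply: (@continuous_big R 'I_n *%R 1 xpredT) => [|i _]; first exact: mul_continuous.
  move=> w; apply: (@continuous_comp _ _ _ (fun v : 'cV[R]_n => v i 0)
    (fun x => x ^+ mpoly.fun_of_multinom m i)); first exact: coord_continuous.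
  exact: exprn_continuous.
by move=> v; apply: continuousM; [exact: cst_continuous|exact: cprod].
Qed.

Lemma polynomial_mreal : mreal P.
Proof.
have [p hp] := polyP.
have -> : P = fun v => \sum_(m <- mpoly.msupp p) mpoly.mcoeff m p *
    \prod_(i < n) v i 0 ^+ mpoly.fun_of_multinom m i.
  by apply/funext => v; rewrite hp mpoly.mevalE.
apply: mreal_sum => m; apply: mrealM; first exact: mreal_cst.
apply: measurable_prod => i _.
exact: (mreal_continuous (@exprn_continuous _ _) (@mreal_coord _ _ i)).
Qed.

Lemma mreal_expRN_polynomial s : mreal (fun v => expR (- (s * P v))).
Proof.
apply: (mreal_continuous (@continuous_expR R)).
have := mrealM (@mreal_cst _ n (- s)) polynomial_mreal.
by under eq_fun do rewrite mulNr.
Qed.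

End Polynomial.

(** P attains a positive minimum on the compact annulus r <= |v| <= L, and exceeds 1 beyond it. *)
Lemma coercive_gap n (P : 'cV[R]_n -> R) (L r : R) : continuous P ->
  positive_definite P -> (forall v, P v <= 1 -> `|v| <= L) -> 0 < r ->
  exists2 delta, 0 < delta & forall v, r <= `|v| -> delta <= P v.
Proof.
move=> cP [P0 Peq0] PL r0; pose A := [set v : 'cV[R]_n | r <= `|v| <= L].
have [A0|/set0P/negP/negPn/eqP A0] := pselect (A !=set0); last first.
  exists 1 => // v rv; rewrite leNgt; apply/negP => Pv.
  have : A v by rewrite /A/= rv PL// ltW.
  by rewrite A0.
have [c cA hc] := compact_EVT_min A0 (@compact_cV_annulus n r L)
  (continuous_subspaceT cP).
have Pc : 0 < P c.
  rewrite lt_def P0 andbT; apply: contraTneq cA => /Peq0 ->.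
  by rewrite notin_setE /A/= normr0 leNgt r0.
exists (Num.min 1 (P c)); first by rewrite lt_min ltr01.
move=> v rv; have [Pv|Pv] := leP (P v) 1; last by rewrite ge_min (ltW Pv).
by rewrite ge_min hc ?orbT// inE /A/= rv PL.
Qed.

End Estimates.

(** * The Fourier transform away from its maximum *)

Section FourierGap.
Context {R : realType}.
Local Notation Re := complex.Re.
Local Notation Im := complex.Im.
Local Notation normc := Normc.normc.

Lemma expi_2pi_intr (m : int) : expi (m%:~R * (2 * pi)) = 1 :> R[i].
Proof.
have e1 : expi (2 * pi) = 1 :> R[i].
  rewrite mulr_natl /expi cos2pi.
  by rewrite mulr2n sinDpi sinpi oppr0.
have nat1 (k : nat) : expi (k%:R * (2 * pi)) = 1 :> R[i].
  elim: k => [|k ih]; first by rewrite mul0r expi0.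
  by rewrite -natr1 mulrDl mul1r expiD ih e1 mulr1.
case: m => k; first exact: nat1.
rewrite NegzE mulrNz mulNr -[LHS]mulr1 -[X in _ * X](nat1 k.+1) -expiD.
by rewrite addNr expi0.
Qed.

Lemma dotv_vecZ n (x k : 'cV[int]_n) :
  dotv (vecZ x) (vecZ k) = (\sum_i x i 0 * k i 0)%:~R :> R.
Proof.
rewrite /dotv (big_morph (fun m : int => m%:~R : R) (@intrD R) erefl).
by apply: eq_bigr => i _; rewrite !mxE intrM.
Qed.

Lemma dotvZr n c (u v : 'cV[R]_n) : dotv u (c *: v) = c * dotv u v.
Proof. by rewrite dotvC dotvZl dotvC. Qed.

Lemma fourier_periodic n (phi : 'cV[int]_n -> R[i]) (k : 'cV[int]_n) (xi : 'cV[R]_n) :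
  fourier phi (xi + (2 * pi) *: vecZ k) = fourier phi xi.
Proof.
apply: eq_fsbigr => x _; congr (_ * _).
by rewrite dotvDr expiD dotvZr dotv_vecZ [2 * pi * _]mulrC expi_2pi_intr mulr1.
Qed.

Lemma torus_representative n (xi : 'cV[R]_n) :
  exists k : 'cV[int]_n, torus (xi + (2 * pi) *: vecZ k).
Proof.
have pi0 : 0 < 2 * pi :> R by rewrite mulr_gt0// pi_gt0.
(* The ceiling matches the closed right end of the interval (-pi, pi]. *)
exists (\col_i (- Num.ceil ((xi i 0 - pi) / (2 * pi)))) => i.
rewrite !mxE; set y := (_ / _); have /andP[] := ceil_itv y.
set c : int := Num.ceil y; rewrite intrB mulrNz /y.
by rewrite ltr_pdivlMr// ler_pdivrMr//; lra.
Qed.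

Section Gap.
Context {d : nat}.
Variables (phi : 'cV[int]_d -> R[i]) (xi0 : 'cV[R]_d).
Hypothesis hphi : finitely_supported phi.
Hypothesis hmax : forall xi : 'cV[R]_d, normc (fourier phi xi) <= 1.
Hypothesis hxi0_unique : forall xi : 'cV[R]_d, torus xi ->
  normc (fourier phi xi) = 1 -> xi = xi0.

Lemma continuous_dotv_shift n (u c : 'cV[R]_n) :
  continuous (fun v : 'cV[R]_n => dotv u (v + c)).
Proof.
apply: continuous_big => [|i _]; first exact: add_continuous.
move=> v; apply: continuousM; first exact: cst_continuous.
have -> : (fun v : 'cV[R]_n => (v + c) i 0) = (fun v : 'cV[R]_n => v i 0 + c i 0).
  by apply/funext => w; rewrite mxE.
apply: continuousD; last exact: cst_continuous.
exact: coord_continuous.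
Qed.

Lemma continuous_normc_fourier : continuous (fun v : 'cV[R]_d => normc (fourier phi (v + xi0))).
Proof.
have cadd (f g : 'cV[R]_d -> R) : continuous f -> continuous g ->
    continuous (fun v => f v + g v) by move=> cf cg v; exact: (cvgD (cf v) (cg v)).
have cmul (f g : 'cV[R]_d -> R) : continuous f -> continuous g ->
    continuous (fun v => f v * g v) by move=> cf cg v; exact: (cvgM (cf v) (cg v)).
have normcE (z : R[i]) : normc z = Num.sqrt (Re z ^+ 2 + Im z ^+ 2) by case: z.
have ccos u : continuous (fun v : 'cV[R]_d => cos (dotv u (v + xi0)) : R).
  move=> v; apply: (@continuous_comp _ _ _ (fun v : 'cV[R]_d => dotv u (v + xi0)) cos).
    exact: continuous_dotv_shift.
  exact: continuous_cos.
have csin u : continuous (fun v : 'cV[R]_d => sin (dotv u (v + xi0)) : R).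
  move=> v; apply: (@continuous_comp _ _ _ (fun v : 'cV[R]_d => dotv u (v + xi0)) sin).
    exact: continuous_dotv_shift.
  exact: continuous_sin.
have cRe : continuous (fun v : 'cV[R]_d => Re (fourier phi (v + xi0))).
  under eq_fun do rewrite fourierE// (big_morph (@complex.Re R) (@ReD R) erefl).
  apply: continuous_big => [|y _]; first exact: add_continuous.
  have -> : (fun v : 'cV[R]_d => Re (expi (dotv (vecZ y) (v + xi0)) * phi y)) =
      fun v => cos (dotv (vecZ y) (v + xi0)) * Re (phi y) +
               sin (dotv (vecZ y) (v + xi0)) * (- Im (phi y)).
    by apply/funext => v; rewrite ReM mulrN.
  by apply: cadd; apply: cmul => //; exact: cst_continuous.
have cIm : continuous (fun v : 'cV[R]_d => Im (fourier phi (v + xi0))).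
  under eq_fun do rewrite fourierE// (big_morph (@complex.Im R) (@ImD R) erefl).
  apply: continuous_big => [|y _]; first exact: add_continuous.
  have -> : (fun v : 'cV[R]_d => Im (expi (dotv (vecZ y) (v + xi0)) * phi y)) =
      fun v => cos (dotv (vecZ y) (v + xi0)) * Im (phi y) +
               sin (dotv (vecZ y) (v + xi0)) * Re (phi y).
    by apply/funext => v; rewrite ImM.
  by apply: cadd; apply: cmul => //; exact: cst_continuous.
have -> : (fun v : 'cV[R]_d => normc (fourier phi (v + xi0))) = fun v => Num.sqrt
    (Re (fourier phi (v + xi0)) * Re (fourier phi (v + xi0)) +
     Im (fourier phi (v + xi0)) * Im (fourier phi (v + xi0))).
  by apply/funext => v; rewrite normcE !expr2.
move=> v; apply: (@continuous_comp _ _ _ (fun v : 'cV[R]_d =>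
  Re (fourier phi (v + xi0)) * Re (fourier phi (v + xi0)) +
  Im (fourier phi (v + xi0)) * Im (fourier phi (v + xi0))) Num.sqrt).
  by apply: (cadd _ _); apply: cmul.
exact: sqrt_continuous.
Qed.

(** The point v + xi0 may leave the torus. Brought back by a multiple of 2 pi, it would coincide
    with xi0 by uniqueness, so v would be a nonzero vector of the lattice 2 pi Z^d, of norm at least
    2 pi. *)
Lemma fourier_lt1 (v : 'cV[R]_d) : v != 0 -> `|v| <= pi ->
  normc (fourier phi (v + xi0)) < 1.
Proof.
move=> v0 vpi; rewrite lt_neqAle hmax andbT; apply/eqP => f1.
have [k hk] := torus_representative (v + xi0).
have := hxi0_unique hk; rewrite fourier_periodic => /(_ f1) /eqP.
rewrite addrAC -subr_eq0 addrK addr_eq0 => /eqP vE.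
case/negP: v0; apply/eqP; rewrite vE.
suff -> : k = 0 by rewrite /vecZ map_mx0 scaler0 oppr0.
apply/matrixP => i j; rewrite (ord1 j) [RHS]mxE.
have := le_trans (mx_norm_coord v i 0) vpi; rewrite vE !mxE normrN normrM.
have pi0 : 0 < pi :> R by exact: pi_gt0.
rewrite ger0_norm ?mulr_ge0 ?(ltW pi0)// -intr_norm.
have [//|k0] := eqVneq (k i 0) 0.
have : 1 <= `|k i 0| by rewrite -gtz0_ge1 normr_gt0.
rewrite -(ler_int R) mulr1z => k1.
have p2 : 0 <= 2 * pi :> R by rewrite mulr_ge0// ltW.
by have := ler_wpM2l p2 k1 => h1 h2; exfalso; lra.
Qed.

Lemma fourier_gap (r : R) : 0 < r -> exists2 rho, 0 <= rho < 1 &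
  forall v : 'cV[R]_d, r <= `|v| -> `|v| <= pi -> normc (fourier phi (v + xi0)) <= rho.
Proof.
move=> r0; pose A := [set v : 'cV[R]_d | r <= `|v| <= pi].
have [A0|/set0P/negP/negPn/eqP A0] := pselect (A !=set0); last first.
  (* The annulus is empty, for instance when r > pi, so any bound will do. *)
  exists 0 => [|v rv vpi]; first by rewrite lexx ltr01.
  by have : A v by [rewrite /A/= rv vpi]; rewrite A0.
have [c cA hc] := compact_EVT_max A0 (@compact_cV_annulus R d r pi)
  (continuous_subspaceT continuous_normc_fourier).
move: cA; rewrite inE /A/= => /andP[rc cpi].
exists (normc (fourier phi (c + xi0))).
  rewrite normc_ge0/= fourier_lt1// -normr_gt0; exact: lt_le_trans rc.
by move=> v rv vpi; apply: hc; rewrite inE /A/= rv.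
Qed.

End Gap.
End FourierGap.

(** * Pointwise error of the local expansion *)

Section PointwiseBounds.
Context {R : realType}.
Local Notation Re := complex.Re.
Local Notation Im := complex.Im.
Local Notation normc := Normc.normc.

Lemma expiX (x : R) n : expi x ^+ n = expi (n%:R * x).
Proof.
elim: n => [|n ih]; first by rewrite expr0 mul0r expi0.
by rewrite exprS ih -expiD -natr1 mulrDl mul1r addrC.
Qed.

Lemma expRCX (x : R) n : (expR x)%:C ^+ n = (expR (n%:R * x))%:C :> R[i].
Proof. by rewrite -rmorphXn/= -expRM_natl. Qed.

Lemma Gamma_polar d (phi : 'cV[int]_d -> R[i]) (xi0 xi alpha : 'cV[R]_d)
    (p : R) (r : R[i]) :
  fourier phi xi0 != 0 -> fourier phi (xi + xi0) != 0 ->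
  Gamma phi xi0 xi = 'i%C * (dotv alpha xi)%:C - p%:C + r ->
  fourier phi (xi + xi0) =
  fourier phi xi0 * ((expR (- p + Re r))%:C * expi (dotv alpha xi + Im r)).
Proof.
move=> f0 fxi; rewrite /Gamma => GE.
have w0 : fourier phi (xi + xi0) / fourier phi xi0 != 0.
  by rewrite mulf_neq0// invr_neq0.
have := LogK w0; rewrite GE => wE.
rewrite -[LHS](divfK f0) wE mulrC; congr (_ * ((expR _)%:C * expi _)).
  by rewrite !ReD ReM/=; case: (r) => ? ? /=; ring.
by rewrite !ImD ImM/=; case: (r) => ? ? /=; ring.
Qed.

(** The model factors out and leaves e^(n r) - 1 with n |r| <= e u, where u = n p. By
    [normc_exp_sub1] the error is at most 3 e u e^(-u + e u); giving up part of the exponent turns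
    the factor u into 4, whence 12 = 3 * 4. *)
Lemma normc_phase_sub (theta r : R[i]) (p t s s0 e : R) n : normc theta = 1 ->
  0 <= p -> 0 <= e <= 2^-1 -> normc r <= e * p ->
  normc ((theta * ((expR (- p + Re r))%:C * expi (t + Im r))) ^+ n *
           expi (- (s + s0)) -
         theta ^+ n * expi (- s0) *
           ((expR (- (n%:R * p)))%:C * expi (- (s - n%:R * t)))) <=
  12 * e * expR (- (n%:R / 4 * p)).
Proof.
move=> th1 p0 /andP[e0 e2] re.
have n0 : 0 <= n%:R :> R by [].
pose u := n%:R * p; have u0 : 0 <= u by rewrite mulr_ge0.
have -> : (theta * ((expR (- p + Re r))%:C * expi (t + Im r))) ^+ n *
      expi (- (s + s0)) -
    theta ^+ n * expi (- s0) * ((expR (- (n%:R * p)))%:C * expi (- (s - n%:R * t))) =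
    theta ^+ n * expi (- s0) * ((expR (- (n%:R * p)))%:C * expi (- (s - n%:R * t))) *
    ((expR (n%:R * Re r))%:C * expi (n%:R * Im r) - 1).
  rewrite !exprMn expRCX expiX mulrDr mulrN expRD rmorphM/= mulrDr expiD.
  rewrite opprD expiD opprB [n%:R * t - s]addrC expiD; ring.
have rn : n%:R * normc r <= e * u.
  by rewrite /u mulrCA ler_wpM2l.
rewrite !Normc.normcM normcX th1 expr1n !normc_expi normc_real !mul1r mulr1.
rewrite ger0_norm ?expR_ge0//.
have := @normc_exp_sub1 R (n%:R * Re r) (n%:R * Im r) (e * u).
rewrite !normrM !(ger0_norm n0) => h.
rewrite (le_trans (ler_wpM2l (expR_ge0 _) (h _ _)))//.
- by rewrite (le_trans _ rn)// ler_wpM2l// normr_Re_le.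
- by rewrite (le_trans _ rn)// ler_wpM2l// normr_Im_le.
have -> : expR (- (n%:R * p)) * (3 * (e * u * expR (e * u))) =
    3 * e * (u * expR (- u + e * u)) by rewrite expRD -/u; ring.
have -> : 12 * e * expR (- (n%:R / 4 * p)) = 3 * e * (4 * expR (- (u / 4))).
  by have -> : n%:R / 4 * p = u / 4; rewrite /u; ring.
rewrite ler_wpM2l ?mulr_ge0//.
(* As e <= 1/2, half of the exponent survives; half of that is then spent on u / 4 <= e^(u / 4). *)
rewrite (@le_trans _ _ (u * expR (- (u / 2))))//.
  by rewrite ler_wpM2l// ler_expR; nra.
have -> : u * expR (- (u / 2)) = 4 * (u / 4 * expR (- (u / 4))) * expR (- (u / 4)).
  have -> : expR (- (u / 2)) = expR (- (u / 4)) * expR (- (u / 4)).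
    by rewrite -expRD; congr expR; lra.
  by field.
rewrite ler_wpM2r ?expR_ge0// ler_piMr// expRN ler_pdivrMr ?expR_gt0// mul1r.
by have := expR_ge1Dx (u / 4); lra.
Qed.

Lemma IcolD n (F G : 'cV[R]_n -> R) : mreal F -> mreal G ->
  (forall v, 0 <= F v) -> (forall v, 0 <= G v) ->
  Icol (fun v => (F v + G v)%:E) =
  (Icol (fun v => (F v)%:E) + Icol (fun v => (G v)%:E))%E.
Proof.
move=> mF mG F0 G0; rewrite /Icol -ge0_integralD//.
- by move=> t _; rewrite lee_fin.
- exact: mreal_mcol.
- by move=> t _; rewrite lee_fin.
- exact: mreal_mcol.
Qed.

Lemma Icol_realZ n (F : 'cV[R]_n -> R) (k : R) : mreal F -> (forall v, 0 <= F v) ->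
  0 <= k -> Icol (fun v => (k * F v)%:E) = (k%:E * Icol (fun v => (F v)%:E))%E.
Proof.
move=> mF F0 k0; rewrite -IcolZl//; exact: mreal_mcol.
Qed.

End PointwiseBounds.

(** * Integrating the error *)

Section LocalLimit.
Context {R : realType} {d : nat}.
Local Notation normc := Normc.normc.
Variables (phi : 'cV[int]_d -> R[i]) (xi0 alpha : 'cV[R]_d) (U : set 'cV[R]_d)
  (P : 'cV[R]_d -> R) (Rem : 'cV[R]_d -> R[i]).
Hypothesis hphi : finitely_supported phi.
Hypothesis hxi0_max : normc (fourier phi xi0) = 1.
Hypothesis hU_dom : forall xi, U xi -> fourier phi (xi + xi0) != 0.
Hypothesis hGamma : forall xi, U xi ->
  Gamma phi xi0 xi = 'i%C * (dotv alpha xi)%:C - (P xi)%:C + Rem xi.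
Hypothesis P0 : forall xi, 0 <= P xi.
Hypothesis mP : forall s, mreal (fun v : 'cV[R]_d => expR (- (s * P v))).

Let theta := fourier phi xi0.
Let heat_integrand (t : R) (x : 'cV[R]_d) (v : 'cV[R]_d) : R[i] :=
  (expR (- (t * P v)))%:C * expi (- dotv x v).
(** One integrand for the whole error: near 0 its two terms almost cancel, elsewhere each of them is
    small. *)
Let error_integrand n (x : 'cV[int]_d) (v : 'cV[R]_d) : R[i] :=
  inversion_integrand phi xi0 n x v +
  (- (theta ^+ n * expi (- dotv (vecZ x) xi0))) *
  heat_integrand n%:R (vecZ x - n%:R *: alpha) v.

Let cmeas_heat t x : cmeas (heat_integrand t x).
Proof.
apply: cmeasM; first exact: cmeas_real.
by apply: cmeas_expi; under eq_fun do rewrite -dotvNl; exact: mreal_dotv.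
Qed.

Let normc_heat t x v : normc (heat_integrand t x v) = expR (- (t * P v)).
Proof.
by rewrite /heat_integrand Normc.normcM normc_expi mulr1 normc_real ger0_norm ?expR_ge0.
Qed.

Let twist1 n x : normc (theta ^+ n * expi (- x)) = 1.
Proof. by rewrite Normc.normcM normcX normc_expi hxi0_max expr1n mulr1. Qed.

Let normcN (z : R[i]) : normc (- z) = normc z.
Proof. by case: z => ? ? /=; rewrite !sqrrN. Qed.

Lemma error_integrand_local n x v (e : R) : U v -> `|v| <= pi -> 0 <= e <= 2^-1 ->
  normc (Rem v) <= e * P v ->
  normc (error_integrand n x v) <= 12 * e * expR (- (n%:R / 4 * P v)).
Proof.
move=> Uv vpi e01 he; have theta0 : theta != 0.
  by apply/eqP => t0; move: hxi0_max; rewrite -/theta t0 Normc.normc0 => /esym/eqP;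
    rewrite oner_eq0.
rewrite /error_integrand /inversion_integrand /heat_integrand cubeE vpi/= rmorph1 mul1r.
rewrite mulNr (Gamma_polar theta0 (hU_dom Uv) (hGamma Uv)) dotvDr dotvDl dotvNl dotvZl.
exact: normc_phase_sub.
Qed.

(** Of the n + 1 copies of P in the exponent, n are replaced by [delta] and one is kept for
    integrability. The first term of the integrand vanishes outside the cube. *)
Lemma error_integrand_far n x v (rho delta : R) : 0 <= rho ->
  (`|v| <= pi -> normc (fourier phi (v + xi0)) <= rho) -> delta <= P v ->
  normc (error_integrand n.+1 x v) <=
  cube v * rho ^+ n.+1 + expR (- (n%:R * delta)) * expR (- (1 * P v)).
Proof.
move=> rho0 hrho hdelta; rewrite (le_trans (normcD _ _))// lerD//.
  rewrite /inversion_integrand !Normc.normcM normc_expi mulr1 normc_real ger0_norm ?cube_ge0//.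
  rewrite cubeE; case: (leP `|v| pi) => [vpi|_]; rewrite ?mul0r// !mul1r normcX.
  by rewrite lerXn2r ?nnegrE ?normc_ge0 ?hrho.
rewrite Normc.normcM normc_heat normcN twist1 mul1r.
rewrite -expRD ler_expR -natr1 mulrDl mul1r opprD lerD2r lerN2.
by rewrite ler_wpM2l.
Qed.

Variables (mu K : R).
Hypothesis hK : forall s, 1 <= s ->
  (Icol (fun v => (expR (- (s * P v)))%:E) <= (K * s `^ (- mu))%:E)%E.

(** The local bound calls for [hK] at s = (n + 1) / 4, and 4 <= n + 1 makes this s admissible; the
    far bound uses s = 1. *)
Lemma convpow_heat_kernel_le n x (e r rho delta : R) : (4 <= n.+1)%N ->
  0 <= e <= 2^-1 -> 0 <= rho -> r <= pi ->
  (forall v, `|v| < r -> U v /\ normc (Rem v) <= e * P v) ->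
  (forall v, r <= `|v| -> `|v| <= pi -> normc (fourier phi (v + xi0)) <= rho) ->
  (forall v, r <= `|v| -> delta <= P v) ->
  normc (convpow phi n.+1 x - theta ^+ n.+1 * expi (- dotv (vecZ x) xi0)
         * heat_kernel P n.+1%:R (vecZ x - n.+1%:R *: alpha)) <=
  ((2 * pi) ^+ d)^-1 * (2 * (12 * e * (K * (n.+1%:R / 4) `^ (- mu)) +
    ((2 * pi) ^+ d * rho ^+ n.+1 + expR (- (n%:R * delta)) * K))).
Proof.
move=> n4 /andP[e0 e2] rho0 rpi hloc hrho hdelta.
have pi0 : 0 < (2 * pi) ^+ d :> R by rewrite exprn_gt0// mulr_gt0// pi_gt0.
have n4R : 1 <= n.+1%:R / 4 :> R by rewrite ler_pdivlMr// mul1r ler_nat.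
have n1R : 1 <= n.+1%:R :> R by rewrite ler1n.
set E1 := 12 * e * _; set E2 := (2 * pi) ^+ d * _; set E3 := _ * K.
have cheat : cint (heat_integrand n.+1%:R (vecZ x - n.+1%:R *: alpha)).
  split; first exact: cmeas_heat.
  exists (fun v => expR (- (n.+1%:R * P v))); split => //.
    by move=> v; rewrite normc_heat.
  by eexists; apply: hK.
have -> : convpow phi n.+1 x - theta ^+ n.+1 * expi (- dotv (vecZ x) xi0)
         * heat_kernel P n.+1%:R (vecZ x - n.+1%:R *: alpha) =
    (((2 * pi) ^+ d)^-1)%:C * integral_Rn (error_integrand n.+1 x).
  rewrite integral_RnD; [|exact: cint_inversion|exact: cintZ].
  rewrite integral_RnZ// fourier_inversion// mulrDr mulrA -rmorphM/= mulVf ?gt_eqF//.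
  by rewrite mul1r /heat_kernel; ring.
rewrite Normc.normcM normc_real ger0_norm ?invr_ge0 ?(ltW pi0)// ler_wpM2l ?invr_ge0 ?(ltW pi0)//.
pose G1 v := 12 * e * expR (- (n.+1%:R / 4 * P v)).
pose G2 (v : 'cV[R]_d) := cube v * rho ^+ n.+1.
pose G3 v := expR (- (n%:R * delta)) * expR (- (1 * P v)).
have mG1 : mreal G1 by apply: mrealM; [exact: mreal_cst|exact: mP].
have mG2 : mreal G2 by apply: mrealM; [exact: mreal_cube|exact: mreal_cst].
have mG3 : mreal G3 by apply: mrealM; [exact: mreal_cst|exact: mP].
have G10 v : 0 <= G1 v by rewrite !mulr_ge0// expR_ge0.
have G20 v : 0 <= G2 v by rewrite mulr_ge0 ?cube_ge0// exprn_ge0.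
have G30 v : 0 <= G3 v by rewrite mulr_ge0// expR_ge0.
(* Adding the local and far bounds gives a majorant valid everywhere, so the domain of integration
   need not be split. *)
apply: (@normc_integral_le _ _ _ (fun v => G1 v + (G2 v + G3 v))).
- apply: cmeasD; first by case: (cint_inversion xi0 hphi n.+1 x).
  by apply: cmeasM; [exact: cmeas_cst|exact: cmeas_heat].
- by apply: mrealD => //; exact: mrealD.
- move=> v; case: (ltP `|v| r) => vr.
    have [Uv hRem] := hloc _ vr.
    rewrite (le_trans (error_integrand_local _ _ Uv _ _ hRem)) ?e0//.
      by rewrite (le_trans _ rpi)// ltW.
    by rewrite lerDl addr_ge0.
  rewrite (le_trans (error_integrand_far _ _ rho0 (hrho _ vr) (hdelta _ vr)))//.
  by rewrite lerDr.
rewrite IcolD//; [|exact: mrealD|by move=> v; rewrite addr_ge0].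
rewrite IcolD// EFinD leeD//; last first.
  rewrite EFinD leeD// ?Icol_cube ?exprn_ge0//.
  rewrite /G3 Icol_realZ ?expR_ge0//.
  rewrite /E3 EFinM lee_wpmul2l ?lee_fin ?expR_ge0//.
  by rewrite (le_trans (hK _))// powR1 mulr1.
rewrite /G1 Icol_realZ ?mulr_ge0//.
rewrite /E1 [leRHS]EFinM lee_wpmul2l ?lee_fin ?mulr_ge0//; exact: hK.
Qed.

End LocalLimit.
Arguments convpow_heat_kernel_le {R d phi xi0 alpha U P Rem} _ _ _ _ _ _ {mu K} _ {n} x
  {e r rho delta}.

(** * Choice of the constants in the local limit theorem *)

Theorem theorem5p1 (R : realType) (a b : nat) (ha : (0 < a)%N) (hb : (0 < b)%N)
  (phi : 'cV[int]_(a + b) -> R[i]) (hphi : finitely_supported phi)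
  (hmax : forall xi : 'cV[R]_(a + b), Normc.normc (fourier phi xi) <= 1)
  (xi0 : 'cV[R]_(a + b)) (hxi0 : torus xi0)
  (hxi0_max : Normc.normc (fourier phi xi0) = 1)
  (hxi0_unique : forall xi : 'cV[R]_(a + b), torus xi ->
     Normc.normc (fourier phi xi) = 1 -> xi = xi0)
  (U : set 'cV[R]_(a + b)) (hU : open U) (hU0 : U 0)
  (hU_dom : forall xi, U xi -> fourier phi (xi + xi0) != 0)
  (alpha : 'cV[R]_(a + b)) (P : 'cV[R]_(a + b) -> R)
  (Rem : 'cV[R]_(a + b) -> R[i])
  (hGamma : forall xi, U xi ->
     Gamma phi xi0 xi = 'i%C * (dotv alpha xi)%:C - (P xi)%:C + Rem xi)
  (hP_poly : is_polynomial P) (hP_pos : positive_definite P)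
  (hRem_Re : smooth U (fun xi => complex.Re (Rem xi)))
  (hRem_Im : smooth U (fun xi => complex.Im (Rem xi)))
  (hRem_o : forall eps : R, 0 < eps ->
     \forall xi \near (0 : 'cV[R]_(a + b)),
       Normc.normc (Rem xi) <= eps * P xi)
  (P1 P2 : 'cV[R]_a -> R) (Q : 'cV[R]_b -> 'cV[R]_a)
  (hP : forall eta zeta, P (col_mx eta zeta) = P1 (eta + Q zeta) + P2 eta)
  (hP1 : positive_homogeneous P1) (hP2 : positive_homogeneous P2)
  (hQ_C1 : Ck 1 setT Q) (hQ : nondegenerate_multivariate_homogeneous Q)
  (E1 E2 : 'M[R]_a) (F1 F2 : 'M[R]_b)
  (hE1 : Exp P1 E1) (hE2 : Exp P2 E2)
  (hQ1 : homogeneous_wrt Q E1 F1) (hQ2 : homogeneous_wrt Q E2 F2)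
  (hcomm : E1 *m E2 - E2 *m E1 = 0) (hE12 : nonexpanding (E1 - E2)) :
  let mu := homogeneous_order P1
            + homogeneous_order (fun zeta : 'cV[R]_b => P2 (- Q zeta)) in
  mu = \tr E1 + \tr F2 /\
  forall eps : R, 0 < eps ->
    exists2 N : nat, (0 < N)%N &
      forall (n : nat) (x : 'cV[int]_(a + b)), (N <= n)%N ->
        Normc.normc (convpow phi n x
          - fourier phi xi0 ^+ n * expi (- dotv (vecZ x) xi0)
            * heat_kernel P n%:R (vecZ x - n%:R *: alpha))
        < eps * n%:R `^ (- mu).

Proof.
move=> mu.
have [hP2Q hF2] := positive_homogeneous_comp_opp hP2 hQ hE2 hQ2.
have muE : mu = \tr E1 + \tr F2.
  by rewrite /mu (homogeneous_order_mxtrace hP1 hE1) (homogeneous_order_mxtrace hP2Q hF2).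
split=> // eps eps0.
have mP := mreal_expRN_polynomial hP_poly.
have [K K0 hK] := Icol_expRN_le hP hP1 hP2 hQ hE1 hE2 hQ2 hcomm hE12
  (fun s => mreal_mcol (mP s)).
rewrite -muE in hK.
set kappa := ((2 * pi) ^+ (a + b))^-1 : R.
have pi0 : 0 < (2 * pi) ^+ (a + b) :> R by rewrite exprn_gt0// mulr_gt0// pi_gt0.
have kappa0 : 0 < kappa by rewrite invr_gt0.
(* The coefficient of e n^(-mu) in the local term: 24 = 2 * 12, and 4^mu comes from (n /
   4)^(-mu). *)
pose A : R := kappa * 24 * K * 4 `^ mu.
have A0 : 0 <= A by rewrite !mulr_ge0 ?powR_ge0// ltW.
(* At most 1/2 for the local estimate, and small enough for A e <= eps / 4; the added 1 avoids a
   division by zero. *)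
pose e := Num.min 2^-1 (eps / 4 / (A + 1)).
have e0 : 0 < e by rewrite lt_min invr_gt0 ltr0n/= !divr_gt0// ltr_wpDl.
have [r [r0 rpi hloc]] : exists r, [/\ 0 < r, r <= pi & forall v,
    `|v| < r -> U v /\ Normc.normc (Rem v) <= e * P v].
  have : \forall v \near (0 : 'cV[R]_(a + b)), U v /\ Normc.normc (Rem v) <= e * P v.
    by near=> v; split; near: v; [exact: open_nbhs_nbhs|exact: hRem_o].
  move=> /nbhs_ballP[r' /= r'0 hr]; exists (Num.min r' pi).
  split=> [||v]; first by rewrite lt_min r'0 pi_gt0.
    by rewrite ge_min lexx orbT.
  rewrite lt_min => /andP[vr _]; apply: hr.
  by rewrite mx_norm_ball /ball_ /= sub0r normrN.
have [rho rho01 hrho] := fourier_gap hphi hmax hxi0_unique r0.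
have [L [m L1 hL]] := norm_le_phase_polynomial hP hP1 hP2 hQ hE1 hE2 hQ2.
have [delta delta0 hdelta] : exists2 delta, 0 < delta & forall v, r <= `|v| -> delta <= P v.
  (* Where P <= 1, the growth bound gives |v| <= L 2^m. *)
  apply: (@coercive_gap _ _ _ (L * 2 ^+ m)) => //; first exact: polynomial_continuous.
  have [P0 _] := hP_pos; move=> v Pv; rewrite (le_trans (hL v))//.
  by rewrite ler_wpM2l ?(le_trans _ L1)// lerXn2r ?nnegrE ?addr_ge0//; have := P0 v; lra.
(* The coefficient of e^(-delta n) in the far term, where [expR delta] makes up for the copy of P
   that was kept. *)
pose B := kappa * 2 * K * expR delta.
have B0 : 0 <= B by rewrite !mulr_ge0 ?expR_ge0// ltW.
(* The geometric term carries a factor 2, so eps / 8 gives it eps / 4; the three terms then total 3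
   eps / 4, which makes the final inequality strict. *)
have eps8 : 0 < eps / 8 by rewrite divr_gt0.
have epsB : 0 < eps / 4 / (B + 1) by rewrite !divr_gt0// ltr_wpDl.
have [N1 hN1] := geometric_decay mu rho01 eps8.
have [|N2 hN2] := @geometric_decay _ (expR (- delta)) mu _ _ epsB.
  by rewrite expR_ge0 expR_lt1 oppr_lt0.
(* The added 4 gives n >= 4 and makes n strictly larger than both thresholds. *)
exists (maxn N1 N2).+4 => // -[//|n] x nN.
have n4 : (4 <= n.+1)%N by rewrite (leq_trans _ nN).
have nN1 : (N1 < n.+1)%N.
  by rewrite (leq_ltn_trans (leq_maxl N1 N2))// (leq_trans _ nN)// !ltnS leqW// leqW.
have nN2 : (N2 < n.+1)%N.
  by rewrite (leq_ltn_trans (leq_maxr N1 N2))// (leq_trans _ nN)// !ltnS leqW// leqW.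
have [P0 _] := hP_pos; have /andP[rho0 _] := rho01.
have e2 : 0 <= e <= 2^-1 by rewrite ltW//= ge_min lexx.
have := convpow_heat_kernel_le hphi hxi0_max hU_dom hGamma P0 mP hK x n4
  e2 rho0 rpi hloc hrho hdelta.
move/le_lt_trans; apply; rewrite -/kappa.
set t := n.+1%:R `^ (- mu); have t0 : 0 < t by rewrite powR_gt0.
have -> : (n.+1%:R / 4) `^ (- mu) = 4 `^ mu * t.
  by rewrite powRM ?invr_ge0// mulrC -powR_inv1// -powRrM mulN1r opprK.
have -> : expR (- (n%:R * delta)) = expR delta * expR (- delta) ^+ n.+1.
  by rewrite -expRM_natl -expRD; congr expR; rewrite -natr1; ring.
have frac y : 0 <= y -> y * (eps / 4 / (y + 1)) <= eps / 4.
  move=> y0; rewrite mulrA ler_pdivrMr ?ltr_wpDl// mulrC ler_wpM2l ?lerDl//.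
  by rewrite divr_ge0// ltW.
have h1 : A * e <= eps / 4.
  rewrite (@le_trans _ _ (A * (eps / 4 / (A + 1))))//.
    by rewrite ler_wpM2l// ge_min lexx orbT.
  exact: frac.
have h2 := hN1 _ nN1.
have h3 : B * expR (- delta) ^+ n.+1 <= eps / 4 * t.
  rewrite (le_trans (ler_wpM2l B0 (hN2 _ nN2)))// -/t mulrA ler_wpM2r ?(ltW t0)//.
  exact: frac.
have -> : kappa * (2 * (12 * e * (K * (4 `^ mu * t)) +
    ((2 * pi) ^+ (a + b) * rho ^+ n.+1 + expR delta * expR (- delta) ^+ n.+1 * K))) =
    A * e * t + 2 * rho ^+ n.+1 + B * expR (- delta) ^+ n.+1.
  have : kappa * (2 * pi) ^+ (a + b) = 1 by rewrite mulVf// gt_eqF.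
  rewrite /A /B; move: (_ ^+ (a + b)) => c kc.
  have -> : 2 * rho ^+ n.+1 = kappa * c * (2 * rho ^+ n.+1) by rewrite kc mul1r.
  by ring.
have := ler_wpM2r (ltW t0) h1; rewrite -/t in h2; have := mulr_gt0 eps0 t0; lra.
Unshelve. all: by end_near.
Qed.
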